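(* Let $f,g\in L_2$. Then $$\int_{\mathbb{R}^n}f^{\dagger}(x)g(x)\,dm(x)=\int_{\mathbb{R}^n}(\mathcal{F}_o f)^{\dagger}(x)(\mathcal{F}_o g)(x)\,dm(x)$$ and $$\int_{\mathbb{R}^n}f(x)g^{\dagger}(x)\,dm(x)=\int_{\mathbb{R}^n}(f\mathcal{F}_o)(x)(g\mathcal{F}_o)^{\dagger}(x)\,dm(x).$$
   Context: $\mathcal{G}_{2n}$ is the real Clifford algebra generated by an orthonormal basis $e_1,\dots,e_n,e'_1,\dots,e'_n$ of $\mathbb{R}^{2n}$, with $v^2=v\cdot v$ for all vectors $v$ (so basis vectors square to $1$ and distinct basis vectors anticommute). The reversion $\dagger$ is the anti-involution of $\mathcal{G}_{2n}$ fixing every vector. The norm is $|A|^2=\sum_I\alpha_I^2$ for $A=\sum_I\alpha_I e_I$ in the standard basis of ordered products of basis vectors. Put $B_i=e_ie'_i$; then $B_i^2=-1$ and $B_iB_j=B_jB_i$. The measure is $dm(x)=(2\pi)^{-n/2}dx$ on $\mathbb{R}^n$, with $dx$ Lebesgue measure; for $p=1,2$, $L_p$ is the space of (classes of) measurable functions $f\colon\mathbb{R}^n\to\mathcal{G}_{2n}$ with $\|f\|_p=\left(\int_{\mathbb{R}^n}|f|^p\,dm\right)^{1/p}<\infty$. With $I(x,y)=\sum_{i=1}^nB_ix_iy_i$ for $x,y\in\mathbb{R}^n$, the left and right Clifford-Fourier transforms are, for $f\in L_1\cap L_2$, $$(\mathcal{F}_o f)(y)=\int_{\mathbb{R}^n}e^{-I(x,y)}f(x)\,dm(x),\qquad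 (f\mathcal{F}_o)(y)=\int_{\mathbb{R}^n}f(x)e^{-I(x,y)}\,dm(x);$$ these maps are $L_2$-isometric on $L_1\cap L_2$, and for general $f\in L_2$ the symbols $\mathcal{F}_of$ and $f\mathcal{F}_o$ denote their unique continuous extensions to $L_2$. *)

(* Defs.v *)
From HB Require Import structures.
From mathcomp Require Import all_boot all_order all_algebra.

Set Implicit Arguments.
Unset Strict Implicit.
Unset Printing Implicit Defensive.
Import Order.TTheory GRing.Theory Num.Theory.

Local Open Scope ring_scope.

(* An element of the Clifford algebra of the Euclidean space R^m is given by
   its coefficients on the ordered products e_I = e_{i_1} ... e_{i_k},
   I = {i_1 < ... < i_k}. *)
Definition clifford (R : comNzRingType) (m : nat) : Type :=
  {ffun {set 'I_m} -> R}.

Section blades.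
Variable m : nat.
Implicit Types I J K : {set 'I_m}.

Definition symdiff I J : {set 'I_m} := (I :\: J) :|: (J :\: I).

Definition inversions I J : nat := #|[set p in setX I J | (p.2 < p.1)%N]|.

Lemma in_symdiff I J i : (i \in symdiff I J) = (i \in I) (+) (i \in J).
Proof. by rewrite !inE; do 2 case: (i \in _). Qed.

Lemma symdiffC : commutative symdiff.
Proof. by move=> I J; apply/setP => i; rewrite !in_symdiff addbC. Qed.

Lemma symdiffA : associative symdiff.
Proof. by move=> I J K; apply/setP => i; rewrite !in_symdiff addbA. Qed.

Lemma symdiffK I : involutive (symdiff I).
Proof. by move=> J; apply/setP => i; rewrite !in_symdiff addbA addbb. Qed.

Lemma symdiffv I : symdiff I I = set0.
Proof. by apply/setP => i; rewrite !in_symdiff addbb inE. Qed.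

Lemma symdiff0s I : symdiff set0 I = I.
Proof. by apply/setP => i; rewrite !in_symdiff inE. Qed.

Lemma symdiffs0 I : symdiff I set0 = I.
Proof. by rewrite symdiffC symdiff0s. Qed.

Lemma odd_inversions I J : odd (inversions I J) =
  \big[addb/false]_(p : 'I_m * 'I_m | (p.2 < p.1)%N)
    ((p.1 \in I) && (p.2 \in J)).
Proof.
rewrite /inversions -sum1_card (big_morph odd oddD (erefl : odd 0 = false)).
rewrite big_mkcond [RHS]big_mkcond /=; apply: eq_bigr => p _.
by rewrite !inE andbC; case: ifP => //= _; case: (_ && _).
Qed.

Lemma odd_inversionsDl I J K : odd (inversions (symdiff I J) K) =
  odd (inversions I K) (+) odd (inversions J K).
Proof.
rewrite !odd_inversions -big_split /=; apply: eq_bigr => p _.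
by rewrite in_symdiff andb_addl.
Qed.

Lemma odd_inversionsDr I J K : odd (inversions K (symdiff I J)) =
  odd (inversions K I) (+) odd (inversions K J).
Proof.
rewrite !odd_inversions -big_split /=; apply: eq_bigr => p _.
by rewrite in_symdiff andb_addr.
Qed.

Lemma odd_inversions0l I : odd (inversions set0 I) = false.
Proof. by rewrite odd_inversions big1// => p _; rewrite inE. Qed.

Lemma odd_inversions0r I : odd (inversions I set0) = false.
Proof. by rewrite odd_inversions big1// => p _; rewrite inE andbF. Qed.

Lemma odd_inversions1 i j : odd (inversions [set i] [set j]) = (j < i)%N.
Proof.
rewrite odd_inversions big_mkcond (bigD1 (i, j)) //= !inE !eqxx big1.
  by rewrite addbF; case: ifP.
by move=> [a b] /=; rewrite xpair_eqE negb_and !inE => ab; case: ifP => // _;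
  apply/negP => /andP[/eqP ai /eqP bj]; move: ab; rewrite ai bj !eqxx.
Qed.

End blades.

Section clifford_algebra.
Variables (R : comNzRingType) (m : nat).
Local Notation G := (clifford R m).
Implicit Types (A B C : G) (I J K : {set 'I_m}).

HB.instance Definition _ := Choice.on G.
HB.instance Definition _ := GRing.Zmodule.copy G {ffun {set 'I_m} -> R}.

(* e_I e_J = (-1) ^ (inversions I J) e_(symdiff I J), since e_i ^ 2 = 1 and
   e_i e_j = - e_j e_i for i != j; the coefficient on e_K thus collects the
   pairs (I, J) with J = symdiff I K. *)
Definition clifford_mul A B : G :=
  [ffun K => \sum_I (-1) ^+ inversions I (symdiff I K) * A I * B (symdiff I K)].

Definition clifford_scale (a : R) A : G := [ffun I => a * A I].

Definition blade I : G := [ffun J => (J == I)%:R].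

Fact clifford_scaleA a b A :
  clifford_scale a (clifford_scale b A) = clifford_scale (a * b) A.
Proof. by apply/ffunP => I; rewrite !ffunE mulrA. Qed.

Fact clifford_scale1 : left_id 1 clifford_scale.
Proof. by move=> A; apply/ffunP => I; rewrite !ffunE mul1r. Qed.

Fact clifford_scaleDr : right_distributive clifford_scale +%R.
Proof. by move=> a A B; apply/ffunP => I; rewrite !ffunE mulrDr. Qed.

Fact clifford_scaleDl A : {morph clifford_scale^~ A : a b / a + b}.
Proof. by move=> a b; apply/ffunP => I; rewrite !ffunE mulrDl. Qed.

HB.instance Definition _ := GRing.Zmodule_isLmodule.Build R G
  clifford_scaleA clifford_scale1 clifford_scaleDr clifford_scaleDl.

Fact clifford_mulA : associative clifford_mul.
Proof.
move=> A B C; apply/ffunP => K; rewrite !ffunE.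
under eq_bigr => I _.
  by rewrite ffunE big_distrr /= (reindex_inj (can_inj (symdiffK I))); over.
rewrite exchange_big /=; apply: eq_bigr => J _.
rewrite ffunE big_distrr big_distrl /=; apply: eq_bigr => I _.
have -> : symdiff (symdiff I J) (symdiff I K) = symdiff J K.
  by apply/setP => i; rewrite !in_symdiff; do 3 case: (i \in _).
suff sgnE : (-1) ^+ inversions I (symdiff I K)
    * (-1) ^+ inversions (symdiff I J) (symdiff J K) =
    (-1) ^+ inversions J (symdiff J K) * (-1) ^+ inversions I (symdiff I J) :> R.
  rewrite !mulrA [_ * A I * _]mulrAC sgnE.
  by rewrite -!mulrA; congr (_ * (_ * _)); rewrite mulrCA.
rewrite -![_ ^+ inversions _ _]signr_odd !odd_inversionsDl !odd_inversionsDr.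
rewrite -!signr_addb; congr (_ ^+ nat_of_bool _).
by move: (odd _) (odd _) (odd _) (odd _) (odd _) => [] [] [] [] [].
Qed.

Fact clifford_mul1A : left_id (blade set0) clifford_mul.
Proof.
move=> A; apply/ffunP => K; rewrite ffunE (bigD1 set0) //= big1 ?addr0.
  by rewrite symdiff0s ffunE eqxx -signr_odd odd_inversions0l !mul1r.
by move=> I I0; rewrite ffunE (negPf I0) mulr0 mul0r.
Qed.

Fact clifford_mulA1 : right_id (blade set0) clifford_mul.
Proof.
move=> A; apply/ffunP => K; rewrite ffunE (bigD1 K) //= big1 ?addr0.
  by rewrite symdiffv ffunE eqxx -signr_odd odd_inversions0r mul1r mulr1.
move=> I IK; rewrite ffunE; case: eqP => [I0|]; last by rewrite mulr0.
by case/eqP: IK; rewrite -[K](symdiffK I) I0 symdiffs0.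
Qed.

Fact clifford_mulDl : left_distributive clifford_mul +%R.
Proof.
move=> A B C; apply/ffunP => K; rewrite !ffunE -big_split /=.
by apply: eq_bigr => I _; rewrite ffunE mulrDr mulrDl.
Qed.

Fact clifford_mulDr : right_distributive clifford_mul +%R.
Proof.
move=> A B C; apply/ffunP => K; rewrite !ffunE -big_split /=.
by apply: eq_bigr => I _; rewrite ffunE mulrDr.
Qed.

Fact clifford_oner_neq0 : blade set0 != 0.
Proof.
by apply/eqP => /ffunP/(_ set0); rewrite !ffunE eqxx; apply/eqP/oner_neq0.
Qed.

HB.instance Definition _ := GRing.Zmodule_isNzRing.Build G
  clifford_mulA clifford_mul1A clifford_mulA1 clifford_mulDl clifford_mulDr
  clifford_oner_neq0.

Fact clifford_scaleAl a A B : a *: (A * B) = a *: A * B.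
Proof.
apply/ffunP => K; rewrite !ffunE big_distrr /=; apply: eq_bigr => I _.
by rewrite ffunE !mulrA [a * _]mulrC.
Qed.

HB.instance Definition _ := GRing.Lmodule_isLalgebra.Build R G clifford_scaleAl.

Fact clifford_scaleAr a A B : a *: (A * B) = A * (a *: B).
Proof.
apply/ffunP => K; rewrite !ffunE big_distrr /=; apply: eq_bigr => I _.
by rewrite ffunE mulrCA.
Qed.

HB.instance Definition _ := GRing.Lalgebra_isAlgebra.Build R G clifford_scaleAr.

Lemma coefD A B I : (A + B) I = A I + B I. Proof. exact: ffunE. Qed.

Lemma coefZ a A I : (a *: A) I = a * A I. Proof. exact: ffunE. Qed.

Lemma clifford_basis A : A = \sum_I A I *: blade I.
Proof.
apply/ffunP => K; rewrite sum_ffunE (bigD1 K) //= big1 ?addr0 => [|I IK].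
  by rewrite !ffunE eqxx mulr1.
by rewrite !ffunE eq_sym (negPf IK) mulr0.
Qed.

Lemma bladeM I J :
  blade I * blade J = (-1) ^+ inversions I J *: blade (symdiff I J).
Proof.
apply/ffunP => K; rewrite !ffunE (bigD1 I) //= big1 ?addr0 => [|L LI].
  rewrite !ffunE eqxx mulr1 -(can_eq (symdiffK I)) symdiffK.
  by case: eqP => [->|]; rewrite ?mulr0 ?symdiffK.
by rewrite ffunE (negPf LI) mulr0 mul0r.
Qed.

Definition basis_vector (i : 'I_m) : G := blade [set i].

Lemma basis_vector_sqr i : basis_vector i * basis_vector i = 1.
Proof.
by rewrite bladeM symdiffv -signr_odd odd_inversions1 ltnn scale1r.
Qed.

Lemma basis_vector_anticomm i j : i != j ->
  basis_vector i * basis_vector j = - (basis_vector j * basis_vector i).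
Proof.
move=> ij; rewrite !bladeM symdiffC -[X in X *: _ = _]signr_odd.
rewrite -[X in _ = - (X *: _)]signr_odd !odd_inversions1 -scaleNr.
by case: (ltngtP i j) ij => [||/val_inj->]; rewrite ?eqxx //= ?expr1 opprK.
Qed.

Lemma blade_ordered_prod I :
  blade I = \prod_(i <- enum I) basis_vector i.
Proof.
have -> : blade I = blade [set i in enum I].
  by congr blade; apply/setP => i; rewrite inE mem_enum.
have : sorted (fun i j : 'I_m => (i < j)%N) (enum I).
  apply: sorted_filter; first by move=> ? ? ?; exact: ltn_trans.
  rewrite -enumT -[sorted _ _](@sorted_map _ _ (@nat_of_ord m) ltn) val_enum_ord.
  exact: iota_ltn_sorted.
elim: (enum I) => [_|i s IHs /=]; first by rewrite big_nil set_nil.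
rewrite (path_sortedE (fun _ _ _ => @ltn_trans _ _ _)) => /andP[/allP i_lt /IHs s_prod].
rewrite big_cons -s_prod bladeM set_cons.
have -> : inversions [set i] [set j in s] = 0%N.
  apply/eqP; rewrite cards_eq0 -subset0; apply/subsetP => -[a b].
  by rewrite !inE /= => /andP[/andP[/eqP-> /i_lt ib]]; rewrite ltnNge (ltnW ib).
rewrite scale1r; congr blade; apply/setP => j; rewrite in_symdiff !inE.
case: eqP => //= ->; case: (boolP (i \in s)) => // /i_lt.
by rewrite ltnn.
Qed.

(* Reversing the order of the factors of e_I takes one exchange of
   anticommuting vectors for each pair of elements of I. *)
Definition reversion A : G := [ffun I => (-1) ^+ inversions I I * A I].

Lemma reversion_is_linear : linear reversion.
Proof.
by move=> a A B; apply/ffunP => I; rewrite !ffunE mulrDr mulrCA.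
Qed.

HB.instance Definition _ :=
  GRing.isLinear.Build R G G *:%R reversion reversion_is_linear.

Lemma reversionK : involutive reversion.
Proof. by move=> A; apply/ffunP => I; rewrite !ffunE signrMK. Qed.

Lemma reversion1 : reversion 1 = 1.
Proof.
apply/ffunP => I; rewrite [1]/(blade set0) !ffunE; case: eqP => [->|].
  by rewrite -signr_odd odd_inversions0l mul1r.
by rewrite mulr0.
Qed.

Lemma reversionM A B : reversion (A * B) = reversion B * reversion A.
Proof.
apply/ffunP => K; rewrite !ffunE big_distrr (reindex_inj (can_inj (symdiffK K))).
apply: eq_bigr => J _ /=.
have -> : symdiff (symdiff K J) K = J by rewrite symdiffC symdiffK.
rewrite symdiffC; set I := symdiff J K; rewrite !ffunE.
have -> : K = symdiff I J by rewrite /I symdiffC symdiffK.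
suff sgnE : (-1) ^+ inversions (symdiff I J) (symdiff I J)
    * (-1) ^+ inversions I J =
    (-1) ^+ inversions J I * (-1) ^+ inversions J J * (-1) ^+ inversions I I :> R.
  rewrite !mulrA sgnE.
  by rewrite -!mulrA; do 2 congr (_ * _); rewrite [RHS]mulrC mulrA.
rewrite -![_ ^+ inversions _ _]signr_odd !odd_inversionsDl !odd_inversionsDr.
rewrite -!signr_addb; congr (_ ^+ nat_of_bool _).
by move: (odd _) (odd _) (odd _) (odd _) => [] [] [] [].
Qed.

Lemma reversion_vector i : reversion (basis_vector i) = basis_vector i.
Proof.
apply/ffunP => I; rewrite !ffunE; case: eqP => [->|]; last by rewrite mulr0.
by rewrite -signr_odd odd_inversions1 ltnn mul1r.
Qed.
Lemma reversion_unique (f : {linear G -> G}) :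
  f 1 = 1 -> (forall A B, f (A * B) = f B * f A) ->
  (forall i, f (basis_vector i) = basis_vector i) -> f =1 reversion.
Proof.
move=> f1 fM fv A; rewrite (clifford_basis A) !linear_sum.
apply: eq_bigr => I _; rewrite !linearZ /=; congr (_ *: _).
rewrite blade_ordered_prod; elim: (enum I) => [|i s IHs].
  by rewrite big_nil f1 reversion1.
by rewrite big_cons fM reversionM fv reversion_vector IHs.
Qed.

End clifford_algebra.

(* Loaded only here: it hides the finset notations used above. *)
From mathcomp Require Import all_classical all_reals all_analysis.
Import numFieldNormedType.Exports.
Local Open Scope classical_set_scope.

Notation "''Eucl[' R ]_ n" := (n.-tuple (measurableTypeR R))
  (at level 8, n at level 2, format "''Eucl[' R ]_ n").

Section lebesgue_tuple.
Variable R : realType.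

(* Lebesgue measure on R^n is built by recursion on n as a product of copies of
   the one-dimensional measure, see lebesgue_tuple_box. *)
Definition tuple_cons n (p : measurableTypeR R * 'Eucl[R]_n) : 'Eucl[R]_n.+1 :=
  [tuple of p.1 :: p.2].

Lemma measurable_tuple_cons n : measurable_fun setT (@tuple_cons n).
Proof. exact: measurable_cons. Qed.


Section step.
Variables (n : nat) (mu : {sigma_finite_measure set 'Eucl[R]_n -> \bar R}).

Definition lebesgue_cons : set 'Eucl[R]_n.+1 -> \bar R :=
  pushforward (lebesgue_measure \x mu)%E (@tuple_cons n).

Let lebesgue_cons_measure : {measure set 'Eucl[R]_n.+1 -> \bar R} :=
  measure_function_pushforward__canonical__measure_function_Measure
    (lebesgue_measure \x mu)%E (@measurable_tuple_cons n).

Fact lebesgue_cons0 : lebesgue_cons set0 = 0%E.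
Proof. exact: (measure0 lebesgue_cons_measure). Qed.

Fact lebesgue_cons_ge0 A : (0 <= lebesgue_cons A)%E.
Proof. exact: (measure_ge0 lebesgue_cons_measure). Qed.

Fact lebesgue_cons_sigma_additive : semi_sigma_additive lebesgue_cons.
Proof. exact: (@measure_semi_sigma_additive _ _ _ lebesgue_cons_measure). Qed.

HB.instance Definition _ := isMeasure.Build _ _ _ lebesgue_cons
  lebesgue_cons0 lebesgue_cons_ge0 lebesgue_cons_sigma_additive.

Lemma measurable_head_behead (A : set (measurableTypeR R)) (B : set 'Eucl[R]_n) :
  measurable A -> measurable B ->
  measurable [set x : 'Eucl[R]_n.+1 | A (thead x) /\ B [tuple of behead x]].
Proof.
move=> mA mB.
rewrite [X in measurable X](_ : _ = ((@tnth _ _)^~ ord0) @^-1` A `&`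
  (fun x : 'Eucl[R]_n.+1 => [tuple of behead x]) @^-1` B)//.
apply: measurableI; rewrite -[X in measurable X]setTI.
- exact: measurable_tnth.
- exact: measurable_behead.
Qed.

Lemma lebesgue_consE (A : set (measurableTypeR R)) (B : set 'Eucl[R]_n) :
  measurable A -> measurable B ->
  lebesgue_cons [set x | A (thead x) /\ B [tuple of behead x]] =
  (lebesgue_measure A * mu B)%E.
Proof.
move=> mA mB; rewrite -product_measure1E// /lebesgue_cons /pushforward.
congr ((_ \x _)%E _).
apply/seteqP; split => -[a b] /=; rewrite theadE (_ : [tuple of _] = b)//.
  exact/val_inj.
exact/val_inj.
Qed.

Fact lebesgue_cons_sigma_finite : sigma_finite setT lebesgue_cons.
Proof.
have /sigma_finiteP[F [TF ndF Foo]] := sigma_finiteT (@lebesgue_measure R).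
have /sigma_finiteP[G [TG ndG Goo]] := sigma_finiteT mu.
exists (fun k => [set x | F k (thead x) /\ G k [tuple of behead x]]).
  apply/seteqP; split => // x _.
  have [k _ Fk] : (\bigcup_k F k) (thead x) by rewrite -TF.
  have [l _ Gl] : (\bigcup_k G k) [tuple of behead x] by rewrite -TG.
  exists (maxn k l) => //; split.
  - by move: Fk; exact/subsetPset/ndF/leq_maxl.
  - by move: Gl; exact/subsetPset/ndG/leq_maxr.
move=> k; have [mF ?] := Foo k; have [mG ?] := Goo k; split.
  exact: measurable_head_behead.
by rewrite lebesgue_consE// lte_mul_pinfty// ge0_fin_numE.
Qed.

HB.instance Definition _ := Measure_isSigmaFinite.Build _ _ _ lebesgue_cons
  lebesgue_cons_sigma_finite.

End step.

Fixpoint lebesgue_tuple (n : nat) :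
    {sigma_finite_measure set 'Eucl[R]_n -> \bar R} :=
  if n is n'.+1 then lebesgue_cons (lebesgue_tuple n') else \d_[tuple].

Lemma lebesgue_tuple_box n (A : 'I_n -> set (measurableTypeR R)) :
  (forall i, measurable (A i)) ->
  lebesgue_tuple n [set x | forall i, A i (tnth x i)] =
  (\prod_(i < n) lebesgue_measure (A i))%E.
Proof.
elim: n A => [|n IHn] A mA.
  by rewrite big_ord0 /= diracE mem_set// => -[].
rewrite big_ord_recl -IHn => [|i]; last exact: mA.
rewrite -lebesgue_consE//; last first.
  rewrite [X in measurable X](_ : _ = \bigcap_(i in [set: 'I_n])
    (fun x : 'Eucl[R]_n => tnth x i) @^-1` A (lift ord0 i)).
    apply: fin_bigcap_measurable => [|i _]; first exact: finite_finset.
    by rewrite -[X in measurable X]setTI; exact: measurable_tnth.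
  by apply/seteqP; split => x /= Ax i; [move=> _|]; exact: Ax.
have tnth_lift (x : 'Eucl[R]_n.+1) i :
    tnth [tuple of behead x] i = tnth x (lift ord0 i).
  rewrite tnth_behead; congr tnth.
  by apply: val_inj; rewrite /= inordK// ltnS.
congr (lebesgue_cons _ _); apply/seteqP; split => x /=.
  by move=> Ax; split => [|i]; [exact: Ax|rewrite tnth_lift; exact: Ax].
move=> [A0 A1] i; case: (unliftP ord0 i) => [j ->|->//].
by rewrite -tnth_lift; exact: A1.
Qed.

End lebesgue_tuple.

Section clifford_analysis.
Variable R : realType.

Definition clifford_norm m (A : clifford R m) : R :=
  Num.sqrt (\sum_I A I ^+ 2).

(* The exponential series, summed coefficientwise. *)
Definition clifford_exp m (A : clifford R m) : clifford R m :=
  [ffun I => limn (series (fun k => (k`!%:R^-1 *: A ^+ k) I))].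

Variable n : nat.
Local Notation G := (clifford R (n + n)).
Local Notation E := ('Eucl[R]_n).
Implicit Types (f g : E -> G) (T : (E -> G) -> (E -> G)).

(* e_1, ..., e_n are the first n basis vectors, e'_1, ..., e'_n the last n. *)
Definition bivector (i : 'I_n) : G :=
  basis_vector R (lshift n i) * basis_vector R (rshift n i).

Lemma bivector_sqr i : bivector i * bivector i = -1.
Proof.
rewrite /bivector; set a := basis_vector R _; set b := basis_vector R _.
have ab : b * a = - (a * b).
  by apply: basis_vector_anticomm; rewrite eq_sym eq_lrshift.
by rewrite mulrA -(mulrA a) ab mulrN mulrA basis_vector_sqr mul1r mulNr
  basis_vector_sqr.
Qed.

Lemma bivectorC i j : bivector i * bivector j = bivector j * bivector i.
Proof.
have [->//|ij] := eqVneq i j.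
have comm k : k != lshift n j -> k != rshift n j ->
    basis_vector R k * bivector j = bivector j * basis_vector R k.
  move=> kl kr; rewrite /bivector mulrA (basis_vector_anticomm R kl) mulNr.
  rewrite -(mulrA _ _ (basis_vector R (rshift n j))).
  by rewrite (basis_vector_anticomm R kr) mulrN opprK mulrA.
have commr : basis_vector R (rshift n i) * bivector j =
    bivector j * basis_vector R (rshift n i).
  by apply: comm; rewrite ?eq_rshift ?eq_rlshift.
have comml : basis_vector R (lshift n i) * bivector j =
    bivector j * basis_vector R (lshift n i).
  by apply: comm; rewrite ?eq_lshift ?eq_lrshift.
by rewrite -[LHS]mulrA commr mulrA comml -mulrA.
Qed.

Definition normalized_lebesgue : {measure set E -> \bar R} :=
  mscale (NngNum (powR_ge0 (2 * pi) (- (n%:R / 2)))) (lebesgue_tuple R n).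

Local Notation dm := normalized_lebesgue.

Definition clifford_integral f : G := [ffun I => \int[dm]_x f x I].

Definition clifford_Lnorm (p : R) f : \bar R :=
  Lnorm dm p%:E (fun x => (clifford_norm (f x))%:E).

(* Measurability is with respect to the Borel sets of R^n. *)
Definition in_clifford_L (p : R) f : Prop :=
  (forall I, measurable_fun setT (fun x => f x I)) /\
  (clifford_Lnorm p f < +oo)%E.

Definition fourier_form (x y : E) : G :=
  \sum_(i < n) (tnth x i * tnth y i : R) *: bivector i.

Definition fourier_left_L1 f : E -> G := fun y =>
  clifford_integral (fun x => clifford_exp (- fourier_form x y) * f x).

Definition fourier_right_L1 f : E -> G := fun y =>
  clifford_integral (fun x => f x * clifford_exp (- fourier_form x y)).

(* Operators act on representatives: continuity at f forces T f and T g to be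
   equal almost everywhere when f and g are. By density of the intersection of
   L_1 and L_2, two such extensions agree almost everywhere on L_2. *)
Definition continuous_L2_extension T0 T : Prop :=
  [/\ forall f, in_clifford_L 2 f -> in_clifford_L 2 (T f),
      forall f, in_clifford_L 1 f -> in_clifford_L 2 f ->
        {ae dm, forall x, T f x = T0 f x} &
      forall f, in_clifford_L 2 f -> forall e : R, 0 < e ->
        exists2 d : R, 0 < d & forall g, in_clifford_L 2 g ->
          (clifford_Lnorm 2 (fun x => f x - g x)%R < d%:E)%E ->
          (clifford_Lnorm 2 (fun x => T f x - T g x)%R < e%:E)%E].

Definition fourier_left : (E -> G) -> (E -> G) :=
  xget (fun=> fun=> 0) (continuous_L2_extension fourier_left_L1).

Definition fourier_right : (E -> G) -> (E -> G) :=
  xget (fun=> fun=> 0) (continuous_L2_extension fourier_right_L1).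

End clifford_analysis.

(* Main.v *)
(** The kernel exp(-I(x,y)) is the product of the commuting rotors
    cos(x_i y_i) - B_i sin(x_i y_i), and its reversion is its inverse. For f in
    L_1 and L_2, integrating |F f|^2 against prod_i exp(-e |y_i|) and exchanging
    the integrals gives (2 pi)^n times the double integral of <f x, f x'> against
    a product of Poisson kernels of width e in the x_i - x'_i: the sine terms are
    odd in y and drop out. The Poisson kernels form an approximate identity on
    L_2, so e -> 0 yields the isometry on the intersection of L_1 and L_2, and
    completeness of L_2 yields the extension. Finally the coefficient on e_K of
    a^dagger b is the inner product of a and b e_K^dagger; right multiplication
    by e_K^dagger commutes with the left transform, so polarization and density
    give the first identity, and the second one by exchanging the two sides. *)
Require Import Defs.
From HB Require Import structures.
From mathcomp Require Import all_boot all_order all_algebra.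
From mathcomp Require Import all_classical all_reals all_analysis.
From mathcomp Require Import measurable_realfun.
From mathcomp Require Import ring lra.
Set Implicit Arguments.
Unset Strict Implicit.
Unset Printing Implicit Defensive.
Import Order.TTheory GRing.Theory Num.Theory.
Import numFieldNormedType.Exports.
Local Open Scope classical_set_scope.
Local Open Scope ring_scope.

(** * Exponentials of commuting bivectors *)

(** The approximate identity is never handled as a convolution. Against a symmetric kernel [k] of
    mass 1, ab = (a^2 + b^2 - (a - b)^2)/2 turns the double integral of k f f into the square norm
    of f minus half the energy [kdist k f], so only the vanishing of this energy has to be shown.
    The energy is at most 4 times the square norm, hence reduces to indicators; and it tensorizes,
    hence reduces to dimension one. The damping exp(-e |y_i|) has an elementary cosine integral, and
    it increases to 1 as e decreases: monotone convergence then recovers the square norm of the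
    transform, not yet known to be finite. Left and right transforms share one argument, for a
    kernel given by linear maps [L s] with trigonometric coefficients. Norms appear as squares in
    the extended reals, so that (a + b)^2 <= 2 a^2 + 2 b^2 replaces Minkowski's inequality, at the
    price of loose constants. Since the transforms are chosen by [xget], the existence of an
    extension must be proved before anything can be said of them. *)

Lemma cvg_sumr (R : realType) (I : Type) (r : seq I) (P : pred I)
    (F : I -> nat -> R) (l : I -> R) :
  (forall i, P i -> F i N @[N --> \oo] --> l i) ->
  \sum_(i <- r | P i) F i N @[N --> \oo] --> \sum_(i <- r | P i) l i.
Proof.
move=> Fl; elim: r => [|i r IH].
  by under eq_fun do rewrite big_nil; rewrite big_nil; exact: cvg_cst.
rewrite big_cons; under eq_fun do rewrite big_cons.
by case: ifPn => // Pi; apply: cvgD => //; exact: Fl.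
Qed.

Section exp_partial.
Variables (R : realType) (A : algType R).

Definition exp_partial N (a : A) : A := \sum_(k < N) k`!%:R^-1 *: a ^+ k.

(** By the binomial theorem the partial sum at a + b is the triangle i + j < N of the square i, j <
    N; the rest is the error. As an identity in any algebra it serves twice: for Clifford elements,
    and for the real numbers that dominate them. *)
Lemma exp_partialM N (a b : A) : GRing.comm a b ->
  exp_partial N a * exp_partial N b - exp_partial N (a + b) =
  \sum_(i < N) \sum_(j < N | (N <= i + j)%N)
    (i`!%:R^-1 * j`!%:R^-1) *: (a ^+ i * b ^+ j).
Proof.
move=> ab; apply/eqP; rewrite subr_eq; apply/eqP.
pose F i j : A := (i`!%:R^-1 * j`!%:R^-1) *: (a ^+ i * b ^+ j).
have -> : exp_partial N a * exp_partial N b = \sum_(i < N) \sum_(j < N) F i j.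
  rewrite /exp_partial big_distrl; apply: eq_bigr => i _ /=.
  rewrite big_distrr; apply: eq_bigr => j _ /=.
  by rewrite -[LHS]scalerAl -[X in _ *: X]scalerAr [LHS]scalerA.
have -> : exp_partial N (a + b) = \sum_(i < N) \sum_(j < N | (i + j < N)%N) F i j.
  have E (i k : nat) : (i <= k)%N -> (k < N)%N ->
      F i (k - i)%N = k`!%:R^-1 *: ((a ^+ i * b ^+ (k - i)) *+ 'C(k, i)).
    move=> ik kN; rewrite /F -[X in _ = _ *: X]scaler_nat scalerA; congr (_ *: _).
    rewrite -(bin_fact ik) !natrM -invrM ?unitfE ?pnatr_eq0 -?lt0n ?fact_gt0//.
    have h1 : i`!%:R != 0 :> R by rewrite pnatr_eq0 -lt0n fact_gt0.
    have h2 : (k - i)`!%:R != 0 :> R by rewrite pnatr_eq0 -lt0n fact_gt0.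
    have h3 : 'C(k, i)%:R != 0 :> R by rewrite pnatr_eq0 -lt0n bin_gt0.
    by field; rewrite h1 h2 h3.
  (* Summation by total degree k, with i the exponent of a; the shift j = k - i turns i <= k < N
     into i + j < N. *)
  transitivity (\sum_(k < N) \sum_(i < N | (i <= k)%N) F i (k - i)%N).
    apply: eq_bigr => k _; rewrite addrC exprDn_comm; last exact: commr_sym.
    rewrite scaler_sumr (big_ord_widen_cond N xpredT
      (fun i => k`!%:R^-1 *: ((b ^+ (k - i) * a ^+ i) *+ 'C(k, i))))//.
    apply: eq_big => [i|i]; first by rewrite ltnS.
    rewrite ltnS => ik; rewrite E//.
    by congr (_ *: (_ *+ _)); apply/commr_sym/commrX/commr_sym/commrX.
  rewrite (exchange_big_dep xpredT)//=; apply: eq_bigr => i _.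
  rewrite -(big_mkord (fun k => (i <= k)%N) (fun k => F i (k - i)%N)).
  rewrite -(big_mkord (fun j => (i + j < N)%N) (fun j => F i j)).
  rewrite (big_cat_nat (n := i)) ?(ltnW (ltn_ord i))//= big_nat_cond big1 ?add0r.
    rewrite -{1}(add0n (i : nat)) big_addn.
    rewrite [RHS](big_cat_nat (n := (N - i)%N)) ?leq_subr//=.
    rewrite [X in _ + X]big_nat_cond [X in _ + X]big1 ?addr0.
      rewrite big_nat_cond [RHS]big_nat_cond; apply: eq_big => j.
        by rewrite leq_addl ltn_subRL; case: (i + j < N)%N; rewrite ?andbF.
      by rewrite addnK.
    by move=> j /andP[/andP[]]; rewrite leq_subLR => ? _; rewrite ltnNge => /negP.
  by move=> j /andP[/andP[_ ?]]; rewrite leqNgt => /negP.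
rewrite -big_split; apply: eq_bigr => i _ /=.
rewrite (bigID (fun j : 'I_N => (N <= i + j)%N)) /=; congr (_ + _).
by apply: eq_bigl => j; rewrite ltnNge.
Qed.

End exp_partial.

(** * The exponential of a sum of commuting Clifford elements *)

Section clifford_l1.
Variables (R : realType) (m : nat).
Local Notation G := (clifford R m).
Implicit Types A B U V : G.

(** Submultiplicative with constant 1 ([l1normM]), which the Euclidean norm is not as soon as m > 0:
    (1 + e_1)^2 = 2 (1 + e_1). This makes the scalar exponential series a majorant. *)
Definition l1norm A : R := \sum_I `|A I|.

Lemma l1norm_ge0 A : 0 <= l1norm A.
Proof. by apply: sumr_ge0. Qed.

Lemma le_coef_l1norm A I : `|A I| <= l1norm A.
Proof. by rewrite /l1norm (bigD1 I)//= lerDl sumr_ge0. Qed.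

Lemma l1norm_sum (J : Type) (r : seq J) (P : pred J) (F : J -> G) :
  l1norm (\sum_(j <- r | P j) F j) <= \sum_(j <- r | P j) l1norm (F j).
Proof.
rewrite exchange_big; apply: ler_sum => I _ /=.
by rewrite sum_ffunE; exact: ler_norm_sum.
Qed.

Lemma l1normZ (a : R) A : l1norm (a *: A) = `|a| * l1norm A.
Proof.
by rewrite /l1norm big_distrr; apply: eq_bigr => I _ /=; rewrite Defs.coefZ normrM.
Qed.

Lemma l1normM A B : l1norm (A * B) <= l1norm A * l1norm B.
Proof.
have -> : l1norm A * l1norm B =
    \sum_K \sum_I `|A I| * `|B (symdiff I K)|.
  rewrite exchange_big big_distrl; apply: eq_bigr => I _ /=.
  by rewrite big_distrr (reindex_inj (can_inj (symdiffK I))).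
apply: ler_sum => K _; rewrite ffunE.
apply: (le_trans (ler_norm_sum _ _ _)); apply: ler_sum => I _.
by rewrite !normrM normrX normrN1 expr1n mul1r.
Qed.

Lemma l1norm_blade (I : {set 'I_m}) : l1norm (blade R I) = 1.
Proof.
rewrite /l1norm (bigD1 I)//= big1 => [|J JI]; last first.
  by rewrite ffunE (negPf JI) normr0.
by rewrite ffunE eqxx normr1 addr0.
Qed.

Lemma l1norm_exp A k : l1norm (A ^+ k) <= l1norm A ^+ k.
Proof.
elim: k => [|k IH]; first by rewrite expr0 (l1norm_blade finset.set0).
rewrite exprS (le_trans (l1normM _ _))// exprS ler_wpM2l//.
exact: l1norm_ge0.
Qed.

(** A relation rather than the value [clifford_exp A]: [limn] returns something even for a divergent
    sequence, so convergence has to be carried along. *)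
Definition has_exp A U := forall I,
  exp_partial N A I @[N --> \oo] --> (U I : R).

Lemma has_expE A U : has_exp A U -> clifford_exp A = U.
Proof.
move=> AU; apply/ffunP => I; rewrite ffunE; apply/cvg_lim => //.
rewrite [X in X @ _](_ : _ = (fun N => exp_partial N A I)); first exact: AU.
by apply/funext => N; rewrite seriesEord /exp_partial /= sum_ffunE.
Qed.

Lemma exp_partialR_cvg (a : R) : (exp_partial N (a : R^o) : R) @[N --> \oo] --> expR a.
Proof.
rewrite [X in X @ _](_ : _ = series (exp_coeff a)).
  exact: is_cvg_series_exp_coeff.
apply/funext => N; rewrite seriesEord; apply: eq_bigr => k _.
by rewrite /exp_coeff /= mulrC.
Qed.

(* The error of the Cauchy product is dominated by the error for the scalar
   exponential series at the l1 norms, which tends to 0. *)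
Lemma has_expD A B U V : GRing.comm A B -> has_exp A U -> has_exp B V ->
  has_exp (A + B) (U * V).
Proof.
move=> AB AU BV K.
set a := l1norm A; set b := l1norm B.
pose e N : R := exp_partial N (a : R^o) * exp_partial N (b : R^o)
  - exp_partial N (a + b : R^o).
have e0 : e N @[N --> \oo] --> (0 : R).
  rewrite [0](_ : _ = expR a * expR b - expR (a + b)); last by rewrite expRD subrr.
  apply: cvgB; last exact: exp_partialR_cvg.
  by apply: cvgM; exact: exp_partialR_cvg.
pose d N : R := (exp_partial N A * exp_partial N B - exp_partial N (A + B)) K.
have de N : `|d N| <= e N.
  rewrite /d (le_trans (le_coef_l1norm _ _))// exp_partialM//.
  rewrite /e (@exp_partialM _ R^o); last exact: mulrC.
  rewrite (le_trans (l1norm_sum _ _ _))// ler_sum// => i _.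
  rewrite (le_trans (l1norm_sum _ _ _))// ler_sum// => j _.
  rewrite l1normZ ger0_norm ?mulr_ge0 ?invr_ge0 ?ler0n// ler_wpM2l//.
  rewrite (le_trans (l1normM _ _))// ler_pM ?l1norm_ge0//; exact: l1norm_exp.
have d0 : d N @[N --> \oo] --> (0 : R).
  apply/norm_cvg0P; apply: (squeeze_cvgr _ (cvg_cst 0) e0).
  by apply: nearW => N; rewrite normr_ge0 de.
have UV : (exp_partial N A * exp_partial N B) K @[N --> \oo] --> (U * V) K.
  rewrite ffunE.
  rewrite [X in X @ _](_ : _ = (fun N => \sum_I (-1) ^+ inversions I (symdiff I K)
     * (exp_partial N A) I * (exp_partial N B) (symdiff I K))); last first.
    by apply/funext => N; rewrite ffunE.
  apply: cvg_sumr => I _; apply: cvgM; last exact: BV.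
  by apply: cvgM; [exact: cvg_cst|exact: AU].
rewrite [X in _ --> X](_ : _ = (U * V) K - 0); last by rewrite subr0.
rewrite [X in X @ _](_ : _ = (fun N => (exp_partial N A * exp_partial N B) K - d N)).
  exact: cvgB.
by apply/funext => N; rewrite /d [X in _ - X]ffunE opprD addrA subrr add0r ffunE opprK.
Qed.

End clifford_l1.

(** * Rotors of a commuting family of square roots of -1 *)

Section rotor.
Variables (R : realType) (m n : nat).
Local Notation G := (clifford R m).
Variable B : 'I_n -> G.
Hypothesis B_sqr : forall i, B i * B i = -1.
Hypothesis B_comm : forall i j, B i * B j = B j * B i.
Implicit Types (s t : R) (th : 'I_n -> R).

Lemma exprB i k : B i ^+ k = (-1) ^+ k./2 *: (if odd k then B i else 1).
Proof.
elim/ltn_ind: k => -[|[|k]] IH; first by rewrite scale1r.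
  by rewrite scale1r expr1.
by rewrite -[k.+2./2]/(k./2.+1) !exprS mulrA B_sqr IH//= negbK !mulN1r scaleNr.
Qed.

Lemma exp_coeffB i s k : k`!%:R^-1 *: (s *: B i) ^+ k =
  cos_coeff s k *: 1 + sin_coeff s k *: B i :> G.
Proof.
rewrite exprZn exprB !scalerA /cos_coeff /sin_coeff /=.
case: ifPn => ok /=; rewrite ?mul0r ?scale0r ?add0r ?addr0 mul1r.
  have -> : k.-1./2 = k./2.
    by case: k ok => // k /=; rewrite uphalf_half => /negPf ->.
  by congr (_ *: _); rewrite -mulrA mulrC [s ^+ k * _]mulrC.
by congr (_ *: _); rewrite -exprnP -mulrA mulrC [s ^+ k * _]mulrC.
Qed.

Lemma has_exp_scaleB i s : has_exp (s *: B i) (cos s *: 1 + sin s *: B i).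
Proof.
move=> I.
rewrite [X in X @ _](_ : _ = (fun N => series (cos_coeff s) N * (1 : G) I
   + series (sin_coeff s) N * B i I)); last first.
  apply/funext => N; rewrite !seriesEord /exp_partial sum_ffunE !big_distrl -big_split.
  by apply: eq_bigr => k _ /=; rewrite exp_coeffB Defs.coefD !Defs.coefZ.
rewrite Defs.coefD !Defs.coefZ.
apply: cvgD; apply: cvgM; try exact: cvg_cst.
- by rewrite unlock; exact: is_cvg_series_cos_coeff.
- by rewrite unlock; exact: is_cvg_series_sin_coeff.
Qed.

Definition rotor1 i s : G := cos s *: 1 - sin s *: B i.

Lemma has_exp_rotor1 i s : has_exp (- s *: B i) (rotor1 i s).
Proof. by rewrite /rotor1 -[- (sin s *: B i)]scaleNr -sinN -cosN; exact: has_exp_scaleB. Qed.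

Lemma rotor1_comm i j s t : GRing.comm (rotor1 i s) (rotor1 j t).
Proof.
have c1 : GRing.comm (rotor1 i s) (B j).
  rewrite /GRing.comm mulrBl mulrBr -!scalerAl -!scalerAr mulr1 mul1r.
  by rewrite B_comm.
apply: commrB; last by rewrite /GRing.comm -scalerAl -scalerAr c1.
by rewrite /GRing.comm -scalerAl -scalerAr mulr1 mul1r.
Qed.

Lemma rotor1D i s t : rotor1 i s * rotor1 i t = rotor1 i (s + t).
Proof.
rewrite /rotor1 mulrBl !mulrBr -!scalerAl -!scalerAr !mul1r !mulr1 B_sqr.
rewrite cosD sinD !scalerA scalerN scalerBl scalerDl !opprD !opprK.
rewrite [X in _ + X]addrC addrACA; congr (_ + _).
by rewrite addrC.
Qed.

Definition rotor th : G := \prod_i rotor1 i (th i).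

Lemma rotorM th th' : rotor th * rotor th' = rotor (fun i => th i + th' i).
Proof.
rewrite /rotor; elim: (index_enum _) => [|i r IH].
  by rewrite !big_nil mulr1.
rewrite !big_cons -IH -rotor1D -!mulrA; congr (_ * _); rewrite !mulrA.
congr (_ * _); apply/commr_sym/commr_prod => j _; exact: rotor1_comm.
Qed.

Lemma has_exp_rotor th : has_exp (\sum_i - th i *: B i) (rotor th).
Proof.
rewrite /rotor; elim: (index_enum _) => [|i r IH].
  rewrite !big_nil => I.
  have E N : exp_partial N.+1 (0 : G) = 1.
    rewrite /exp_partial big_ord_recl big1 ?addr0 ?expr0 ?invr1 ?scale1r//.
    by move=> k _; rewrite exprS mul0r scaler0.
  by rewrite -cvg_shiftS; under eq_fun do rewrite /= E; exact: cvg_cst.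
rewrite !big_cons; apply: has_expD => //; last exact: has_exp_rotor1.
apply: commr_sum => j _.
by rewrite /GRing.comm -!scalerAl -!scalerAr B_comm !scalerA mulrC.
Qed.

(** Reversion reverses the order of the factors, which commute, and flips the sign of each [B i]; a
    rotor is thus sent to its inverse. *)
Lemma reversion_rotor th : (forall i, reversion (B i) = - B i) ->
  reversion (rotor th) = rotor (fun i => - th i).
Proof.
move=> revB; rewrite /rotor; elim: (index_enum _) => [|i r IH].
  by rewrite !big_nil reversion1.
rewrite !big_cons reversionM IH.
have -> : reversion (rotor1 i (th i)) = rotor1 i (- th i).
  rewrite /rotor1 linearB !linearZ /= reversion1 revB cosN sinN.
  by rewrite scalerN scaleNr.
by apply/commr_sym/commr_prod => j _; exact: rotor1_comm.
Qed.

Definition trig (b : bool) s : R := if b then sin s else cos s.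

Definition Bprod (sg : {ffun 'I_n -> bool}) : G :=
  \prod_i (if sg i then - B i else 1).

(** Distributing the product, with [sg i] selecting the sine term of factor i, separates the scalar
    dependence on the angles from the constants [Bprod sg]. Multiplication by a rotor becomes a
    finite sum of constant linear maps with trigonometric coefficients. *)
Lemma rotorE th : rotor th =
  \sum_(sg : {ffun 'I_n -> bool}) (\prod_i trig (sg i) (th i)) *: Bprod sg.
Proof.
rewrite /rotor.
have rotor1E i : rotor1 i (th i) =
    \sum_(b : bool) trig b (th i) *: (if b then - B i else 1).
  by rewrite big_bool/= addrC scalerN.
under eq_bigr => i _ do rewrite rotor1E.
rewrite bigA_distr_bigA; apply: eq_bigr => sg _.
rewrite /Bprod; elim: (index_enum _) => [|i r IH].
  by rewrite !big_nil scale1r.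
by rewrite !big_cons IH /= -scalerAl -scalerAr scalerA.
Qed.

End rotor.

(** * The Poisson kernel *)

Section poisson_kernel.
Variable R : realType.
Local Notation mu := (@lebesgue_measure R).
Implicit Types (e t x y r : R).

Lemma lebesgue_measureD (a : R) (A : set (measurableTypeR R)) : measurable A ->
  pushforward mu (fun x : measurableTypeR R => (x + a : measurableTypeR R)) A = mu A.
Proof.
have ma : measurable_fun setT (fun x : measurableTypeR R => (x + a : measurableTypeR R)).
  exact: measurable_funD.
move=> mA; apply/esym/(lebesgue_measure_unique
  (mu := measure_function_pushforward__canonical__measure_function_Measure mu ma)) => //= _ [[u v]] _ <-.
rewrite /pushforward.
rewrite (_ : _ @^-1` _ = `]u - a, v - a]%classic).
  by rewrite !lebesgue_measure_itv/= !lte_fin ltrD2r -!EFinB; case: ifP => // _; congr EFin; ring.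
by apply/seteqP; split => x /=; rewrite !in_itv/= lerBrDr ltrBlDr.
Qed.

Lemma ge0_integralD_shift (a : R) (f : measurableTypeR R -> \bar R) :
  measurable_fun setT f -> (forall x, 0 <= f x)%E ->
  (\int[mu]_x f ((x : R) + a)%R = \int[mu]_x f x)%E.
Proof.
move=> mf f0.
have ma : measurable_fun setT (fun x : measurableTypeR R => (x + a : measurableTypeR R)).
  exact: measurable_funD.
pose sh (x : measurableTypeR R) : measurableTypeR R := x + a.
transitivity (\int[pushforward mu sh]_x f x)%E.
  by rewrite (ge0_integral_pushforward ma).
by apply: eq_measure_integral => A mA _; exact: lebesgue_measureD.
Qed.

Definition poisson e t : R := pi^-1 * (e / (e ^+ 2 + t ^+ 2)).

Lemma poisson_ge0 e t : 0 <= e -> 0 <= poisson e t.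
Proof.
by move=> e0; rewrite mulr_ge0 ?invr_ge0 ?pi_ge0// divr_ge0// addr_ge0 ?sqr_ge0.
Qed.

Lemma poissonN e t : poisson e (- t) = poisson e t.
Proof. by rewrite /poisson sqrrN. Qed.

Lemma continuous_poisson e : 0 < e -> continuous (poisson e).
Proof.
move=> e0 t; apply: cvgM; first exact: cvg_cst.
apply: cvgM; first exact: cvg_cst.
apply: cvgV; first by rewrite gt_eqF// ltr_pwDl ?exprn_gt0// sqr_ge0.
by apply: cvgD; [exact: cvg_cst|exact: exprn_continuous].
Qed.

Lemma measurable_poisson e : 0 < e -> measurable_fun setT (poisson e).
Proof. by move=> /continuous_poisson; exact: continuous_measurable_fun. Qed.

Lemma integral_poisson e : 0 < e -> (\int[mu]_t (poisson e t)%:E = 1)%E.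
Proof.
move=> e0.
rewrite ge0_symfun_integralT; last 3 first.
- by move=> t; exact/poisson_ge0/ltW.
- exact: continuous_poisson.
- by move=> t; rewrite /= poissonN.
rewrite -set_itvcy.
have de t : is_derive t 1 (fun t => pi^-1 * atan (t * e^-1)) (poisson e t).
  apply: is_derive_eq.
  rewrite /GRing.scale/= /poisson.
  have h1 : e ^+ 2 + t ^+ 2 != 0 by rewrite gt_eqF// ltr_pwDl ?exprn_gt0// sqr_ge0.
  have h2 : 1 + (t / e) ^+ 2 != 0 by rewrite gt_eqF// ltr_pwDl ?sqr_ge0.
  have h3 : e != 0 by rewrite gt_eqF.
  have h4 : pi != 0 :> R by rewrite gt_eqF// pi_gt0.
  by move: (pi : R) h4 => p h4; field; rewrite h1 h3 h4.
rewrite (@ge0_continuous_FTC2y _ _ (fun t => pi^-1 * atan (t * e^-1)) 0 (2^-1)).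
- rewrite mul0r atan0 mulr0 sube0 -EFinM.
  by rewrite divff.
- by move=> t _; exact/poisson_ge0/ltW.
- by apply: continuous_subspaceT; exact: continuous_poisson.
- rewrite (_ : 2^-1 = pi^-1 * (pi / 2) :> R); last by rewrite mulKf// gt_eqF// pi_gt0.
  apply: cvgM; first exact: cvg_cst.
  apply: (@cvg_comp _ _ _ (fun t : R => t * e^-1) atan); last exact: cvgy_atan.
  by apply: gt0_cvgMly; [rewrite invr_gt0|exact: cvg_id].
- by move=> t _; exact: ex_derive.
- apply: cvg_at_right_filter.
  have : {for 0, continuous (fun t => pi^-1 * atan (t * e^-1))}.
    by apply/differentiable_continuous/derivable1_diffP/ex_derive.
  exact.
- by move=> t _; rewrite derive1E; apply: derive_val.
Qed.

Lemma integral_poissonB e x : 0 < e -> (\int[mu]_t (poisson e (x - t))%:E = 1)%E.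
Proof.
move=> e0; rewrite -(integral_poisson e0).
rewrite -(@ge0_integralD_shift (- x) (fun t => (poisson e t)%:E)); last 2 first.
- by apply/measurable_EFinP; exact: measurable_poisson.
- by move=> t; rewrite lee_fin poisson_ge0// ltW.
by apply: eq_integral => t _; rewrite -poissonN opprB.
Qed.

(** For |t| >= r one has r^2 + t^2 <= 2 t^2, so e/(e^2 + t^2) <= 2 e/(r^2 + t^2). The majorant is a
    multiple of the kernel of fixed width r, whose mass is 1: the tail is O(e/r) without any
    estimate of the arctangent. *)
Lemma poisson_le e r t : 0 < e -> 0 < r -> r <= `|t| ->
  poisson e t <= 2 * e / r * poisson r t.
Proof.
move=> e0 r0 rt.
have t2 : r ^+ 2 <= t ^+ 2 by rewrite -[t ^+ 2]real_normK ?num_real// lerXn2r ?nnegrE// ltW.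
have r2 : 0 < r ^+ 2 by rewrite exprn_gt0.
have e2 : 0 < e ^+ 2 by rewrite exprn_gt0.
rewrite /poisson [leRHS]mulrCA ler_wpM2l ?invr_ge0 ?pi_ge0//.
have d1 : 0 < e ^+ 2 + t ^+ 2 by lra.
have d2 : 0 < r ^+ 2 + t ^+ 2 by lra.
rewrite (_ : _ * (r / _) = 2 * e / (r ^+ 2 + t ^+ 2)); last first.
  by field; rewrite !gt_eqF.
rewrite ler_pdivrMr// mulrAC ler_pdivlMr// [2 * e]mulrC -mulrA ler_wpM2l ?(ltW e0)//.
lra.
Qed.

Lemma integral_poisson_tail e r x (A : set (measurableTypeR R)) :
  0 < e -> 0 < r -> measurable A -> (forall t, A t -> r <= `|x - (t : R)|) ->
  (\int[mu]_t (poisson e (x - t) * \1_A t)%:E <= (2 * e / r)%:E)%E.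
Proof.
move=> e0 r0 mA Ar.
have mp s : 0 < s -> measurable_fun setT (fun t => poisson s (x - t)).
  move=> s0; apply: (measurableT_comp (measurable_poisson s0)).
  exact: measurable_funB.
rewrite -[leRHS]mule1 -(integral_poissonB x r0) -ge0_integralZl//; last 3 first.
- by apply/measurable_EFinP; exact: mp.
- by move=> t _; rewrite lee_fin poisson_ge0// ltW.
- by rewrite lee_fin divr_ge0 ?mulr_ge0 ?ltW.
apply: ge0_le_integral => //.
- by move=> t _; rewrite lee_fin; apply: mulr_ge0; [exact/poisson_ge0/ltW|rewrite indicE; exact: ler0n].
- by apply/measurable_EFinP/measurable_funM; [exact: mp|exact: measurable_indic].
- by apply/measurable_EFinP/measurable_funM => //; exact: mp.
- move=> t _; rewrite -EFinM lee_fin indicE.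
  have [/set_mem /Ar rt|_] := boolP (t \in A); first by rewrite mulr1 poisson_le.
  rewrite mulr0; apply: mulr_ge0; last exact/poisson_ge0/ltW.
  by rewrite divr_ge0// ?mulr_ge0// ltW.
Qed.

End poisson_kernel.

(** * Cosine and sine integrals against exp(-e|y|) *)

Section laplace.
Variable R : realType.
Local Notation mu := (@lebesgue_measure R).
Implicit Types (e t y : R).

Definition expabs e y := expR (- (e * `|y|)).

Lemma continuous_expabs e : continuous (expabs e).
Proof.
move=> y; rewrite /expabs.
apply: (@continuous_comp _ _ _ (fun y => - (e * `|y|)) expR); last exact: continuous_expR.
by apply: cvgN; apply: cvgM; [exact: cvg_cst|exact: norm_continuous].
Qed.

Lemma expabs_ge0 e y : 0 <= expabs e y. Proof. exact: expR_ge0. Qed.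

Lemma expabsN e y : expabs e (- y) = expabs e y.
Proof. by rewrite /expabs normrN. Qed.

Lemma measurable_expabs e : measurable_fun setT (expabs e).
Proof. by apply: continuous_measurable_fun; exact: continuous_expabs. Qed.

(** The added 1 makes the integrand nonnegative, as [ge0_continuous_FTC2y] and
    [ge0_symfun_integralT] ask; its contribution, found by setting t = 0, is subtracted in
    [integral_cos_expabs]. *)
Let integral_halfline e t : 0 < e ->
  (\int[mu]_(y in `[0%R, +oo[) ((1 + cos (t * y)) * expR (- (e * y)))%:E =
  (e^-1 + e / (e ^+ 2 + t ^+ 2))%:E)%E.
Proof.
move=> e0.
have en0 : e != 0 by rewrite gt_eqF.
have d0 : e ^+ 2 + t ^+ 2 != 0 by rewrite gt_eqF// ltr_pwDl ?exprn_gt0// sqr_ge0.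
pose f y := (1 + cos (t * y)) * expR (- (e * y)).
(* The primitive of exp(-e y) plus the real part of exp((i t - e) y)/(i t - e). *)
pose F y := (- e^-1 + (t * sin (t * y) - e * cos (t * y)) / (e ^+ 2 + t ^+ 2))
  * expR (- (e * y)).
have dF y : is_derive y 1 F (f y).
  rewrite /F /f; apply: is_derive_eq.
  rewrite /GRing.scale/=.
  move: (cos _) (sin _) (expR _) => c s E.
  by field; rewrite ?d0 ?en0.
have F0 : F 0 = - (e^-1 + e / (e ^+ 2 + t ^+ 2)).
  by rewrite /F !mulr0 sin0 cos0 oppr0 expR0; field; rewrite d0 en0.
rewrite (@ge0_continuous_FTC2y _ _ F 0 0).
- by rewrite F0 -EFinB sub0r opprK.
- by move=> y _; rewrite mulr_ge0 ?expR_ge0// -lerBlDl sub0r cos_geN1.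
- apply: continuous_subspaceT => y.
  have -> : (fun y : R => (1 + cos (t * y)) * expR (- (e * y))) = f by [].
  apply: cvgM.
    apply: cvgD; first exact: cvg_cst.
    apply: (@continuous_comp _ _ _ (fun y => t * y) cos); last exact: continuous_cos.
    by apply: cvgM; [exact: cvg_cst|exact: cvg_id].
  apply: (@continuous_comp _ _ _ (fun y => - (e * y)) expR); last exact: continuous_expR.
  by apply: cvgN; apply: cvgM; [exact: cvg_cst|exact: cvg_id].
- pose M := e^-1 + (`|t| + e) / (e ^+ 2 + t ^+ 2).
  have E0 : M * expR (- (e * y)) @[y --> +oo] --> (0 : R).
    rewrite -[0 in X in _ --> X](mulr0 M); apply: cvgM; first exact: cvg_cst.
    apply: (@cvg_comp _ _ _ (fun y : R => e * y) (fun z => expR (- z))).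
      by apply: gt0_cvgMry => //; exact: cvg_id.
    exact: cvgr_expR.
  apply/norm_cvg0P; apply: (squeeze_cvgr _ (cvg_cst 0) E0).
  apply: nearW => y; rewrite normr_ge0 /= /F normrM (ger0_norm (expR_ge0 _)).
  rewrite ler_wpM2r ?expR_ge0// (le_trans (ler_normD _ _))// lerD//.
    by rewrite normrN ger0_norm// invr_ge0 ltW.
  have dp : 0 < e ^+ 2 + t ^+ 2 by rewrite ltr_pwDl ?exprn_gt0// sqr_ge0.
  rewrite normrM normfV (gtr0_norm dp) ler_wpM2r ?invr_ge0 ?(ltW dp)//.
  rewrite (le_trans (ler_normB _ _))// !normrM (gtr0_norm e0) lerD//.
    by rewrite ler_piMr// ler_norml sin_geN1 sin_le1.
  by rewrite ler_piMr ?(ltW e0)// ler_norml cos_geN1 cos_le1.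
- by move=> y _; have [] := dF y.
- apply: cvg_at_right_filter.
  have : {for 0, continuous F}.
    apply/differentiable_continuous/derivable1_diffP.
    by have [] := dF 0.
  exact.
- by move=> y _; rewrite derive1E; have [_ ->] := dF y.
Qed.

Lemma integral_1cos_expabs e t : 0 < e ->
  (\int[mu]_y ((1 + cos (t * y)) * expabs e y)%:E =
  (2 * (e^-1 + e / (e ^+ 2 + t ^+ 2)))%:E)%E.
Proof.
move=> e0; rewrite ge0_symfun_integralT.
- rewrite EFinM -(integral_halfline t e0) -set_itvcy; congr (_ * _)%E.
  apply: eq_integral => y; rewrite inE/= in_itv/= andbT => y0.
  by rewrite /expabs ger0_norm.
- by move=> y; rewrite mulr_ge0 ?expabs_ge0// -lerBlDl sub0r cos_geN1.
- move=> y; apply: cvgM; last exact: continuous_expabs.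
  apply: cvgD; first exact: cvg_cst.
  apply: (@continuous_comp _ _ _ (fun y => t * y) cos); last exact: continuous_cos.
  by apply: cvgM; [exact: cvg_cst|exact: cvg_id].
- by move=> y; rewrite /= expabsN mulrN cosN.
Qed.

Lemma integral_expabs e : 0 < e -> (\int[mu]_y (expabs e y)%:E = (2 / e)%:E)%E.
Proof.
move=> e0; have := integral_1cos_expabs 0 e0.
under eq_integral do rewrite mul0r cos0 EFinM.
rewrite ge0_integralZl//; last 2 first.
- by apply/measurable_EFinP; exact: measurable_expabs.
- by move=> y _; rewrite lee_fin expabs_ge0.
move=> /(congr1 (fun z => (2^-1)%:E * z)%E).
rewrite muleA -!EFinM mulVf// mul1e => ->; congr EFin.
by rewrite expr0n/= addr0; field; rewrite gt_eqF.
Qed.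

Lemma integrable_expabs e : 0 < e -> mu.-integrable setT (EFin \o expabs e).
Proof.
move=> e0; apply/integrableP; split; first by apply/measurable_EFinP; exact: measurable_expabs.
under eq_integral do rewrite /= ger0_norm ?expabs_ge0//.
by rewrite integral_expabs// ltry.
Qed.

Lemma measurable_trigMl (tr : R -> R) t : continuous tr ->
  measurable_fun setT (fun y => tr (t * y)).
Proof.
move=> ctr; apply: continuous_measurable_fun => y.
apply: (@continuous_comp _ _ _ (fun y => t * y) tr); last exact: ctr.
by apply: cvgM; [exact: cvg_cst|exact: cvg_id].
Qed.

Lemma integrable_trig_expabs (tr : R -> R) e t : continuous tr ->
  (forall s, `|tr s| <= 1) -> 0 < e ->
  mu.-integrable setT (fun y => (tr (t * y) * expabs e y)%:E).
Proof.
move=> ctr tr1 e0; apply: (le_integrable measurableT) (integrable_expabs e0).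
  apply/measurable_EFinP/measurable_funM; last exact: measurable_expabs.
  exact: measurable_trigMl.
move=> y _ /=; rewrite lee_fin normrM ler_piMl//; exact: tr1.
Qed.

Lemma integral_cos_expabs e t : 0 < e ->
  (\int[mu]_y (cos (t * y) * expabs e y)%:E = (2 * e / (e ^+ 2 + t ^+ 2))%:E)%E.
Proof.
move=> e0; have := integral_1cos_expabs t e0.
have ic : mu.-integrable setT (fun y => (cos (t * y) * expabs e y)%:E).
  apply: integrable_trig_expabs => //; first exact: continuous_cos.
  by move=> s; rewrite ler_norml cos_geN1 cos_le1.
under eq_integral do rewrite mulrDl mul1r EFinD.
rewrite integralD//; last exact: integrable_expabs.
rewrite integral_expabs//.
have := integrable_fin_num measurableT ic.
case: (\int[mu]_y _)%E => // r _; rewrite -EFinD => -[] h.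
by congr EFin; rewrite mulrDr in h; apply: (addrI (2 / e)); rewrite h mulrA.
Qed.

Lemma integral_sin_expabs e t : 0 < e ->
  (\int[mu]_y (sin (t * y) * expabs e y)%:E = 0)%E.
Proof.
move=> e0; set I := (\int[mu]_y _)%E.
have is_ : mu.-integrable setT (fun y => (sin (t * y) * expabs e y)%:E).
  apply: integrable_trig_expabs => //; first exact: continuous_sin.
  by move=> s; rewrite ler_norml sin_geN1 sin_le1.
have isN : mu.-integrable setT (fun y => (sin (t * - y) * expabs e (- y))%:E).
  apply: eq_integrable (integrableN is_) => // y _ /=.
  by rewrite mulrN sinN expabsN mulNr.
have IN : I = (- I)%E.
  rewrite {1}/I.
  transitivity (\int[pushforward mu (-%R : _ -> measurableTypeR R)]_y
      (sin (t * y) * expabs e y)%:E)%E.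
    by apply: eq_measure_integral => A mA _; apply/esym/lebesgue_measureN.
  rewrite integral_pushforward//=; last exact: measurable_int is_.
  rewrite preimage_setT -integralN; last exact: integrable_add_def.
  by apply: eq_integral => y _; rewrite mulrN sinN expabsN mulNr.
have := integrable_fin_num measurableT is_.
rewrite -/I; move: IN; case: I => // r [] rN _; congr EFin; lra.
Qed.

End laplace.

(** * Approximate identities *)

Section vanishing.
Variable R : realType.
Implicit Types u v : nat -> \bar R.

(** Convergence to 0 from above only: on nonnegative sequences it is plain convergence
    ([vanishing_cvg0]), and it passes to smaller sequences and to sums in the extended reals without
    side conditions. *)
Definition vanishing u := forall e : R, 0 < e -> \forall n \near \oo, (u n <= e%:E)%E.

Lemma cvg0_vanishing u : u n @[n --> \oo] --> 0%E -> vanishing u.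
Proof.
move=> u0 e e0; have e0' : (0 < e%:E)%E by rewrite lte_fin.
near=> n; apply: ltW; near: n.
exact: (u0 _ (open_ereal_lt' e0')).
Unshelve. all: by end_near. Qed.

Lemma vanishing_le u v : (forall n, (u n <= v n)%E) -> vanishing v -> vanishing u.
Proof.
move=> uv v0 e e0; apply: filterS (v0 e e0) => n; exact/le_trans/uv.
Qed.

Lemma vanishingD u v : vanishing u -> vanishing v ->
  vanishing (fun n => u n + v n)%E.
Proof.
move=> u0 v0 e e0.
have e20 : 0 < e / 2 by rewrite divr_gt0.
near=> n; rewrite [e]splitr EFinD leeD//.
- by near: n; exact: u0.
- by near: n; exact: v0.
Unshelve. all: by end_near. Qed.

Lemma vanishingZ (c : R) u : 0 <= c -> vanishing u ->
  vanishing (fun n => c%:E * u n)%E.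
Proof.
move=> c0 u0 e e0.
have d0 : 0 < e / (c + 1) by rewrite divr_gt0// ltr_wpDl.
apply: filterS (u0 _ d0) => n un.
apply: (le_trans (lee_wpmul2l _ un)); first by rewrite lee_fin.
rewrite -EFinM lee_fin mulrCA ler_piMr ?(ltW e0)// ler_pdivrMr ?ltr_wpDl//.
by rewrite mul1r lerDl.
Qed.

Lemma vanishing_cvg0 u : (forall n, 0 <= u n)%E -> vanishing u ->
  u n @[n --> \oo] --> 0%E.
Proof.
move=> u_ge0 u0; apply/fine_cvgP; split.
  apply: filterS (u0 1 ltr01) => n un.
  by rewrite ge0_fin_numE// (le_lt_trans un)// ltry.
apply/cvgrPdist_le => e e0; apply: filterS (u0 e e0) => n un /=.
rewrite sub0r normrN ger0_norm ?fine_ge0// -lee_fin fineK//.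
by rewrite ge0_fin_numE// (le_lt_trans un)// ltry.
Qed.

End vanishing.

Section nonnegative_integral.
Local Open Scope ereal_scope.
Context d (T : measurableType d) (R : realType).
Variable mu : {measure set T -> \bar R}.
Implicit Types f g : T -> R.

Lemma le_integral_EFin f g : measurable_fun setT f -> measurable_fun setT g ->
  (forall x, (0 <= f x)%R) -> (forall x, (f x <= g x)%R) ->
  \int[mu]_x (f x)%:E <= \int[mu]_x (g x)%:E.
Proof.
move=> mf mg f0 fg; apply: ge0_le_integral => //.
- by move=> x _; rewrite lee_fin.
- exact/measurable_EFinP.
- exact/measurable_EFinP.
- by move=> x _; rewrite lee_fin.
Qed.

Lemma integralD_EFin_ge0 f g : measurable_fun setT f -> measurable_fun setT g ->
  (forall x, (0 <= f x)%R) -> (forall x, (0 <= g x)%R) ->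
  \int[mu]_x (f x + g x)%:E = \int[mu]_x (f x)%:E + \int[mu]_x (g x)%:E.
Proof.
move=> mf mg f0 g0.
under eq_integral do rewrite EFinD.
rewrite ge0_integralD//.
- by move=> x _; rewrite lee_fin.
- exact/measurable_EFinP.
- by move=> x _; rewrite lee_fin.
- exact/measurable_EFinP.
Qed.

Lemma integralZ_EFin_ge0 (c : R) f : measurable_fun setT f -> (0 <= c)%R ->
  (forall x, (0 <= f x)%R) ->
  \int[mu]_x (c * f x)%:E = c%:E * \int[mu]_x (f x)%:E.
Proof.
move=> mf c0 f0.
under eq_integral do rewrite EFinM.
rewrite ge0_integralZl//.
- exact/measurable_EFinP.
- by move=> x _; rewrite lee_fin.
Qed.

End nonnegative_integral.

Section square_integral.
Local Open Scope ereal_scope.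
Context d (T : measurableType d) (R : realType).
Variable mu : {measure set T -> \bar R}.
Implicit Types f g : T -> R.

Definition sqint f := \int[mu]_x (f x ^+ 2)%:E.

Lemma sqint_ge0 f : 0 <= sqint f.
Proof. by apply: integral_ge0 => x _; rewrite lee_fin sqr_ge0. Qed.

Lemma sqintN f : sqint (fun x => - f x)%R = sqint f.
Proof. by apply: eq_integral => x _; rewrite sqrrN. Qed.

Lemma sqr_addr_le (a b : R) : ((a + b) ^+ 2 <= 2 * a ^+ 2 + 2 * b ^+ 2)%R.
Proof. by rewrite -subr_ge0 (_ : _ - _ = (a - b) ^+ 2)%R ?sqr_ge0//; ring. Qed.

Lemma sqintD f g : measurable_fun setT f -> measurable_fun setT g ->
  sqint (fun x => f x + g x)%R <= 2%:E * sqint f + 2%:E * sqint g.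
Proof.
move=> mf mg; rewrite /sqint.
have mf2 := measurable_funX 2%N mf; have mg2 := measurable_funX 2%N mg.
rewrite -!integralZ_EFin_ge0//; try by move=> x; exact: sqr_ge0.
rewrite -integralD_EFin_ge0//; last 4 first.
- exact: measurable_funM.
- exact: measurable_funM.
- by move=> x; rewrite mulr_ge0// sqr_ge0.
- by move=> x; rewrite mulr_ge0// sqr_ge0.
apply: le_integral_EFin => [|||x].
- by apply: measurable_funX; exact: measurable_funD.
- by apply: measurable_funD; exact: measurable_funM.
- by move=> x; exact: sqr_ge0.
- exact: sqr_addr_le.
Qed.

End square_integral.

(** * The energy of a symmetric Markov kernel *)

Section kernel_distance.
Local Open Scope ereal_scope.
Context d (T : measurableType d) (R : realType).
Variable mu : {sigma_finite_measure set T -> \bar R}.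
Implicit Types (k : T -> T -> R) (f g : T -> R).

(** By symmetry and unit mass, the measure k(x, y) dmu dmu on pairs has both marginals equal to mu;
    this is the content of [integral_kernel1] and [integral_kernel2]. *)
Definition markov_kernel k := [/\ measurable_fun setT (fun z : T * T => k z.1 z.2),
  forall x y, (0 <= k x y)%R, forall x y, k x y = k y x &
  forall x, \int[mu]_y (k x y)%:E = 1].

(* The integral of k x y * f x * f y is that of f ^+ 2 minus kdist k f / 2. *)
Definition kdist k f :=
  \int[mu \x mu]_z (k z.1 z.2 * (f z.1 - f z.2) ^+ 2)%:E.

Lemma kdist_ge0 k f : markov_kernel k -> 0 <= kdist k f.
Proof.
by case=> _ k0 _ _; apply: integral_ge0 => z _; rewrite lee_fin mulr_ge0// sqr_ge0.
Qed.

Let measurable_fst_comp f : measurable_fun setT f ->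
  measurable_fun setT (fun z : T * T => f z.1).
Proof. by move=> mf; exact: measurableT_comp mf measurable_fst. Qed.

Let measurable_snd_comp f : measurable_fun setT f ->
  measurable_fun setT (fun z : T * T => f z.2).
Proof. by move=> mf; exact: measurableT_comp mf measurable_snd. Qed.

Let measurable_kdist k f : markov_kernel k -> measurable_fun setT f ->
  measurable_fun setT (fun z : T * T => k z.1 z.2 * (f z.1 - f z.2) ^+ 2)%R.
Proof.
move=> [mk _ _ _] mf; apply: measurable_funM => //.
by apply: measurable_funX; apply: measurable_funB;
  [exact: measurable_fst_comp|exact: measurable_snd_comp].
Qed.

Lemma integral_kernel1 k f : markov_kernel k -> measurable_fun setT f ->
  (forall x, (0 <= f x)%R) ->
  \int[mu \x mu]_z (k z.1 z.2 * f z.1)%:E = \int[mu]_x (f x)%:E.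
Proof.
move=> [mk k0 kC k1] mf f0.
rewrite fubini_tonelli1; last 2 first.
- apply/measurable_EFinP; apply: measurable_funM => //; exact: measurable_fst_comp.
- by move=> z; rewrite lee_fin mulr_ge0.
apply: eq_integral => x _; rewrite /fubini_F /=.
under eq_integral do rewrite mulrC.
rewrite integralZ_EFin_ge0//; last exact: measurable_fun_pair2 mk.
by rewrite k1 mule1.
Qed.

Lemma integral_kernel2 k f : markov_kernel k -> measurable_fun setT f ->
  (forall x, (0 <= f x)%R) ->
  \int[mu \x mu]_z (k z.1 z.2 * f z.2)%:E = \int[mu]_x (f x)%:E.
Proof.
move=> [mk k0 kC k1] mf f0.
rewrite fubini_tonelli2; last 2 first.
- apply/measurable_EFinP; apply: measurable_funM => //; exact: measurable_snd_comp.
- by move=> z; rewrite lee_fin mulr_ge0.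
apply: eq_integral => x _; rewrite /fubini_G /=.
under eq_integral do rewrite mulrC kC.
rewrite integralZ_EFin_ge0//; last exact: measurable_fun_pair2 mk.
by rewrite k1 mule1.
Qed.

Lemma kdist_sqint k f : markov_kernel k -> measurable_fun setT f ->
  kdist k f <= 4%:E * sqint mu f.
Proof.
move=> km mf; have [mk k0 kC k1] := km.
have mf2 := measurable_funX 2%N mf.
have sq0 x : (0 <= f x ^+ 2)%R by exact: sqr_ge0.
have m1 : measurable_fun setT (fun z : T * T => k z.1 z.2 * f z.1 ^+ 2)%R.
  by apply: measurable_funM => //; exact: (measurable_fst_comp mf2).
have m2 : measurable_fun setT (fun z : T * T => k z.1 z.2 * f z.2 ^+ 2)%R.
  by apply: measurable_funM => //; exact: (measurable_snd_comp mf2).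
apply: (@le_trans _ _ (\int[mu \x mu]_z (2 * (k z.1 z.2 * f z.1 ^+ 2)
    + 2 * (k z.1 z.2 * f z.2 ^+ 2))%:E)).
  apply: le_integral_EFin => [|||z].
  - exact: measurable_kdist.
  - by apply: measurable_funD; exact: measurable_funM.
  - by move=> z; rewrite mulr_ge0// sqr_ge0.
  - rewrite !(mulrCA 2%R (k _ _)) -mulrDr ler_wpM2l//.
    by have := sqr_addr_le (f z.1) (- f z.2)%R; rewrite sqrrN.
rewrite integralD_EFin_ge0; last 4 first.
- by apply: measurable_funM.
- by apply: measurable_funM.
- by move=> z; rewrite mulr_ge0// mulr_ge0.
- by move=> z; rewrite mulr_ge0// mulr_ge0.
rewrite !integralZ_EFin_ge0//; try by move=> z; rewrite mulr_ge0.
rewrite (@integral_kernel1 k (fun x => f x ^+ 2)%R)//.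
rewrite (@integral_kernel2 k (fun x => f x ^+ 2)%R)//.
rewrite -/(sqint mu f) (_ : 4%:E = 2%:E + 2%:E :> \bar R); last first.
  by rewrite -EFinD; congr EFin; ring.
by rewrite ge0_muleDl.
Qed.

Lemma kdistD k f g : markov_kernel k -> measurable_fun setT f ->
  measurable_fun setT g ->
  kdist k (fun x => f x + g x)%R <= 2%:E * kdist k f + 2%:E * kdist k g.
Proof.
move=> km mf mg; have [mk k0 kC k1] := km.
have mF := measurable_kdist km mf; have mG := measurable_kdist km mg.
have sq0 (a b : R) (z : T * T) : (0 <= k z.1 z.2 * (a - b) ^+ 2)%R.
  by rewrite mulr_ge0// sqr_ge0.
rewrite /kdist -!integralZ_EFin_ge0// -integralD_EFin_ge0//; last 4 first.
- exact: measurable_funM.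
- exact: measurable_funM.
- by move=> z; rewrite mulr_ge0.
- by move=> z; rewrite mulr_ge0.
apply: le_integral_EFin => [||z|z].
- exact: (@measurable_kdist k (fun x => f x + g x)%R km (measurable_funD mf mg)).
- by apply: measurable_funD; exact: measurable_funM.
- exact: sq0.
- rewrite !(mulrCA 2%R (k _ _)) -mulrDr ler_wpM2l// opprD addrACA.
  exact: sqr_addr_le.
Qed.

Lemma kdistZ k (c : R) f : markov_kernel k -> measurable_fun setT f ->
  kdist k (fun x => c * f x)%R = (c ^+ 2)%:E * kdist k f.
Proof.
move=> km mf; have [mk k0 kC k1] := km.
rewrite /kdist -integralZ_EFin_ge0 ?sqr_ge0//; last 2 first.
- exact: measurable_kdist.
- by move=> z; rewrite mulr_ge0// sqr_ge0.
by apply: eq_integral => z _; rewrite -mulrBr exprMn mulrCA.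
Qed.

End kernel_distance.

Section approximate_identity.
Local Open Scope ereal_scope.
Context d (T : measurableType d) (R : realType).
Variable mu : {sigma_finite_measure set T -> \bar R}.
Implicit Types (k : nat -> T -> T -> R) (f g : T -> R).

(** Stated through the energy instead of the convergence of smoothed functions: it is all that the
    Parseval identity uses, and in this form the property passes to products. *)
Definition approx_identity k := (forall n, markov_kernel mu (k n)) /\
  forall f, measurable_fun setT f -> sqint mu f < +oo ->
    vanishing (fun n => kdist mu (k n) f).

Section criterion.
Import HBNNSimple.
Variable k : nat -> T -> T -> R.
Hypothesis km : forall n, markov_kernel mu (k n).
Hypothesis k_sets : forall A, measurable A -> mu A < +oo ->
  vanishing (fun n => kdist mu (k n) \1_A).

Let good f := measurable_fun setT f /\ vanishing (fun n => kdist mu (k n) f).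

Let goodD f g : good f -> good g -> good (fun x => f x + g x)%R.
Proof.
move=> [mf f0] [mg g0]; split; first exact: measurable_funD.
apply: (vanishing_le (fun n => kdistD (km n) mf mg)).
by apply: vanishingD; exact: vanishingZ.
Qed.

Let goodZ (c : R) f : good f -> good (fun x => c * f x)%R.
Proof.
move=> [mf f0]; split; first exact: measurable_funM.
apply: (@vanishing_le _ _ (fun n => (c ^+ 2)%:E * kdist mu (k n) f)).
  by move=> n; rewrite kdistZ.
by apply: vanishingZ => //; exact: sqr_ge0.
Qed.

Let good0 : good (fun=> 0%R).
Proof.
have : good \1_(set0 : set T).
  by split; [exact: measurable_indic|apply: k_sets => //; rewrite measure0].
by move=> /(goodZ 0); under eq_fun do rewrite mul0r.
Qed.

Let good_sum (r : nat) (F : 'I_r -> T -> R) : (forall i, good (F i)) ->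
  good (fun x => \sum_(i < r) F i x)%R.
Proof.
move=> gF; elim: (index_enum _) => [|i s IH].
  by under eq_fun do rewrite big_nil.
by under eq_fun do rewrite big_cons; exact: goodD.
Qed.

(** The bound kdist <= 4 sqint is uniform in n, so the property survives limits in L_2. *)
Let good_closed f : measurable_fun setT f ->
  (forall e : R, (0 < e)%R -> exists2 g, good g &
    sqint mu (fun x => f x - g x)%R <= e%:E) -> good f.
Proof.
move=> mf fg; split => // e e0.
(* With f = (f - g) + g the energy is at most 2 (4 e/16) + 2 (e/4) = e. *)
have e1 : (0 < e / 16)%R by rewrite divr_gt0.
have [g [mg g0] fge] := fg _ e1.
have e2 : (0 < e / 4)%R by rewrite divr_gt0.
apply: filterS (g0 _ e2) => n kg.
have mfg : measurable_fun setT (fun x => f x - g x)%R by exact: measurable_funB.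
have := kdistD (km n) mfg mg.
under [X in kdist _ _ X]eq_fun do rewrite subrK.
move=> /le_trans; apply.
apply: (@le_trans _ _ (2%:E * (4%:E * (e / 16)%:E) + 2%:E * (e / 4)%:E)).
  apply: leeD; apply: lee_wpmul2l => //.
  apply: (le_trans (kdist_sqint (km n) mfg)); exact: lee_wpmul2l.
by rewrite -!EFinM -EFinD lee_fin; lra.
Qed.

Let good_nnsfun (s : {nnsfun T >-> R}) : sqint mu s < +oo -> good s.
Proof.
move=> s2.
pose ys := finmap.enum_fset (fset_set (range s)).
pose F (i : 'I_(size ys)) x := (ys`_i * \1_(s @^-1` [set ys`_i]) x)%R.
rewrite (_ : (s : T -> R) = (fun x => \sum_(i < size ys) F i x)%R); last first.
  by apply/funext => x; exact: fimfunEord.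
apply: good_sum => i; rewrite /F; set y := (ys`_i)%R.
(* The value 0 is set apart, since its level set may have infinite measure. For y != 0, y^2 times
   the measure of the level set is at most the integral of s^2. *)
have [->|y0] := eqVneq y 0%R.
  by under eq_fun do rewrite mul0r.
apply: goodZ; have mA : measurable (s @^-1` [set y]).
  by rewrite -[X in measurable X]setTI; exact: measurable_funP.
split; first exact: measurable_indic.
apply: k_sets => //; have y2 : (0 < y ^+ 2)%R by rewrite exprn_even_gt0.
rewrite -(@lte_pmul2l _ (y ^+ 2)%:E)// mulry gtr0_sg// mul1e.
apply: le_lt_trans s2.
rewrite -[X in mu X]setIT -integral_indic// -integralZ_EFin_ge0// ?(ltW y2)//.
apply: le_integral_EFin => [|||x].
- exact: measurable_funM.
- by apply: measurable_funX.
- by move=> x; rewrite mulr_ge0// ltW.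
- rewrite indicE; have [/set_mem /= ->|_] := boolP (x \in _); first by rewrite mulr1.
  by rewrite mulr0 sqr_ge0.
Qed.

Let good_ge0 f : measurable_fun setT f -> (forall x, 0 <= f x)%R ->
  sqint mu f < +oo -> good f.
Proof.
move=> mf f0 f2.
have mEf : measurable_fun setT (EFin \o f) by exact/measurable_EFinP.
pose s := nnsfun_approx measurableT mEf.
have sf x : s n x @[n --> \oo] --> f x.
  have := @cvg_nnsfun_approx _ _ _ _ measurableT _ mEf _ x I.
  by move=> /(_ (fun x _ => f0 x)) /fine_cvgP[].
have s_le n x : (s n x <= f x)%R.
  have nd : nondecreasing_seq (fun n => s n x).
    by move=> m p mp; exact/lefP/nd_nnsfun_approx.
  rewrite -(cvg_lim _ (sf x))//; apply: nondecreasing_cvgn_le => //.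
  by apply/cvg_ex; exists (f x).
have s0 n x : (0 <= s n x)%R by exact: fun_ge0.
have sms n : measurable_fun setT (s n) by exact: measurable_funP.
have dle n x : ((f x - s n x) ^+ 2 <= f x ^+ 2)%R.
  by rewrite lerXn2r ?nnegrE// ?subr_ge0// gerBl.
have if2 : mu.-integrable setT (fun x => (f x ^+ 2)%:E).
  apply/integrableP; split; first by apply/measurable_EFinP; exact: measurable_funX.
  by under eq_integral do rewrite gee0_abs ?lee_fin ?sqr_ge0//.
have v : vanishing (fun n => sqint mu (fun x => f x - s n x)%R).
  apply: cvg0_vanishing; rewrite -(integral0 mu setT).
  apply: dominated_cvg if2 _ => //.
  - by move=> n; apply/measurable_EFinP/measurable_funX; exact: measurable_funB.
  - move=> x _ /=; apply: cvg_EFin; first exact: nearW.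
    rewrite [0%R](_ : _ = (f x - f x) ^+ 2)%R; last by rewrite subrr expr0n.
    apply: (@cvg_comp _ _ _ (fun n => f x - s n x)%R (fun y : R => y ^+ 2)%R).
      by apply: cvgB; [exact: cvg_cst|exact: sf].
    exact: exprn_continuous.
  - by move=> n x _ /=; rewrite lee_fin ger0_norm ?sqr_ge0.
apply: good_closed => // e /v [N _ /(_ N (leqnn N)) HN].
exists (s N) => //; apply: good_nnsfun; apply: le_lt_trans f2.
apply: le_integral_EFin => [|||x].
- exact: measurable_funX.
- exact: measurable_funX.
- by move=> x; exact: sqr_ge0.
- by rewrite lerXn2r ?nnegrE.
Qed.

(** Simple functions are dense in L_2 and [good] is closed under sums, scalar multiples and L_2
    limits. Monotone approximation wants a nonnegative function, whence the splitting into positive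
    and negative parts. *)
Lemma approx_identity_sets : approx_identity k.
Proof.
split => // f mf f2.
have part (h : T -> R) : measurable_fun setT h -> (forall x, 0 <= h x)%R ->
    (forall x, h x <= `|f x|)%R -> good h.
  move=> mh h0 hf; apply: good_ge0 => //; apply: le_lt_trans f2.
  apply: le_integral_EFin => [|||x].
  - exact: measurable_funX.
  - exact: measurable_funX.
  - by move=> x; exact: sqr_ge0.
  - by rewrite -[(f x ^+ 2)%R]real_normK ?num_real// lerXn2r ?nnegrE.
suff [] : good f by [].
have -> : f = (fun x => f^\+ x + -1 * f^\- x)%R.
  by rewrite -[LHS](funrposBneg f); apply/funext => x; rewrite mulN1r.
apply: goodD; last apply: goodZ; apply: part.
- exact: measurable_funrpos.
- by move=> x; rewrite /funrpos le_max lexx orbT.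
- by move=> x; rewrite /funrpos ge_max normr_ge0 ler_norm.
- exact: measurable_funrneg.
- by move=> x; rewrite /funrneg le_max lexx orbT.
- by move=> x; rewrite /funrneg ge_max normr_ge0 -normrN ler_norm.
Qed.

End criterion.
End approximate_identity.

Lemma vanishing_integral d (T : measurableType d) (R : realType)
    (mu : {measure set T -> \bar R}) (u : nat -> T -> \bar R) (g : T -> \bar R) :
  (forall n, measurable_fun setT (u n)) -> (forall n x, 0 <= u n x)%E ->
  mu.-integrable setT g -> (forall n x, u n x <= g x)%E ->
  {ae mu, forall x, vanishing (u ^~ x)} ->
  vanishing (fun n => \int[mu]_x u n x)%E.
Proof.
move=> mu_ u0 ig ug uv; apply: cvg0_vanishing; rewrite -(integral0 mu setT).
have [||_ _] := @dominated_convergence _ _ _ mu _ measurableT u (cst 0%E) g mu_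
  (measurable_cst _) _ ig _; last exact.
- by apply: filterS uv => x ux _; exact: vanishing_cvg0.
- by apply: aeW => x n _; rewrite gee0_abs.
Qed.

Section product_measure.
Local Open Scope ereal_scope.
Context d1 d2 (X : measurableType d1) (Y : measurableType d2) (R : realType).
Variable mu : {sigma_finite_measure set X -> \bar R}.
Variable nu : {sigma_finite_measure set Y -> \bar R}.

(** A name for the product measure, to which the sigma-finite structure is attached; [kdist] on a
    product space and iterated Fubini rest on it. *)
Definition prod_measure := mu \x nu.

HB.instance Definition _ := Measure.on prod_measure.

Fact prod_measure_sigma_finite : sigma_finite setT prod_measure.
Proof.
have /sigma_finiteP[F [TF ndF Foo]] := sigma_finiteT mu.
have /sigma_finiteP[G [TG ndG Goo]] := sigma_finiteT nu.
exists (fun n => F n `*` G n) => [|n]; last first.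
  have [mF muF] := Foo n; have [mG nuG] := Goo n.
  split; first exact: measurableX.
  by rewrite /prod_measure product_measure1E// lte_mul_pinfty// ge0_fin_numE.
apply/seteqP; split => // -[x y] _.
have [i _ Fx] : (\bigcup_n F n) x by rewrite -TF.
have [j _ Gy] : (\bigcup_n G n) y by rewrite -TG.
exists (maxn i j) => //; split.
- by move: Fx; exact/subsetPset/ndF/leq_maxl.
- by move: Gy; exact/subsetPset/ndG/leq_maxr.
Qed.

HB.instance Definition _ := Measure_isSigmaFinite.Build _ _ _ prod_measure
  prod_measure_sigma_finite.

End product_measure.

(** * Products of approximate identities *)

Section approximate_identity_prod.
Local Open Scope ereal_scope.
Context d1 d2 (X : measurableType d1) (Y : measurableType d2) (R : realType).
Variable mu : {sigma_finite_measure set X -> \bar R}.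
Variable nu : {sigma_finite_measure set Y -> \bar R}.

Definition prod_kernel (k : X -> X -> R) (l : Y -> Y -> R) (p q : X * Y) : R :=
  k p.1 q.1 * l p.2 q.2.

Let mpair12 : measurable_fun setT (fun z : (X * Y) * (X * Y) => (z.1.1, z.2.1)).
Proof.
by apply: measurable_fun_pair; [exact: measurableT_comp measurable_fst measurable_fst
  |exact: measurableT_comp measurable_fst measurable_snd].
Qed.

Let mpair22 : measurable_fun setT (fun z : (X * Y) * (X * Y) => (z.1.2, z.2.2)).
Proof.
by apply: measurable_fun_pair; [exact: measurableT_comp measurable_snd measurable_fst
  |exact: measurableT_comp measurable_snd measurable_snd].
Qed.

Lemma markov_kernel_prod k l : markov_kernel mu k -> markov_kernel nu l ->
  markov_kernel (prod_measure mu nu) (prod_kernel k l).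
Proof.
move=> [mk k0 kC k1] [ml l0 lC l1]; split => [|p q|p q|p].
- by apply: measurable_funM; [exact: measurableT_comp mk mpair12
    |exact: measurableT_comp ml mpair22].
- by rewrite mulr_ge0.
- by rewrite /prod_kernel kC lC.
- have mk' := measurable_fun_pair2 p.1 mk.
  have ml' := measurable_fun_pair2 p.2 ml.
  rewrite fubini_tonelli1; last 2 first.
  + apply/measurable_EFinP/measurable_funM.
    * exact: measurableT_comp mk' measurable_fst.
    * exact: measurableT_comp ml' measurable_snd.
  + by move=> q; rewrite lee_fin mulr_ge0.
  rewrite -(k1 p.1); apply: eq_integral => x _; rewrite /fubini_F /prod_kernel/=.
  by rewrite integralZ_EFin_ge0// l1 mule1.
Qed.

Section bound.
Variables (k : X -> X -> R) (l : Y -> Y -> R) (f : X * Y -> R).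
Hypotheses (km : markov_kernel mu k) (lm : markov_kernel nu l).
Hypothesis mf : measurable_fun setT f.

Let mkz : measurable_fun setT (fun z : (X * Y) * (X * Y) => k z.1.1 z.2.1).
Proof. by case: km => mk _ _ _; exact: measurableT_comp mk mpair12. Qed.

Let mlz : measurable_fun setT (fun z : (X * Y) * (X * Y) => l z.1.2 z.2.2).
Proof. by case: lm => ml _ _ _; exact: measurableT_comp ml mpair22. Qed.

(** To go from (x, y) to (x', y') one coordinate is changed at a time, through the intermediate
    point (x', y): [D1] moves the first coordinate and [D2] the second. *)
Let D1 (z : (X * Y) * (X * Y)) := (f z.1 - f (z.2.1, z.1.2))%R.
Let D2 (z : (X * Y) * (X * Y)) := (f (z.2.1, z.1.2) - f z.2)%R.

Let mfz : measurable_fun setT (fun z : (X * Y) * (X * Y) => f (z.2.1, z.1.2)).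
Proof.
apply: (measurableT_comp mf); apply: measurable_fun_pair.
- exact: measurableT_comp measurable_fst measurable_snd.
- exact: measurableT_comp measurable_snd measurable_fst.
Qed.

Let mD1 : measurable_fun setT D1.
Proof. by apply: measurable_funB => //; exact: measurableT_comp mf measurable_fst. Qed.

Let mD2 : measurable_fun setT D2.
Proof. by apply: measurable_funB => //; exact: measurableT_comp mf measurable_snd. Qed.

Let k0 x x' : (0 <= k x x')%R. Proof. by case: km. Qed.
Let l0 y y' : (0 <= l y y')%R. Proof. by case: lm. Qed.

Let mW (D : (X * Y) * (X * Y) -> R) : measurable_fun setT D ->
  measurable_fun setT (fun z => prod_kernel k l z.1 z.2 * D z ^+ 2)%R.
Proof.
move=> mD; apply: measurable_funM; last exact: measurable_funX.
by apply: measurable_funM.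
Qed.

Let W0 (D : (X * Y) * (X * Y) -> R) z : (0 <= prod_kernel k l z.1 z.2 * D z ^+ 2)%R.
Proof. by apply: mulr_ge0; [exact: mulr_ge0|exact: sqr_ge0]. Qed.

Let m1 : measurable_fun setT (fun w : Y * (X * X) =>
  (k w.2.1 w.2.2 * (f (w.2.1, w.1) - f (w.2.2, w.1)) ^+ 2)%R).
Proof.
case: km => mk _ _ _; apply: measurable_funM.
  exact: measurableT_comp mk measurable_snd.
apply: measurable_funX; apply: measurable_funB; apply: (measurableT_comp mf);
  apply: measurable_fun_pair => //.
- exact: measurableT_comp measurable_fst measurable_snd.
- exact: measurableT_comp measurable_snd measurable_snd.
Qed.

Let m2 : measurable_fun setT (fun w : X * (Y * Y) =>
  (l w.2.1 w.2.2 * (f (w.1, w.2.1) - f (w.1, w.2.2)) ^+ 2)%R).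
Proof.
case: lm => ml _ _ _; apply: measurable_funM.
  exact: measurableT_comp ml measurable_snd.
apply: measurable_funX; apply: measurable_funB; apply: (measurableT_comp mf);
  apply: measurable_fun_pair => //.
- exact: measurableT_comp measurable_fst measurable_snd.
- exact: measurableT_comp measurable_snd measurable_snd.
Qed.

Lemma measurable_kdist_left : measurable_fun setT
  (fun y => kdist mu k (fun x => f (x, y))).
Proof.
apply: (measurable_fun_fubini_tonelli_F (m2 := prod_measure mu mu) (fun w : Y * (X * X) =>
  (k w.2.1 w.2.2 * (f (w.2.1, w.1) - f (w.2.2, w.1)) ^+ 2)%:E)).
- exact/measurable_EFinP.
- by move=> w; rewrite lee_fin mulr_ge0// sqr_ge0.
Qed.

Lemma measurable_kdist_right : measurable_fun setT
  (fun x => kdist nu l (fun y => f (x, y))).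
Proof.
apply: (measurable_fun_fubini_tonelli_F (m2 := prod_measure nu nu) (fun w : X * (Y * Y) =>
  (l w.2.1 w.2.2 * (f (w.1, w.2.1) - f (w.1, w.2.2)) ^+ 2)%:E)).
- exact/measurable_EFinP.
- by move=> w; rewrite lee_fin mulr_ge0// sqr_ge0.
Qed.

(** Here y' occurs only in the factor l(y, y'), which integrates to 1; the energy of k on the
    sections with y fixed is left. *)
Let int1 : \int[prod_measure mu nu \x prod_measure mu nu]_z
    (prod_kernel k l z.1 z.2 * D1 z ^+ 2)%:E =
  \int[nu]_y kdist mu k (fun x => f (x, y)).
Proof.
rewrite fubini_tonelli1; last 2 first.
- by apply/measurable_EFinP; exact: mW mD1.
- by move=> z; rewrite lee_fin.
have mg : measurable_fun setT (fun w : (X * Y) * X =>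
    (k w.1.1 w.2 * (f w.1 - f (w.2, w.1.2)) ^+ 2)%R).
  case: km => mk _ _ _; apply: measurable_funM.
    have mp : measurable_fun setT (fun w : (X * Y) * X => (w.1.1, w.2)).
      apply: measurable_fun_pair => //.
      exact: measurableT_comp measurable_fst measurable_fst.
    exact: measurableT_comp mk mp.
  apply: measurable_funX; apply: measurable_funB.
    exact: measurableT_comp mf measurable_fst.
  apply: (measurableT_comp mf); apply: measurable_fun_pair => //.
  exact: measurableT_comp measurable_snd measurable_fst.
have g0 (w : (X * Y) * X) :
    0 <= (k w.1.1 w.2 * (f w.1 - f (w.2, w.1.2)) ^+ 2)%:E.
  by rewrite lee_fin mulr_ge0// sqr_ge0.
transitivity (\int[prod_measure mu nu]_p \int[mu]_x'
    (k p.1 x' * (f p - f (x', p.2)) ^+ 2)%:E).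
  apply: eq_integral => p _; rewrite /fubini_F /=.
  have mgp := measurable_fun_pair2 p mg.
  case: lm => ml _ _ l1; have ml' := measurable_fun_pair2 p.2 ml.
  rewrite fubini_tonelli1; last 2 first.
  - by apply/measurable_EFinP; exact: (measurable_fun_pair2 p (mW mD1)).
  - by move=> q; rewrite lee_fin; exact: (W0 D1 (p, q)).
  apply: eq_integral => x' _; rewrite /fubini_F /=.
  under eq_integral do rewrite /prod_kernel /D1 /= mulrAC.
  rewrite integralZ_EFin_ge0//; last by rewrite mulr_ge0// sqr_ge0.
  by rewrite l1 mule1.
rewrite fubini_tonelli2; last 2 first.
- exact: (measurable_fun_fubini_tonelli_F _ ((measurable_EFinP _ _).2 mg)).
- by move=> p; apply: integral_ge0 => x' _; exact: (g0 (p, x')).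
apply: eq_integral => y _; rewrite /fubini_G /kdist fubini_tonelli1//.
- by apply/measurable_EFinP; exact: (measurable_fun_pair2 y m1).
- by move=> w; rewrite lee_fin mulr_ge0// sqr_ge0.
Qed.

(** Now x occurs only in k(x, x'), and it is integrated first: the symmetry of k gives mass 1 in
    that variable as well. *)
Let int2 : \int[prod_measure mu nu \x prod_measure mu nu]_z
    (prod_kernel k l z.1 z.2 * D2 z ^+ 2)%:E =
  \int[mu]_x kdist nu l (fun y => f (x, y)).
Proof.
rewrite fubini_tonelli2; last 2 first.
- by apply/measurable_EFinP; exact: mW mD2.
- by move=> z; rewrite lee_fin.
have mg : measurable_fun setT (fun w : (X * Y) * Y =>
    (l w.2 w.1.2 * (f (w.1.1, w.2) - f w.1) ^+ 2)%R).
  case: lm => ml _ _ _; apply: measurable_funM.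
    have mp : measurable_fun setT (fun w : (X * Y) * Y => (w.2, w.1.2)).
      apply: measurable_fun_pair => //.
      exact: measurableT_comp measurable_snd measurable_fst.
    exact: measurableT_comp ml mp.
  apply: measurable_funX; apply: measurable_funB.
    apply: (measurableT_comp mf); apply: measurable_fun_pair => //.
    exact: measurableT_comp measurable_fst measurable_fst.
  exact: measurableT_comp mf measurable_fst.
have g0 (w : (X * Y) * Y) :
    0 <= (l w.2 w.1.2 * (f (w.1.1, w.2) - f w.1) ^+ 2)%:E.
  by rewrite lee_fin mulr_ge0// sqr_ge0.
transitivity (\int[prod_measure mu nu]_p \int[nu]_y
    (l y p.2 * (f (p.1, y) - f p) ^+ 2)%:E).
  apply: eq_integral => p _; rewrite /fubini_G /=.
  have mgp := measurable_fun_pair2 p mg.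
  case: km => mk _ kC k1; have mk' := measurable_fun_pair2 p.1 mk.
  rewrite fubini_tonelli2; last 2 first.
  - by apply/measurable_EFinP; exact: (measurable_fun_pair1 p (mW mD2)).
  - by move=> q; rewrite lee_fin; exact: (W0 D2 (q, p)).
  apply: eq_integral => y _; rewrite /fubini_G /=.
  under eq_integral do rewrite /prod_kernel /D2 /= -mulrA mulrC kC.
  rewrite integralZ_EFin_ge0//; last by rewrite mulr_ge0// sqr_ge0.
  by rewrite k1 mule1.
rewrite fubini_tonelli1; last 2 first.
- exact: (measurable_fun_fubini_tonelli_F _ ((measurable_EFinP _ _).2 mg)).
- by move=> p; apply: integral_ge0 => y _; exact: (g0 (p, y)).
apply: eq_integral => x _; rewrite /fubini_F /kdist fubini_tonelli2//.
- by apply/measurable_EFinP; exact: (measurable_fun_pair2 x m2).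
- by move=> w; rewrite lee_fin mulr_ge0// sqr_ge0.
Qed.

Lemma kdist_prod_le : kdist (prod_measure mu nu) (prod_kernel k l) f <=
  2%:E * \int[nu]_y kdist mu k (fun x => f (x, y)) +
  2%:E * \int[mu]_x kdist nu l (fun y => f (x, y)).
Proof.
rewrite -int1 -int2 -!integralZ_EFin_ge0//; try exact: mW.
rewrite -integralD_EFin_ge0//; last 4 first.
- by apply: measurable_funM => //; exact: mW.
- by apply: measurable_funM => //; exact: mW.
- by move=> z; rewrite mulr_ge0.
- by move=> z; rewrite mulr_ge0.
have mD : measurable_fun setT (fun z => D1 z + D2 z)%R by exact: measurable_funD.
have DE z : (D1 z + D2 z = f z.1 - f z.2)%R by rewrite /D1 /D2 addrA subrK.
apply: le_integral_EFin => [||z|z].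
- by have := mW mD; under eq_fun do rewrite DE.
- by apply: measurable_funD; apply: measurable_funM => //; exact: mW.
- by apply: mulr_ge0; [exact: mulr_ge0|exact: sqr_ge0].
- rewrite !(mulrCA 2%R (prod_kernel _ _ _ _)) -mulrDr -DE.
  apply: ler_wpM2l; first exact: mulr_ge0.
  exact: sqr_addr_le.
Qed.

End bound.

(** By Tonelli almost every section of f is in L_2, so its energy vanishes in the limit; 4 times its
    square norm dominates that energy and is integrable, so the two integrals of [kdist_prod_le]
    tend to 0 by dominated convergence. *)
Lemma approx_identity_prod k l : approx_identity mu k -> approx_identity nu l ->
  approx_identity (prod_measure mu nu) (fun n => prod_kernel (k n) (l n)).
Proof.
move=> [km kv] [lm lv]; split => [n|f mf f2]; first exact: markov_kernel_prod.
apply: (vanishing_le (fun n => kdist_prod_le (km n) (lm n) mf)).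
have mf2 : measurable_fun setT (fun z => (f z ^+ 2)%:E).
  by apply/measurable_EFinP; exact: measurable_funX.
have f20 z : 0 <= (f z ^+ 2)%:E by rewrite lee_fin sqr_ge0.
have mfx y : measurable_fun setT (fun x => f (x, y)) by exact: measurable_fun_pair1 mf.
have mfy x : measurable_fun setT (fun y => f (x, y)) by exact: measurable_fun_pair2 mf.
have iX : nu.-integrable setT (fun y => sqint mu (fun x => f (x, y))).
  apply/integrableP; split; first exact: (measurable_fun_fubini_tonelli_G _ mf2).
  under eq_integral do rewrite gee0_abs ?sqint_ge0//.
  by move: f2; rewrite /sqint fubini_tonelli2.
have iY : mu.-integrable setT (fun x => sqint nu (fun y => f (x, y))).
  apply/integrableP; split; first exact: (measurable_fun_fubini_tonelli_F _ mf2).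
  under eq_integral do rewrite gee0_abs ?sqint_ge0//.
  by move: f2; rewrite /sqint fubini_tonelli1.
apply: vanishingD; apply: vanishingZ => //.
- apply: (@vanishing_integral _ _ _ _ _ (fun y => 4%:E * sqint mu (fun x => f (x, y)))).
  + by move=> n; exact: measurable_kdist_left.
  + by move=> n y; exact: kdist_ge0.
  + exact: integrableZl.
  + by move=> n y; exact: kdist_sqint.
  + apply: filterS (integrable_ae measurableT iX) => y /(_ I) yfin.
    by apply: kv => //; rewrite -ge0_fin_numE ?sqint_ge0.
- apply: (@vanishing_integral _ _ _ _ _ (fun x => 4%:E * sqint nu (fun y => f (x, y)))).
  + by move=> n; exact: measurable_kdist_right.
  + by move=> n x; exact: kdist_ge0.
  + exact: integrableZl.
  + by move=> n x; exact: kdist_sqint.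
  + apply: filterS (integrable_ae measurableT iY) => x /(_ I) xfin.
    by apply: lv => //; rewrite -ge0_fin_numE ?sqint_ge0.
Qed.

End approximate_identity_prod.

(** * Poisson kernels on the line *)

Section approximate_identity_poisson.
Local Open Scope ereal_scope.
Variable R : realType.
Local Notation mu := (@lebesgue_measure R).

Definition poissonB (e : R) (x t : measurableTypeR R) : R := poisson e ((x : R) - (t : R))%R.

Lemma measurable_poissonB (e : R) : (0 < e)%R ->
  measurable_fun setT (fun z : measurableTypeR R * measurableTypeR R => poissonB e z.1 z.2).
Proof.
move=> e0; apply: (measurableT_comp (measurable_poisson e0)).
exact: measurable_funB.
Qed.

Lemma markov_kernel_poissonB (e : R) : (0 < e)%R ->
  markov_kernel mu (poissonB e).
Proof.
move=> e0; split.
- exact: measurable_poissonB.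
- by move=> x y; exact/poisson_ge0/ltW.
- by move=> x y; rewrite /poissonB -poissonN opprB.
- by move=> x; exact: integral_poissonB.
Qed.

Let eps (n : nat) : R := n.+1%:R^-1%R.
Let eps_gt0 n : (0 < eps n)%R. Proof. by rewrite invr_gt0 ltr0n. Qed.

(** The integrand is nonzero only when exactly one of x, t lies in A. The other point is then
    outside U, which gives [F1] or [F2], equal in integral by symmetry; or it is in U minus A, which
    gives [F3] or [F4], whose integrals are mu(U minus A) by the marginals. *)
Let kdist_indic_le (e : R) (A U : set (measurableTypeR R)) : (0 < e)%R ->
  measurable A -> measurable U -> A `<=` U ->
  kdist mu (poissonB e) \1_A <=
  2%:E * (\int[mu]_x \int[mu]_t (\1_A x * (poissonB e x t * \1_(~` U) t))%:E)
  + 2%:E * mu (U `\` A).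
Proof.
move=> e0 mA mU AU; have km := markov_kernel_poissonB e0.
have [mk k0 kC k1] := km.
have mCU : measurable (~` U) by exact: measurableC.
have mUA : measurable (U `\` A) by exact: measurableD.
pose a (x : measurableTypeR R) := \1_A x : R.
pose u (x : measurableTypeR R) := \1_(~` U) x : R.
pose v (x : measurableTypeR R) := \1_(U `\` A) x : R.
have ma : measurable_fun setT a by exact: measurable_indic.
have mu_ : measurable_fun setT u by exact: measurable_indic.
have mv : measurable_fun setT v by exact: measurable_indic.
have i0 (B : set (measurableTypeR R)) x : (0 <= \1_B x :> R)%R by rewrite indicE ler0n.
have m1 (h : measurableTypeR R -> R) : measurable_fun setT h ->
    measurable_fun setT (fun z : measurableTypeR R * measurableTypeR R => h z.1).
  by move=> mh; exact: measurableT_comp mh measurable_fst.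
have m2 (h : measurableTypeR R -> R) : measurable_fun setT h ->
    measurable_fun setT (fun z : measurableTypeR R * measurableTypeR R => h z.2).
  by move=> mh; exact: measurableT_comp mh measurable_snd.
pose F1 (z : measurableTypeR R * measurableTypeR R) := (a z.1 * (poissonB e z.1 z.2 * u z.2))%R.
pose F2 (z : measurableTypeR R * measurableTypeR R) := (a z.2 * (poissonB e z.1 z.2 * u z.1))%R.
pose F3 (z : measurableTypeR R * measurableTypeR R) := (poissonB e z.1 z.2 * v z.1)%R.
pose F4 (z : measurableTypeR R * measurableTypeR R) := (poissonB e z.1 z.2 * v z.2)%R.
have mF1 : measurable_fun setT F1.
  by apply: measurable_funM; [exact: m1|apply: measurable_funM => //; exact: m2].
have mF2 : measurable_fun setT F2.
  by apply: measurable_funM; [exact: m2|apply: measurable_funM => //; exact: m1].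
have mF3 : measurable_fun setT F3 by apply: measurable_funM => //; exact: m1.
have mF4 : measurable_fun setT F4 by apply: measurable_funM => //; exact: m2.
have F10 z : (0 <= F1 z)%R by apply: mulr_ge0; [exact: i0|apply: mulr_ge0 => //; exact: i0].
have F20 z : (0 <= F2 z)%R by apply: mulr_ge0; [exact: i0|apply: mulr_ge0 => //; exact: i0].
have F30 z : (0 <= F3 z)%R by apply: mulr_ge0 => //; exact: i0.
have F40 z : (0 <= F4 z)%R by apply: mulr_ge0 => //; exact: i0.
apply: (@le_trans _ _ (\int[mu \x mu]_z ((F1 z + F2 z) + (F3 z + F4 z))%:E)).
  apply: le_integral_EFin => [|||z].
  - apply: measurable_funM => //; apply: measurable_funX; apply: measurable_funB.
      exact: (m1 a).
    exact: (m2 a).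
  - by apply: measurable_funD; exact: measurable_funD.
  - by move=> z; rewrite mulr_ge0 ?sqr_ge0.
  - rewrite /F1 /F2 /F3 /F4 (mulrCA (a z.1)) (mulrCA (a z.2)) -!mulrDr ler_wpM2l//.
    rewrite /a /u /v !indicE !in_setD !in_setC.
    have AUb y : (y \in A) ==> (y \in U).
      by apply/implyP => /set_mem yA; exact/mem_set/AU.
    move: (AUb z.1) (AUb z.2).
    by do 4 case: (_ \in _) => //=; rewrite ?expr0n/=; lra.
rewrite !integralD_EFin_ge0//; last 4 first.
- exact: measurable_funD.
- exact: measurable_funD.
- by move=> z; rewrite addr_ge0.
- by move=> z; rewrite addr_ge0.
have E1 : \int[mu \x mu]_z (F1 z)%:E =
    \int[mu]_x \int[mu]_t (\1_A x * (poissonB e x t * \1_(~` U) t))%:E.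
  by rewrite fubini_tonelli1//; exact/measurable_EFinP.
have E2 : \int[mu \x mu]_z (F2 z)%:E =
    \int[mu]_x \int[mu]_t (\1_A x * (poissonB e x t * \1_(~` U) t))%:E.
  rewrite fubini_tonelli2//; last exact/measurable_EFinP.
  apply: eq_integral => x _; apply: eq_integral => t _.
  by rewrite /F2 /= kC.
have E3 : \int[mu \x mu]_z (F3 z)%:E = mu (U `\` A).
  by rewrite (@integral_kernel1 _ _ _ mu (poissonB e) v)// integral_indic ?setIT.
have E4 : \int[mu \x mu]_z (F4 z)%:E = mu (U `\` A).
  by rewrite (@integral_kernel2 _ _ _ mu (poissonB e) v)// integral_indic ?setIT.
rewrite E1 E2 E3 E4 !mule_natl !mule2n//.
Qed.

Lemma approx_identity_poissonB :
  approx_identity mu (fun n => poissonB n.+1%:R^-1).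
Proof.
apply: approx_identity_sets => [n|A mA Aoo]; first exact: (markov_kernel_poissonB (eps_gt0 n)).
move=> e e0.
have e4 : (0 < e / 4)%R by rewrite divr_gt0.
(* Outer regularity makes the second term of [kdist_indic_le] at most 2 e/4; the first one will be
   at most 2 e/4 for large n. *)
have [U [oU AU UAe]] := lebesgue_regularity_outer mA Aoo e4.
have mU : measurable (U : set (measurableTypeR R)) by exact: open_measurable.
have mCU : measurable (~` U : set (measurableTypeR R)) by exact: measurableC.
pose F n (z : measurableTypeR R * measurableTypeR R) :=
  (\1_A z.1 * (poissonB (eps n) z.1 z.2 * \1_(~` U) z.2))%R : R.
have i0 (B : set (measurableTypeR R)) x : (0 <= \1_B x :> R)%R by rewrite indicE ler0n.
have k0 n x t : (0 <= poissonB (eps n) x t)%R by exact/poisson_ge0/ltW.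
have mF n : measurable_fun setT (F n).
  apply: measurable_funM.
    exact: measurableT_comp (measurable_indic mA) measurable_fst.
  apply: measurable_funM; first exact: measurable_poissonB.
  exact: measurableT_comp (measurable_indic mCU) measurable_snd.
have F0 n z : (0 <= F n z)%R by apply: mulr_ge0; [exact: i0|apply: mulr_ge0 => //; exact: i0].
have v : vanishing (fun n => \int[mu]_x \int[mu]_t (F n (x, t))%:E).
  apply: (@vanishing_integral _ _ _ _ _ (fun x => (\1_A x)%:E)).
  - move=> n; apply: (measurable_fun_fubini_tonelli_F (fun z => (F n z)%:E)).
      exact/measurable_EFinP.
    by move=> z; rewrite lee_fin.
  - by move=> n x; apply: integral_ge0 => t _; rewrite lee_fin.
  - apply/integrableP; split; first exact/measurable_EFinP/measurable_indic.
    under eq_integral do rewrite gee0_abs ?lee_fin ?i0//.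
    by rewrite integral_indic// setIT.
  - move=> n x; rewrite /F /= integralZ_EFin_ge0//; last 2 first.
    + apply: measurable_funM; last exact: measurable_indic.
      exact: (measurable_fun_pair2 x (measurable_poissonB (eps_gt0 n))).
    + by move=> t; apply: mulr_ge0 => //; exact: i0.
    rewrite -[leRHS]mule1; apply: lee_wpmul2l; first by rewrite lee_fin.
    rewrite -(integral_poissonB x (eps_gt0 n)); apply: le_integral_EFin => [|||t].
    + apply: measurable_funM; last exact: measurable_indic.
      exact: (measurable_fun_pair2 x (measurable_poissonB (eps_gt0 n))).
    + exact: (measurable_fun_pair2 x (measurable_poissonB (eps_gt0 n))).
    + by move=> t; apply: mulr_ge0 => //; exact: i0.
    + by rewrite ler_piMr// indicE; case: (_ \in _).
  - apply: aeW => x /=.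
    have [/set_mem xA|xA] := boolP (x \in A); last first.
      move=> d d0; apply: nearW => n.
      under eq_integral do rewrite /F indicE (negPf xA) mul0r.
      by rewrite integral0 lee_fin ltW.
    (* A point of A has a ball of some radius r inside U, so the mass that the kernel at x puts
       outside U is at most 2 eps/r. Since r depends on x, convergence is only pointwise, and
       domination by the indicator of A does the rest. *)
    have /(_ x (AU _ xA)) := oU; rewrite /interior -nbhs_ballE => -[r /= r0 rU].
    apply: (@vanishing_le _ _ (fun n => (2 * eps n / r)%:E)) => [n|].
      under eq_integral do rewrite /F indicE mem_set//= mul1r.
      apply: integral_poisson_tail => // t Ut.
      by rewrite leNgt; apply/negP => xt; exact/Ut/rU.
    apply: cvg0_vanishing; apply: cvg_EFin; first exact: nearW.
    rewrite [X in X @ _](_ : _ = (fun n => 2 / r * harmonic n)%R); last first.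
      by apply/funext => n; rewrite /eps /harmonic/= mulrAC.
    rewrite -[0%R in X in _ --> X](mulr0 (2 / r)%R).
    by apply: cvgM; [exact: cvg_cst|exact: cvg_harmonic].
apply: filterS (v _ e4) => n vn.
apply: (le_trans (kdist_indic_le (eps_gt0 n) mA mU AU)).
apply: (@le_trans _ _ (2%:E * (e / 4)%:E + 2%:E * (e / 4)%:E)).
  by apply: leeD; apply: lee_wpmul2l => //; exact: ltW.
by rewrite -!EFinM -EFinD lee_fin; lra.
Qed.

End approximate_identity_poisson.

Section integral_prod_fun.
Local Open Scope ereal_scope.
Context d1 d2 (X : measurableType d1) (Y : measurableType d2) (R : realType).
Variable mu : {sigma_finite_measure set X -> \bar R}.
Variable nu : {sigma_finite_measure set Y -> \bar R}.
Variables (f : X -> R) (g : Y -> R).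
Hypothesis fi : mu.-integrable setT (EFin \o f).
Hypothesis gi : nu.-integrable setT (EFin \o g).

Let mf : measurable_fun setT f.
Proof. exact/measurable_EFinP/(measurable_int _ fi). Qed.

Let mg : measurable_fun setT g.
Proof. exact/measurable_EFinP/(measurable_int _ gi). Qed.

Lemma integrable_prodM : (mu \x nu).-integrable setT (fun z => (f z.1 * g z.2)%:E).
Proof.
apply/integrable12ltyP.
  apply/measurable_EFinP/measurable_funM.
  - exact: measurableT_comp mf measurable_fst.
  - exact: measurableT_comp mg measurable_snd.
have mng : measurable_fun setT (fun y => `|g y|)%R by exact: measurableT_comp.
have mnf : measurable_fun setT (fun y => `|f y|)%R by exact: measurableT_comp.
have Eg : \int[nu]_y (`|g y|)%:E = (fine (\int[nu]_y (`|g y|)%:E))%:E.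
  rewrite fineK// ge0_fin_numE ?integral_ge0//; by case/integrableP: gi.
set c := fine _ in Eg.
have c0 : (0 <= c)%R by rewrite fine_ge0// integral_ge0// => y _; rewrite lee_fin.
have -> : \int[mu]_x \int[nu]_y `|(f (x, y).1 * g (x, y).2)%:E| =
    \int[mu]_x (c * `|f x|)%:E.
  apply: eq_integral => x _ /=.
  under eq_integral do rewrite normrM.
  by rewrite integralZ_EFin_ge0// Eg -EFinM mulrC.
rewrite integralZ_EFin_ge0//.
rewrite lte_mul_pinfty ?lee_fin//.
by case/integrableP: fi.
Qed.

Lemma integral_prodM : \int[mu \x nu]_z (f z.1 * g z.2)%:E =
  \int[mu]_x (f x)%:E * \int[nu]_y (g y)%:E.
Proof.
rewrite -integral12_prod_meas1; last exact: integrable_prodM.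
rewrite /fubini_F /=.
have Eg : \int[nu]_y (g y)%:E = (fine (\int[nu]_y (g y)%:E))%:E.
  by rewrite fineK//; exact: integrable_fin_num.
have -> : \int[mu]_x \int[nu]_y (f x * g y)%:E =
    \int[mu]_x ((f x)%:E * \int[nu]_y (g y)%:E).
  by apply: eq_integral => x _; under eq_integral do rewrite EFinM; rewrite integralZl.
by rewrite Eg integralZr.
Qed.

End integral_prod_fun.

Section transfer.
Local Open Scope ereal_scope.
Context d1 d2 (X : measurableType d1) (Y : measurableType d2) (R : realType).
Variable mu : {sigma_finite_measure set X -> \bar R}.
Variable nu : {sigma_finite_measure set Y -> \bar R}.
Variables (phi : X -> Y) (psi : Y -> X).
Hypothesis mphi : measurable_fun setT phi.
Hypothesis phiK : forall y, phi (psi y) = y.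
Hypothesis nuE : forall g : Y -> \bar R, measurable_fun setT g ->
  (forall y, 0 <= g y) -> \int[nu]_y g y = \int[mu]_x g (phi x).

(** Change of variables: [nuE] says that nu is the image of mu under phi, and the section [psi]
    writes every point as an image, which carries the pointwise properties of k over to l. *)
Lemma approx_identity_transfer (k : nat -> X -> X -> R) (l : nat -> Y -> Y -> R) :
  (forall n, measurable_fun setT (fun z : Y * Y => l n z.1 z.2)) ->
  (forall n p q, l n (phi p) (phi q) = k n p q) ->
  approx_identity mu k -> approx_identity nu l.
Proof.
move=> ml lk [km kv]; split => [n|f mf f2].
  have [mk k0 kC k1] := km n.
  split => [//|x y|x y|x].
  - by rewrite -(phiK x) -(phiK y) lk.
  - by rewrite -(phiK x) -(phiK y) !lk kC.
  - rewrite -(phiK x) nuE; last 2 first.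
    + by apply/measurable_EFinP; exact: (measurable_fun_pair2 (phi (psi x)) (ml n)).
    + by move=> y; rewrite lee_fin -(phiK y) lk.
    by rewrite -(k1 (psi x)); apply: eq_integral => y _; rewrite lk.
have f2' : sqint mu (f \o phi) < +oo.
  move: f2; rewrite /sqint nuE//.
  - by apply/measurable_EFinP; exact: measurable_funX.
  - by move=> y; rewrite lee_fin sqr_ge0.
have mfp : measurable_fun setT (f \o phi) by exact: measurableT_comp.
apply: vanishing_le (kv _ mfp f2') => n.
have [mk k0 kC k1] := km n.
have l0 x y : (0 <= l n x y)%R by rewrite -(phiK x) -(phiK y) lk.
have mG : measurable_fun setT (fun z : Y * Y => (l n z.1 z.2 * (f z.1 - f z.2) ^+ 2)%:E).
  apply/measurable_EFinP; apply: measurable_funM => //.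
  apply: measurable_funX; apply: measurable_funB.
  - exact: measurableT_comp mf measurable_fst.
  - exact: measurableT_comp mf measurable_snd.
have G0 (z : Y * Y) : 0 <= (l n z.1 z.2 * (f z.1 - f z.2) ^+ 2)%:E.
  by rewrite lee_fin mulr_ge0// sqr_ge0.
rewrite /kdist fubini_tonelli1// nuE; last 2 first.
- exact: measurable_fun_fubini_tonelli_F.
- by move=> y; apply: integral_ge0.
rewrite fubini_tonelli1; last 2 first.
- apply/measurable_EFinP; apply: measurable_funM => //.
  apply: measurable_funX; apply: measurable_funB.
  + exact: measurableT_comp mfp measurable_fst.
  + exact: measurableT_comp mfp measurable_snd.
- by move=> z; rewrite lee_fin mulr_ge0// sqr_ge0.
rewrite le_eqVlt; apply/orP; left; apply/eqP; apply: eq_integral => p _.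
rewrite /fubini_F nuE; last 2 first.
- exact: (measurable_fun_pair2 (phi p) mG).
- by move=> y; exact: G0 (phi p, y).
by apply: eq_integral => q _ /=; rewrite lk.
Qed.

End transfer.

(** * Integrals over R^n by induction on the dimension *)

Section lebesgue_tuple_integral.
Local Open Scope ereal_scope.
Variable R : realType.
Local Notation leb := (@lebesgue_measure R).

Lemma tnth_tuple_cons0 n (p : measurableTypeR R * 'Eucl[R]_n) :
  tnth (tuple_cons p) ord0 = p.1.
Proof. by rewrite (tnth_nth (p.1)). Qed.

Lemma tnth_tuple_consS n (p : measurableTypeR R * 'Eucl[R]_n) i :
  tnth (tuple_cons p) (lift ord0 i) = tnth p.2 i.
Proof. by rewrite !(tnth_nth (p.1)). Qed.

Lemma tuple_consK n (x : 'Eucl[R]_n.+1) :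
  tuple_cons (thead x, [tuple of behead x]) = x.
Proof. by case/tupleP: x => a u; apply/val_inj. Qed.

Lemma ge0_integral_lebesgue_tupleS n (g : 'Eucl[R]_n.+1 -> \bar R) :
  measurable_fun setT g -> (forall x, 0 <= g x) ->
  \int[lebesgue_tuple R n.+1]_x g x =
  \int[leb \x lebesgue_tuple R n]_p g (tuple_cons p).
Proof.
move=> mg g0; rewrite /= /lebesgue_cons.
by rewrite (ge0_integral_pushforward (@measurable_tuple_cons R n)).
Qed.

Lemma integrable_lebesgue_tupleS n (g : 'Eucl[R]_n.+1 -> \bar R) :
  measurable_fun setT g ->
  (leb \x lebesgue_tuple R n).-integrable setT (g \o @tuple_cons R n) ->
  (lebesgue_tuple R n.+1).-integrable setT g.
Proof.
move=> mg ig.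
exact: (integrable_pushforward (@measurable_tuple_cons R n) mg ig measurableT).
Qed.

Lemma integral_lebesgue_tupleS n (g : 'Eucl[R]_n.+1 -> \bar R) :
  measurable_fun setT g ->
  (leb \x lebesgue_tuple R n).-integrable setT (g \o @tuple_cons R n) ->
  \int[lebesgue_tuple R n.+1]_x g x =
  \int[leb \x lebesgue_tuple R n]_p g (tuple_cons p).
Proof.
move=> mg ig.
exact: (integral_pushforward (@measurable_tuple_cons R n) mg ig measurableT).
Qed.

Lemma measurable_sumr d (T : measurableType d) (I : Type) (r : seq I) (P : pred I)
    (h : I -> T -> R) : (forall i, measurable_fun setT (h i)) ->
  measurable_fun setT (fun x => \sum_(i <- r | P i) h i x)%R.
Proof.
move=> mh; elim: r => [|i r IH].
  by under eq_fun do rewrite big_nil; exact: measurable_cst.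
under eq_fun do rewrite big_cons.
by case: (P i) => //; exact: measurable_funD.
Qed.

Lemma measurable_prodr d (T : measurableType d) (I : Type) (r : seq I) (P : pred I)
    (h : I -> T -> R) : (forall i, measurable_fun setT (h i)) ->
  measurable_fun setT (fun x => \prod_(i <- r | P i) h i x)%R.
Proof.
move=> mh; elim: r => [|i r IH].
  by under eq_fun do rewrite big_nil; exact: measurable_cst.
under eq_fun do rewrite big_cons.
by case: (P i) => //; exact: measurable_funM.
Qed.

Lemma measurable_prod_tnth n (h : 'I_n -> R -> R) :
  (forall i, measurable_fun setT (h i : measurableTypeR R -> R)) ->
  measurable_fun setT (fun x : 'Eucl[R]_n => \prod_i h i (tnth x i))%R.
Proof.
move=> mh; apply: measurable_prodr => i.
exact: measurableT_comp (mh i) (measurable_tnth i).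
Qed.

Lemma integral_prod_tnth n (h : 'I_n -> R -> R) (r : 'I_n -> R) :
  (forall i, leb.-integrable setT (EFin \o h i)) ->
  (forall i, \int[leb]_y (h i y)%:E = (r i)%:E) ->
  (lebesgue_tuple R n).-integrable setT (fun x => (\prod_i h i (tnth x i))%:E) /\
  \int[lebesgue_tuple R n]_x (\prod_i h i (tnth x i))%:E = (\prod_i r i)%:E.
Proof.
elim: n h r => [|n IH] h r hi hr.
  (* R^0 is a single point of mass 1, matching the empty product. *)
  have E : \int[lebesgue_tuple R 0]_x 1 = 1%E.
    by rewrite integral_cst// mul1e; exact: diracT.
  split.
    under eq_fun do rewrite big_ord0.
    apply/integrableP; split => //.
    by under eq_integral do rewrite abse1; rewrite E ltry.
  by under eq_integral do rewrite big_ord0; rewrite big_ord0.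
have [ih1 ih2] := IH (fun i => h (lift ord0 i)) (fun i => r (lift ord0 i))
  (fun i => hi _) (fun i => hr _).
have mh i : measurable_fun setT (h i : measurableTypeR R -> R).
  by apply/measurable_EFinP; exact: measurable_int (hi i).
have mH : measurable_fun setT (fun x : 'Eucl[R]_n.+1 => (\prod_i h i (tnth x i))%:E).
  by apply/measurable_EFinP; exact: measurable_prod_tnth.
have HE (p : measurableTypeR R * 'Eucl[R]_n) :
    (\prod_i h i (tnth (tuple_cons p) i) =
    h ord0 p.1 * \prod_i h (lift ord0 i) (tnth p.2 i))%R.
  rewrite big_ord_recl tnth_tuple_cons0; congr (_ * _)%R.
  by apply: eq_bigr => i _; rewrite tnth_tuple_consS.
have iH : (leb \x lebesgue_tuple R n).-integrable setT
    ((fun x : 'Eucl[R]_n.+1 => (\prod_i h i (tnth x i))%:E) \o @tuple_cons R n).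
  apply: eq_integrable (integrable_prodM (hi ord0) ih1) => // p _.
  by rewrite /= -HE.
split; first exact: integrable_lebesgue_tupleS.
rewrite integral_lebesgue_tupleS//.
under eq_integral do rewrite HE.
transitivity (\int[leb]_y (h ord0 y)%:E * \int[lebesgue_tuple R n]_u
    (\prod_i h (lift ord0 i) (tnth u i))%:E).
  exact: (integral_prodM (hi ord0) ih1).
by rewrite ih2 hr big_ord_recl EFinM.
Qed.

Definition tuple_poisson n (e : R) (x y : 'Eucl[R]_n) : R :=
  \prod_(i < n) poisson e ((tnth x i : R) - (tnth y i : R)).

Lemma measurable_tuple_poisson n (e : R) : (0 < e)%R ->
  measurable_fun setT (fun z : 'Eucl[R]_n * 'Eucl[R]_n => tuple_poisson e z.1 z.2).
Proof.
move=> e0; apply: measurable_prodr => i.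
apply: (measurableT_comp (measurable_poisson e0)).
apply: measurable_funB.
- exact: measurableT_comp (measurable_tnth i) measurable_fst.
- exact: measurableT_comp (measurable_tnth i) measurable_snd.
Qed.

(** In dimension 0 any two points are equal, so the energy is 0. The step identifies R^(n+1) with R
    x R^n, on which the kernel is a product. *)
Lemma approx_identity_tuple_poisson n :
  approx_identity (lebesgue_tuple R n) (fun m => @tuple_poisson n m.+1%:R^-1).
Proof.
elim: n => [|n IH].
  have E (e : R) : @tuple_poisson 0 e = fun _ _ => 1%R.
    by apply/funext => x; apply/funext => y; rewrite /tuple_poisson big_ord0.
  split => [m|f mf _].
    rewrite E; split => //.
    by move=> x; rewrite integral_cst// mul1e; exact: diracT.
  move=> e e0; apply: nearW => m; rewrite /kdist.
  under eq_integral => z _ do rewrite (tuple0 z.1) (tuple0 z.2) subrr expr0n mulr0.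
  by rewrite integral0 lee_fin ltW.
apply: (@approx_identity_transfer _ _ _ _ _ (prod_measure leb (lebesgue_tuple R n))
  _ (@tuple_cons R n) (fun x => (thead x, [tuple of behead x])) _ _ _
  (fun m => prod_kernel (@poissonB R m.+1%:R^-1) (@tuple_poisson n m.+1%:R^-1))).
- exact: measurable_tuple_cons.
- by move=> x; exact: tuple_consK.
- by move=> g mg g0; exact: ge0_integral_lebesgue_tupleS.
- by move=> m; apply: measurable_tuple_poisson; rewrite invr_gt0.
- move=> m p q; rewrite /tuple_poisson big_ord_recl !tnth_tuple_cons0.
  congr (_ * _)%R; apply: eq_bigr => i _.
  by rewrite !tnth_tuple_consS.
- exact: approx_identity_prod (approx_identity_poissonB R) IH.
Qed.

End lebesgue_tuple_integral.

(** * Damped Parseval identity *)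

Section integrable_sum.
Context d (T : measurableType d) (R : realType).
Variable mu : {measure set T -> \bar R}.

Lemma integrable_sumr (I : Type) (r : seq I) (P : pred I) (h : I -> T -> R) :
  (forall i, mu.-integrable setT (EFin \o h i)) ->
  mu.-integrable setT (fun x => (\sum_(i <- r | P i) h i x)%:E).
Proof.
move=> ih; under eq_fun do rewrite -sumEFin.
by apply: integrable_sum => // i Pi; exact: ih.
Qed.

Lemma Rintegral_sum (I : Type) (r : seq I) (P : pred I) (h : I -> T -> R) :
  (forall i, mu.-integrable setT (EFin \o h i)) ->
  \int[mu]_x (\sum_(i <- r | P i) h i x) = \sum_(i <- r | P i) \int[mu]_x h i x.
Proof.
move=> ih; elim: r => [|i r IH].
  under eq_Rintegral do rewrite big_nil.
  by rewrite big_nil Rintegral_cst// mul0r.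
rewrite big_cons; under eq_Rintegral do rewrite big_cons.
case: (P i) => //; rewrite RintegralD// ?IH//.
exact: integrable_sumr.
Qed.

End integrable_sum.

Section clifford_inner.
Variables (R : realType) (m : nat).
Local Notation G := (clifford R m).

Definition cinner (a b : G) : R := \sum_I a I * b I.

Lemma linear_coef (A : {linear G -> G}) (a : G) J :
  A a J = \sum_I a I * A (blade R I) J.
Proof.
rewrite {1}(clifford_basis a) linear_sum sum_ffunE; apply: eq_bigr => I _.
by rewrite linearZ /= Defs.coefZ.
Qed.

End clifford_inner.

(** * Transforms with trigonometric kernels *)

Section kernel_transform.
Variables (R : realType) (n m : nat).
Local Notation G := (clifford R m).
Local Notation E := ('Eucl[R]_n).
Local Notation sign := {ffun 'I_n -> bool}.
Local Notation lam := (lebesgue_tuple R n).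
Variables L M : sign -> {linear G -> G}.
Implicit Types (f : E -> G) (th : 'I_n -> R) (s : sign).

(* With L s the left or right multiplication by Bprod s, kernel_op th is the
   multiplication by rotor th, see rotorE. *)
Definition trigprod s th : R := \prod_i trig (s i) (th i).

Definition kernel_op th (a : G) : G := \sum_(s : sign) trigprod s th *: L s a.

Definition hadamard (x y : E) i : R := (tnth x i : R) * (tnth y i : R).

(** The adjoint of multiplication by a rotor is multiplication by its inverse, so the pairing sees
    only the differences of angles. The constants of the expansion are kept abstract as maps [M s]:
    only the one of the all-cosine term, the identity by [M0], survives integration. *)
Hypothesis kernel_opM : forall th th' a b,
  cinner (kernel_op th a) (kernel_op th' b) =
  \sum_s trigprod s (fun i => th i - th' i) * cinner a (M s b).
Hypothesis M0 : forall b, M [ffun=> false] b = b.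

(** The transform for plain Lebesgue measure; [transformE] restores the factor (2 pi)^(-n/2). *)
Definition kernel_int f (y : E) : G :=
  [ffun J => \int[lam]_x kernel_op (hadamard x y) (f x) J].

Definition cintegrable f := forall I, lam.-integrable setT (fun x => (f x I)%:E).

Lemma trig_le1 b t : `|trig b t : R| <= 1.
Proof. by case: b; rewrite ler_norml ?sin_geN1 ?sin_le1 ?cos_geN1 ?cos_le1. Qed.

Lemma trigprod_le1 s th : `|trigprod s th| <= 1.
Proof.
rewrite /trigprod normr_prod.
suff /andP[] : 0 <= \prod_i `|trig (s i) (th i) : R| <= 1 by [].
elim/big_ind: _ => [|x y /andP[x0 x1] /andP[y0 y1]|i _].
- by rewrite ler01 lexx.
- by rewrite mulr_ge0// mulr_ile1.
- by rewrite normr_ge0 trig_le1.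
Qed.

Lemma continuous_trig b : continuous (trig b : R -> R).
Proof. by case: b; [exact: continuous_sin|exact: continuous_cos]. Qed.

Lemma measurable_trigprod d (T : measurableType d) s (th : T -> 'I_n -> R) :
  (forall i, measurable_fun setT (fun x => th x i)) ->
  measurable_fun setT (fun x => trigprod s (th x)).
Proof.
move=> mth; apply: measurable_prodr => i.
apply: measurableT_comp (mth i).
by apply: continuous_measurable_fun; exact: continuous_trig.
Qed.

Lemma measurable_linear d (T : measurableType d) (A : {linear G -> G}) (f : T -> G) J :
  (forall I, measurable_fun setT (fun x => f x I)) ->
  measurable_fun setT (fun x => A (f x) J).
Proof.
move=> mf; under eq_fun do rewrite linear_coef.
by apply: measurable_sumr => I; apply: measurable_funM.
Qed.

Lemma integrable_linear (A : {linear G -> G}) f J : cintegrable f ->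
  lam.-integrable setT (fun x => (A (f x) J)%:E).
Proof.
move=> fi; under eq_fun do rewrite linear_coef.
apply: integrable_sumr => I.
rewrite (_ : _ \o _ = fun x => (f x I)%:E * (A (blade R I) J)%:E)%E.
  exact: integrableZr.
by apply/funext => x; rewrite /= EFinM.
Qed.

Lemma kernel_op_coef th a J :
  kernel_op th a J = \sum_(s : sign) trigprod s th * L s a J.
Proof.
by rewrite sum_ffunE; apply: eq_bigr => s _; rewrite Defs.coefZ.
Qed.

Lemma integrable_bounded (h g : E -> R) : measurable_fun setT h ->
  (forall x, `|h x| <= 1) -> lam.-integrable setT (EFin \o g) ->
  lam.-integrable setT (fun x => (h x * g x)%:E).
Proof.
move=> mh h1 ig; apply: (le_integrable measurableT) (ig).
  apply/measurable_EFinP/measurable_funM => //.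
  by apply/measurable_EFinP; exact: measurable_int ig.
by move=> x _ /=; rewrite lee_fin normrM ler_piMl.
Qed.

Lemma measurable_hadamardl y s : measurable_fun setT (fun x => trigprod s (hadamard x y)).
Proof.
apply: (@measurable_trigprod _ _ s (fun x => hadamard x y)) => i.
by apply: measurable_funM => //; exact: measurable_tnth.
Qed.

Lemma integrable_kernel_op f y J : cintegrable f ->
  lam.-integrable setT (fun x => (kernel_op (hadamard x y) (f x) J)%:E).
Proof.
move=> fi; under eq_fun do rewrite kernel_op_coef.
apply: integrable_sumr => s; apply: integrable_bounded.
- exact: measurable_hadamardl.
- by move=> x; exact: trigprod_le1.
- exact: integrable_linear.
Qed.

Lemma measurable_kernel_op2 f J : (forall I, measurable_fun setT (fun x => f x I)) ->
  measurable_fun setT (fun z : E * E => kernel_op (hadamard z.1 z.2) (f z.1) J).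
Proof.
move=> mf; under eq_fun do rewrite kernel_op_coef.
apply: measurable_sumr => s; apply: measurable_funM.
  apply: (@measurable_trigprod _ _ s (fun z : E * E => hadamard z.1 z.2)) => i.
  apply: measurable_funM.
  - exact: measurableT_comp (measurable_tnth i) measurable_fst.
  - exact: measurableT_comp (measurable_tnth i) measurable_snd.
apply: (@measurable_linear _ _ (L s) (fun z : E * E => f z.1) J) => I.
exact: measurableT_comp (mf I) measurable_fst.
Qed.

(** The coefficient is a difference of integrals of the positive and negative parts of the
    integrand, each measurable in y by Tonelli. *)
Lemma measurable_kernel_int f J : (forall I, measurable_fun setT (fun x => f x I)) ->
  measurable_fun setT (fun y => kernel_int f y J).
Proof.
move=> mf; under eq_fun do rewrite ffunE /Rintegral integralE.
have mk := measurable_kernel_op2 J mf.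
have mk' : measurable_fun setT (EFin \o (fun z : E * E =>
    kernel_op (hadamard z.1 z.2) (f z.1) J)) by exact/measurable_EFinP.
apply: measurableT_comp; first exact: fine_measurable.
apply: emeasurable_funB.
- have := @measurable_fun_fubini_tonelli_G _ _ _ _ R lam _ (measurable_funepos mk')
    (@funepos_ge0 _ _ _).
  apply: eq_measurable_fun => y _; apply: eq_integral => x _.
  by rewrite !funeposE.
- have := @measurable_fun_fubini_tonelli_G _ _ _ _ R lam _ (measurable_funeneg mk')
    (@funeneg_ge0 _ _ _).
  apply: eq_measurable_fun => y _; apply: eq_integral => x _.
  by rewrite !funenegE.
Qed.

Lemma integrable_cinner_linear (A : {linear G -> G}) f : cintegrable f ->
  (lam \x lam)%E.-integrable setT (fun z => (cinner (f z.1) (A (f z.2)))%:E).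
Proof.
move=> fi; apply: integrable_sumr => I.
exact: (integrable_prodM (fi I) (integrable_linear A I fi)).
Qed.

(** Coefficient by coefficient, the square of an integral is the double integral of the product in
    separate variables; [kernel_opM] then merges the two kernels. *)
Lemma cinner_kernel_int f y : cintegrable f ->
  cinner (kernel_int f y) (kernel_int f y) =
  \int[(lam \x lam)%E]_z \sum_s trigprod s (fun i => hadamard z.1 y i - hadamard z.2 y i)
    * cinner (f z.1) (M s (f z.2)).
Proof.
move=> fi.
transitivity (\int[(lam \x lam)%E]_z cinner (kernel_op (hadamard z.1 y) (f z.1))
    (kernel_op (hadamard z.2 y) (f z.2))); last first.
  by apply: eq_Rintegral => z _; rewrite kernel_opM.
have ik J : lam.-integrable setT
    (EFin \o (fun x => kernel_op (hadamard x y) (f x) J)).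
  exact: integrable_kernel_op.
rewrite Rintegral_sum => [|J]; last exact: (integrable_prodM (ik J) (ik J)).
apply: eq_bigr => J _; rewrite !ffunE.
rewrite /Rintegral (integral_prodM (ik J) (ik J)) fineM//;
  exact: (integrable_fin_num measurableT (ik J)).
Qed.

Definition damp (e : R) (y : E) : R := \prod_i expabs e (tnth y i : R).

Lemma damp_ge0 e y : 0 <= damp e y.
Proof. by apply: prodr_ge0 => i _; exact: expabs_ge0. Qed.

Lemma measurable_damp e : measurable_fun setT (damp e).
Proof. exact: (@measurable_prod_tnth R n (fun=> expabs e) (fun=> @measurable_expabs R e)). Qed.

Lemma integrable_damp e : 0 < e -> lam.-integrable setT (EFin \o damp e).
Proof.
move=> e0.
by have [] := @integral_prod_tnth R n (fun=> expabs e) (fun=> 2 / e)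
  (fun=> integrable_expabs e0) (fun=> integral_expabs e0).
Qed.

Lemma integral_trigprod_damp e s (t : 'I_n -> R) : 0 < e ->
  (\int[lam]_y (trigprod s (fun i => t i * (tnth y i : R)) * damp e y)%:E =
  (if s == [ffun=> false] then (2 * pi) ^+ n * \prod_i poisson e (t i) else 0)%:E)%E.
Proof.
move=> e0.
pose r i := if s i then 0 else 2 * e / (e ^+ 2 + t i ^+ 2).
have hi i : (@lebesgue_measure R).-integrable setT
    (EFin \o (fun y => trig (s i) (t i * y) * expabs e y)).
  apply: integrable_trig_expabs => //; first exact: continuous_trig.
  by move=> u; exact: trig_le1.
have hr i : (\int[@lebesgue_measure R]_y (trig (s i) (t i * y) * expabs e y)%:E = (r i)%:E)%E.
  rewrite /r /trig; case: (s i); first exact: integral_sin_expabs.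
  exact: integral_cos_expabs.
have [_] := @integral_prod_tnth R n (fun i y => trig (s i) (t i * y) * expabs e y) r hi hr.
under eq_integral do rewrite big_split/=.
move=> ->; congr EFin; case: eqP => [s0|/eqP s0].
  rewrite -[n in _ ^+ n](card_ord n) -prodr_const -big_split/=.
  apply: eq_bigr => i _; rewrite /r s0 ffunE /poisson.
  have p0 : (pi : R) != 0 by rewrite gt_eqF// pi_gt0.
  have d0 : e ^+ 2 + t i ^+ 2 != 0.
    by rewrite gt_eqF// ltr_pwDl ?exprn_gt0// sqr_ge0.
  by move: (pi : R) p0 => p p0; field; rewrite d0 p0.
have [i si] : exists i, s i.
  apply: contrapT => /forallNP sF; case/eqP: s0; apply/ffunP => i.
  by rewrite ffunE; apply/negbTE/negP/sF.
by rewrite (bigD1 i)//= /r si mul0r.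
Qed.

Let mdiff (z : (E * E) * E) i : R := hadamard z.1.1 z.2 i - hadamard z.1.2 z.2 i.

Let measurable_mdiff s : measurable_fun setT (fun z : (E * E) * E => trigprod s (mdiff z)).
Proof.
apply: measurable_trigprod => i; rewrite /mdiff /hadamard.
have m1 : measurable_fun setT (fun z : (E * E) * E => tnth z.1.1 i).
  apply: measurableT_comp (measurable_tnth i) _.
  exact: measurableT_comp measurable_fst measurable_fst.
have m2 : measurable_fun setT (fun z : (E * E) * E => tnth z.1.2 i).
  apply: measurableT_comp (measurable_tnth i) _.
  exact: measurableT_comp measurable_snd measurable_fst.
have m3 : measurable_fun setT (fun z : (E * E) * E => tnth z.2 i).
  exact: measurableT_comp (measurable_tnth i) measurable_snd.
by apply: measurable_funB; exact: measurable_funM.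
Qed.

Lemma damped_parseval e f : 0 < e -> cintegrable f ->
  (\int[lam]_y (cinner (kernel_int f y) (kernel_int f y) * damp e y)%:E =
  \int[lam \x lam]_z ((2 * pi) ^+ n * (tuple_poisson e z.1 z.2 *
    cinner (f z.1) (f z.2)))%:E)%E.
Proof.
move=> e0 fi.
pose C s (z : E * E) := cinner (f z.1) (M s (f z.2)).
(* Bounded by |C s z| times [damp e y], a product of two integrable functions since f is in L_1: the
   damping is what allows Fubini. *)
pose Phi s (w : (E * E) * E) : R := C s w.1 * (trigprod s (mdiff w) * damp e w.2).
have iC s : (prod_measure lam lam).-integrable setT (EFin \o C s).
  exact: integrable_cinner_linear.
have id := integrable_damp e0.
have mC s : measurable_fun setT (C s).
  by apply/measurable_EFinP; exact: measurable_int (iC s).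
have iPhi s : (prod_measure lam lam \x lam)%E.-integrable setT (EFin \o Phi s).
  apply: (le_integrable measurableT) (integrable_prodM (iC s) id).
    apply/measurable_EFinP; apply: measurable_funM.
      exact: measurableT_comp (mC s) measurable_fst.
    apply: measurable_funM; first exact: measurable_mdiff.
    exact: measurableT_comp (measurable_damp e) measurable_snd.
  move=> w _; rewrite /Phi /= lee_fin !normrM ler_wpM2l// ler_piMl//.
  exact: trigprod_le1.
have iS : (prod_measure lam lam \x lam)%E.-integrable setT
    (fun w => (\sum_s Phi s w)%:E).
  exact: integrable_sumr.
have := Fubini iS => /esym F.
transitivity (\int[lam]_y \int[prod_measure lam lam]_z (\sum_s Phi s (z, y))%:E)%E.
  apply: eq_integral => y _; rewrite cinner_kernel_int//.
  have iz s : (prod_measure lam lam).-integrable setT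
      (EFin \o (fun z => trigprod s (mdiff (z, y)) * C s z)).
    apply: (le_integrable measurableT) (iC s).
      apply/measurable_EFinP/measurable_funM => //.
      exact: (measurable_fun_pair1 y (measurable_mdiff s)).
    by move=> z _ /=; rewrite lee_fin normrM ler_piMl// trigprod_le1.
  have izs : (prod_measure lam lam).-integrable setT
      (fun z => (\sum_s trigprod s (mdiff (z, y)) * C s z)%:E).
    exact: integrable_sumr.
  rewrite EFinM /Rintegral fineK; last exact: (integrable_fin_num measurableT izs).
  rewrite -integralZr//; apply: eq_integral => z _.
  rewrite -EFinM mulr_suml; congr EFin; apply: eq_bigr => s _.
  by rewrite /Phi /= mulrAC mulrC.
rewrite {}F; apply: eq_integral => z _.
have iy s : lam.-integrable setT
    (fun y => (trigprod s (mdiff (z, y)) * damp e y)%:E).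
  apply: (le_integrable measurableT) id.
    apply/measurable_EFinP/measurable_funM; last exact: measurable_damp.
    exact: (measurable_fun_pair2 z (measurable_mdiff s)).
  by move=> y _ /=; rewrite lee_fin normrM ler_piMl// trigprod_le1.
(* At fixed z = (x, x') the integral over y factorizes over the coordinates, with t_i = x_i -
   x'_i. *)
have Ey s : (\int[lam]_y (Phi s (z, y))%:E = (C s z)%:E *
    (if s == [ffun=> false] then (2 * pi) ^+ n * tuple_poisson e z.1 z.2 else 0)%:E)%E.
  under eq_integral do rewrite /Phi /= EFinM.
  rewrite integralZl//; congr (_ * _)%E.
  rewrite -(integral_trigprod_damp s (fun i => (tnth z.1 i : R) - (tnth z.2 i : R)) e0).
  apply: eq_integral => y _; congr (trigprod s _ * _)%:E.
  by apply/funext => i; rewrite /mdiff /hadamard mulrBl.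
under eq_integral do rewrite -sumEFin.
rewrite integral_sum//; last first.
  move=> s; rewrite /Phi /=.
  by under eq_fun do rewrite EFinM; exact: integrableZl.
rewrite (bigD1 [ffun=> false])//= big1 ?adde0 => [|s s0]; last first.
  by rewrite Ey (negPf s0) mule0.
by rewrite Ey eqxx /C M0 -EFinM mulrC mulrA.
Qed.

End kernel_transform.

Section clifford_square_integral.
Local Open Scope ereal_scope.
Context d (T : measurableType d) (R : realType) (m : nat).
Variable mu : {measure set T -> \bar R}.
Implicit Types f : T -> clifford R m.

Definition cmeasurable f := forall I, measurable_fun setT (fun x => f x I).

Definition csqint f := \sum_I sqint mu (fun x => f x I).

Lemma csqint_ge0 f : 0 <= csqint f.
Proof. by apply: sume_ge0 => I _; exact: sqint_ge0. Qed.

Lemma sqint_le_csqint f I : sqint mu (fun x => f x I) <= csqint f.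
Proof.
rewrite /csqint (bigD1 I)//= leeDl// sume_ge0// => J _; exact: sqint_ge0.
Qed.

Lemma csqintE f : cmeasurable f ->
  csqint f = \int[mu]_x (cinner (f x) (f x))%:E.
Proof.
move=> mf; rewrite /csqint /sqint /cinner -ge0_integral_sum//.
- by apply: eq_integral => x _; rewrite sumEFin.
- by move=> I; apply/measurable_EFinP; exact: measurable_funX.
- by move=> I x _; rewrite lee_fin sqr_ge0.
Qed.

Lemma cinner_ge0 (a : clifford R m) : (0 <= cinner a a)%R.
Proof. by apply: sumr_ge0 => I _; rewrite -expr2 sqr_ge0. Qed.

Lemma measurable_cinner f g : cmeasurable f -> cmeasurable g ->
  measurable_fun setT (fun x => cinner (f x) (g x)).
Proof. by move=> mf mg; apply: measurable_sumr => I; exact: measurable_funM. Qed.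

End clifford_square_integral.

Section kernel_cross.
Local Open Scope ereal_scope.
Context d (T : measurableType d) (R : realType).
Variable mu : {sigma_finite_measure set T -> \bar R}.
Variables (k : T -> T -> R) (h : T -> R).
Hypothesis km : markov_kernel mu k.
Hypothesis mh : measurable_fun setT h.
Hypothesis h2 : sqint mu h < +oo.

(** Half of h(x)^2 + h(x')^2 - (h(x) - h(x'))^2 against k: the first two terms integrate to
    [sqint mu h] by the marginals, the third one is the energy. All three are finite because h is in
    L_2, so the subtraction makes sense. *)
Lemma kernel_cross :
  (mu \x mu).-integrable setT (fun z => (k z.1 z.2 * (h z.1 * h z.2))%:E) /\
  \int[mu \x mu]_z (k z.1 z.2 * (h z.1 * h z.2))%:E =
  (fine (sqint mu h) - 2^-1 * fine (kdist mu k h))%:E.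
Proof.
have [mk k0 kC k1] := km.
have m1 : measurable_fun setT (fun z : T * T => h z.1) by exact: measurableT_comp mh measurable_fst.
have m2 : measurable_fun setT (fun z : T * T => h z.2) by exact: measurableT_comp mh measurable_snd.
have mh2 := measurable_funX 2%N mh.
have integrable_ge0 (g : T * T -> R) : measurable_fun setT g ->
    (forall z, 0 <= g z)%R -> \int[mu \x mu]_z (g z)%:E < +oo ->
    (mu \x mu).-integrable setT (EFin \o g).
  move=> mg g0 goo; apply/integrableP; split; first exact/measurable_EFinP.
  by under eq_integral do rewrite gee0_abs ?lee_fin//.
have i1 : (mu \x mu).-integrable setT (EFin \o (fun z => k z.1 z.2 * h z.1 ^+ 2)%R).
  apply: integrable_ge0.
  - by apply: measurable_funM => //; exact: measurable_funX.
  - by move=> z; rewrite mulr_ge0// sqr_ge0.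
  - rewrite (integral_kernel1 km mh2)// => x; exact: sqr_ge0.
have i2 : (mu \x mu).-integrable setT (EFin \o (fun z => k z.1 z.2 * h z.2 ^+ 2)%R).
  apply: integrable_ge0.
  - by apply: measurable_funM => //; exact: measurable_funX.
  - by move=> z; rewrite mulr_ge0// sqr_ge0.
  - rewrite (integral_kernel2 km mh2)// => x; exact: sqr_ge0.
have kdoo : kdist mu k h < +oo.
  apply: (le_lt_trans (kdist_sqint km mh)).
  by rewrite lte_mul_pinfty.
have i3 : (mu \x mu).-integrable setT (EFin \o (fun z => k z.1 z.2 * (h z.1 - h z.2) ^+ 2)%R).
  apply: integrable_ge0 => //.
  - by apply: measurable_funM => //; apply: measurable_funX; exact: measurable_funB.
  - by move=> z; rewrite mulr_ge0// sqr_ge0.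
have E (z : T * T) : (k z.1 z.2 * (h z.1 * h z.2) = 2^-1 * (k z.1 z.2 * h z.1 ^+ 2 +
    k z.1 z.2 * h z.2 ^+ 2 - k z.1 z.2 * (h z.1 - h z.2) ^+ 2))%R by field.
have i12 : (mu \x mu).-integrable setT (EFin \o (fun z => k z.1 z.2 * h z.1 ^+ 2 +
    k z.1 z.2 * h z.2 ^+ 2)%R).
  exact: (integrableD measurableT i1 i2).
have i123 : (mu \x mu).-integrable setT (EFin \o (fun z => k z.1 z.2 * h z.1 ^+ 2 +
    k z.1 z.2 * h z.2 ^+ 2 - k z.1 z.2 * (h z.1 - h z.2) ^+ 2)%R).
  exact: (integrableB measurableT i12 i3).
have sf : sqint mu h \is a fin_num by rewrite ge0_fin_numE ?sqint_ge0.
have kf : kdist mu k h \is a fin_num by rewrite ge0_fin_numE ?kdist_ge0.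
split.
  under eq_fun do rewrite E EFinM.
  exact: integrableZl.
under eq_integral do rewrite E EFinM.
rewrite integralZl//.
under eq_integral do rewrite EFinB.
rewrite integralB//; under eq_integral do rewrite EFinD.
rewrite integralD//.
rewrite (integral_kernel1 km mh2); last by move=> x; exact: sqr_ge0.
rewrite (integral_kernel2 km mh2); last by move=> x; exact: sqr_ge0.
have Es : \int[mu]_x (h x ^+ 2)%:E = (fine (sqint mu h))%:E by rewrite fineK.
have Ek : \int[mu \x mu]_z (k z.1 z.2 * (h z.1 - h z.2) ^+ 2)%:E =
    (fine (kdist mu k h))%:E by rewrite fineK.
by rewrite Es Ek -EFinD -EFinM; congr EFin; field.
Qed.

End kernel_cross.

(** * Parseval identity without damping *)

Section kernel_parseval.
Variables (R : realType) (n m : nat).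
Local Notation G := (clifford R m).
Local Notation E := ('Eucl[R]_n).
Local Notation sign := {ffun 'I_n -> bool}.
Local Notation lam := (lebesgue_tuple R n).
Variables L M : sign -> {linear G -> G}.
Hypothesis kernel_opM : forall th th' a b,
  cinner (kernel_op L th a) (kernel_op L th' b) =
  \sum_s trigprod s (fun i => th i - th' i) * cinner a (M s b).
Hypothesis M0 : forall b, M [ffun=> false] b = b.

Lemma dampE (e : R) (y : E) : damp e y = expR (- (e * \sum_i `|tnth y i : R|)).
Proof.
rewrite mulr_sumr -sumrN expR_sum; exact: eq_bigr.
Qed.

Lemma cvg_damp (y : E) : damp m.+1%:R^-1 y @[m --> \oo] --> (1 : R).
Proof.
under eq_fun do rewrite dampE.
pose S := \sum_i `|tnth y i : R|.
have e0 : - (m.+1%:R^-1 * S) @[m --> \oo] --> (0 : R).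
  rewrite [0 in X in _ --> X](_ : 0 = - (0 * S)); last by rewrite mul0r oppr0.
  by apply: cvgN; apply: cvgM; [exact: cvg_harmonic|exact: cvg_cst].
have := cvg_comp _ _ e0 (@continuous_expR R 0).
by rewrite expR0.
Qed.

Lemma damp_nd (y : E) : nondecreasing_seq (fun m => damp m.+1%:R^-1 y : R).
Proof.
move=> p q pq; rewrite !dampE ler_expR lerN2 ler_wpM2r//.
  by apply: sumr_ge0.
by rewrite lef_pV2 ?posrE ?ltr0n// ler_nat.
Qed.

(** The damped square norm [u k] has two limits: the square norm of the transform, and, by
    [damped_parseval] with [kernel_cross], (2 pi)^n times that of f as the energies vanish. *)
Lemma kernel_parseval (f : E -> G) : cintegrable f -> (csqint lam f < +oo)%E ->
  csqint lam (kernel_int L f) = (((2 * pi) ^+ n)%:E * csqint lam f)%E.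
Proof.
move=> fi f2.
have mf : cmeasurable f.
  by move=> I; apply/measurable_EFinP; exact: measurable_int (fi I).
have mF : cmeasurable (kernel_int L f).
  by move=> J; exact: measurable_kernel_int.
have f2I I : (sqint lam (fun x => f x I) < +oo)%E.
  exact: le_lt_trans (sqint_le_csqint _ _ _) f2.
have [km kv] := approx_identity_tuple_poisson R n.
pose u k := (\int[lam]_y (cinner (kernel_int L f y) (kernel_int L f y)
  * damp k.+1%:R^-1 y)%:E)%E.
(* The damping factors increase to 1, so monotone convergence applies even though the limit is not
   known to be finite. *)
have u1 : u k @[k --> \oo] --> csqint lam (kernel_int L f).
  have g0 (k : nat) (y : E) : (0 <= cinner (kernel_int L f y) (kernel_int L f y)
      * damp k.+1%:R^-1 y).
    by rewrite mulr_ge0 ?cinner_ge0 ?damp_ge0.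
  rewrite csqintE// [X in _ --> X](_ : _ = \int[lam]_y limn (fun k =>
      (cinner (kernel_int L f y) (kernel_int L f y) * damp k.+1%:R^-1 y)%:E))%E.
    apply: cvg_monotone_convergence => //.
    - move=> k; apply/measurable_EFinP/measurable_funM; first exact: measurable_cinner.
      exact: measurable_damp.
    - by move=> k y _; rewrite lee_fin.
    - move=> y _ p q pq; rewrite lee_fin ler_wpM2l ?cinner_ge0//.
      exact: damp_nd.
  apply: eq_integral => y _; apply/esym/cvg_lim => //; apply: cvg_EFin.
    exact: nearW.
  rewrite -[X in _ --> X]mulr1; apply: cvgM; first exact: cvg_cst.
  exact: cvg_damp.
pose s I := fine (sqint lam (fun x => f x I)).
pose dd I k := fine (kdist lam (@tuple_poisson R n k.+1%:R^-1) (fun x => f x I)).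
have uE k : u k = ((2 * pi) ^+ n * \sum_I (s I - 2^-1 * dd I k))%:E.
  have e0 : 0 < k.+1%:R^-1 :> R by rewrite invr_gt0.
  rewrite /u (damped_parseval kernel_opM M0 e0 fi).
  have c I := kernel_cross (km k) (mf I) (f2I I).
  have iS : (lam \x lam)%E.-integrable setT (fun z => (\sum_I
      tuple_poisson k.+1%:R^-1 z.1 z.2 * (f z.1 I * f z.2 I))%:E).
    by apply: integrable_sumr => I; have [] := c I.
  under eq_integral do rewrite EFinM /cinner mulr_sumr.
  rewrite integralZl// EFinM; congr (_ * _)%E.
  under eq_integral do rewrite -sumEFin.
  rewrite integral_sum//; last by move=> I; have [] := c I.
  by rewrite -sumEFin; apply: eq_bigr => I _; have [_ ->] := c I.
have u2 : u k @[k --> \oo] --> ((2 * pi) ^+ n * \sum_I s I)%:E.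
  under eq_fun do rewrite uE.
  apply: cvg_EFin; first exact: nearW.
  apply: cvgM; first exact: cvg_cst.
  apply: cvg_sumr => I _; rewrite -[X in _ --> X]subr0 -[X in _ - X](mulr0 2^-1).
  apply: cvgB; first exact: cvg_cst.
  apply: cvgM; first exact: cvg_cst.
  have v := vanishing_cvg0 (fun k => kdist_ge0 _ (km k)) (kv _ (mf I) (f2I I)).
  by have /fine_cvgP[] := v.
rewrite -(cvg_lim _ u1)// (cvg_lim _ u2)// EFinM -sumEFin; congr (_ * _)%E.
by apply: eq_bigr => I _; rewrite /s fineK// ge0_fin_numE ?sqint_ge0.
Qed.

End kernel_parseval.

(** * Square-integrable functions and isometric extension *)

Section square_integrable.
Context d (T : measurableType d) (R : realType).
Variable mu : {measure set T -> \bar R}.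
Implicit Types u v : T -> R.

Lemma integrable_mul u v : measurable_fun setT u -> measurable_fun setT v ->
  (sqint mu u < +oo)%E -> (sqint mu v < +oo)%E ->
  mu.-integrable setT (fun x => (u x * v x)%:E).
Proof.
move=> mu_ mv u2 v2; apply/integrableP; split.
  by apply/measurable_EFinP; exact: measurable_funM.
have mu2 := measurable_funX 2%N mu_; have mv2 := measurable_funX 2%N mv.
apply: (@le_lt_trans _ _ (sqint mu u + sqint mu v)%E); last by rewrite lte_add_pinfty.
rewrite /sqint -integralD_EFin_ge0//; try by move=> x; exact: sqr_ge0.
apply: (@le_integral_EFin _ _ _ mu (fun x => `|u x * v x|)) => [|||x].
- by apply: measurableT_comp => //; exact: measurable_funM.
- exact: measurable_funD.
- by move=> x.
- rewrite normrM -[u x ^+ 2]real_normK ?num_real// -[v x ^+ 2]real_normK ?num_real//.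
  have := sqr_ge0 (`|u x| - `|v x|); rewrite sqrrB.
  have := normr_ge0 (u x); have := normr_ge0 (v x); nra.
Qed.

(* AM-GM with a free parameter, which replaces the Cauchy-Schwarz inequality. *)
Lemma norm_Rintegral_mul_le u v (t : R) : 0 < t ->
  measurable_fun setT u -> measurable_fun setT v ->
  (sqint mu u < +oo)%E -> (sqint mu v < +oo)%E ->
  `|\int[mu]_x (u x * v x)| <= t * fine (sqint mu u) + t^-1 * fine (sqint mu v).
Proof.
move=> t0 mu_ mv u2 v2.
have mu2 := measurable_funX 2%N mu_; have mv2 := measurable_funX 2%N mv.
have uf : sqint mu u \is a fin_num by rewrite ge0_fin_numE ?sqint_ge0.
have vf : sqint mu v \is a fin_num by rewrite ge0_fin_numE ?sqint_ge0.
have iuv := integrable_mul mu_ mv u2 v2.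
apply: (le_trans (le_normr_Rintegral measurableT iuv)).
rewrite -lee_fin EFinD !EFinM !fineK//; last first.
  exact: (integrable_fin_num measurableT (integrable_norm iuv)).
rewrite /sqint.
rewrite -!integralZ_EFin_ge0 ?invr_ge0 ?(ltW t0)//; try by move=> x; exact: sqr_ge0.
rewrite -integralD_EFin_ge0//; last 4 first.
- exact: measurable_funM.
- exact: measurable_funM.
- by move=> x; rewrite mulr_ge0 ?sqr_ge0// ltW.
- by move=> x; rewrite mulr_ge0 ?sqr_ge0// invr_ge0 ltW.
apply: le_integral_EFin => [|||x].
- by apply: measurableT_comp => //; exact: measurable_funM.
- by apply: measurable_funD; exact: measurable_funM.
- by move=> x.
- rewrite normrM -[u x ^+ 2]real_normK ?num_real// -[v x ^+ 2]real_normK ?num_real//.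
  move: (normr_ge0 (u x)) (normr_ge0 (v x)); move: `|u x| `|v x| => a b a0 b0.
  rewrite -subr_ge0 (_ : _ - _ = t^-1 * ((t * a - b) ^+ 2 + t * a * b)).
    rewrite mulr_ge0 ?invr_ge0 ?(ltW t0)// addr_ge0 ?sqr_ge0// !mulr_ge0//.
    exact: ltW.
  by field; rewrite gt_eqF.
Qed.

Lemma sqint_fine_cvg0 (q : nat -> T -> R) : vanishing (fun k => sqint mu (q k)) ->
  forall e : R, 0 < e -> \forall k \near \oo, fine (sqint mu (q k)) <= e.
Proof.
move=> q0 e e0; apply: filterS (q0 e e0) => k qk.
by rewrite -lee_fin fineK// ge0_fin_numE ?sqint_ge0// (le_lt_trans qk)// ltry.
Qed.

(** With a = u - u_k and b = v - v_k, the difference of the integrands is u b + a v - a b; each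
    integral is bounded by [norm_Rintegral_mul_le] with its own parameter. *)
Lemma cvg_Rintegral_mul (u v : T -> R) (u_ v_ : nat -> T -> R) :
  measurable_fun setT u -> measurable_fun setT v ->
  (forall k, measurable_fun setT (u_ k)) -> (forall k, measurable_fun setT (v_ k)) ->
  (sqint mu u < +oo)%E -> (sqint mu v < +oo)%E ->
  (forall k, sqint mu (u_ k) < +oo)%E -> (forall k, sqint mu (v_ k) < +oo)%E ->
  vanishing (fun k => sqint mu (fun x => u x - u_ k x)) ->
  vanishing (fun k => sqint mu (fun x => v x - v_ k x)) ->
  \int[mu]_x (u_ k x * v_ k x) @[k --> \oo] --> \int[mu]_x (u x * v x).
Proof.
move=> mu_ mv muk mvk u2 v2 uk2 vk2 uu vv.
pose a k x := u x - u_ k x; pose b k x := v x - v_ k x.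
have ma k : measurable_fun setT (a k) by exact: measurable_funB.
have mb k : measurable_fun setT (b k) by exact: measurable_funB.
have sq_oo (p q : T -> R) : measurable_fun setT p -> measurable_fun setT q ->
    (sqint mu p < +oo)%E -> (sqint mu q < +oo)%E ->
    (sqint mu (fun x => p x - q x)%R < +oo)%E.
  move=> mp mq p2 q2; apply: (le_lt_trans (sqintD mu mp (measurable_funN mq))).
  by rewrite sqintN lte_add_pinfty// lte_mul_pinfty.
have a2 k : (sqint mu (a k) < +oo)%E by exact: sq_oo.
have b2 k : (sqint mu (b k) < +oo)%E by exact: sq_oo.
pose A := fine (sqint mu u); pose B := fine (sqint mu v).
have A0 : 0 <= A by rewrite fine_ge0 ?sqint_ge0.
have B0 : 0 <= B by rewrite fine_ge0 ?sqint_ge0.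
apply/cvgrPdist_le => e e0.
(* The parameters keep the contributions of the fixed functions u and v below e/8, the + 1 guarding
   against A = 0 or B = 0. The four remaining terms drop below e/8 for large k, and the sum is at
   most 6 e/8. *)
pose tA := e / (8 * (A + 1)); pose tB := e / (8 * (B + 1)).
have tA0 : 0 < tA by rewrite divr_gt0// mulr_gt0// ltr_wpDl.
have tB0 : 0 < tB by rewrite divr_gt0// mulr_gt0// ltr_wpDl.
have tAA : tA * A <= e / 8.
  rewrite /tA mulrAC ler_pdivrMr ?mulr_gt0 ?ltr_wpDl//.
  by rewrite (_ : e / 8 * _ = e * (A + 1)); [rewrite ler_wpM2l ?lerDl// ltW|field].
have tBB : tB * B <= e / 8.
  rewrite /tB mulrAC ler_pdivrMr ?mulr_gt0 ?ltr_wpDl//.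
  by rewrite (_ : e / 8 * _ = e * (B + 1)); [rewrite ler_wpM2l ?lerDl// ltW|field].
have small (q : nat -> T -> R) (t : R) : 0 < t -> vanishing (fun k => sqint mu (q k)) ->
    \forall k \near \oo, t * fine (sqint mu (q k)) <= e / 8.
  move=> t0 q0; have d0 : 0 < e / 8 / t by rewrite !divr_gt0.
  apply: filterS (sqint_fine_cvg0 q0 d0) => k.
  by rewrite ler_pdivlMr// mulrC.
near=> k.
have E : \int[mu]_x (u x * v x) - \int[mu]_x (u_ k x * v_ k x) =
    \int[mu]_x (u x * b k x) + \int[mu]_x (a k x * v x) - \int[mu]_x (a k x * b k x).
  rewrite -RintegralB//; try exact: integrable_mul.
  rewrite -RintegralD//; try exact: integrable_mul.
  rewrite -RintegralB//; try exact: integrable_mul.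
    by apply: eq_Rintegral => x _; rewrite /a /b; ring.
  exact: (integrableD measurableT (integrable_mul mu_ (mb k) u2 (b2 k))
    (integrable_mul (ma k) mv (a2 k) v2)).
rewrite E.
have h1 := norm_Rintegral_mul_le tA0 mu_ (mb k) u2 (b2 k).
have h2 := norm_Rintegral_mul_le tB0 mv (ma k) v2 (a2 k).
have h3 := norm_Rintegral_mul_le ltr01 (ma k) (mb k) (a2 k) (b2 k).
have s1 : tA^-1 * fine (sqint mu (b k)) <= e / 8.
  by near: k; apply: small => //; rewrite invr_gt0.
have s2 : tB^-1 * fine (sqint mu (a k)) <= e / 8.
  by near: k; apply: small => //; rewrite invr_gt0.
have s3 : 1 * fine (sqint mu (a k)) <= e / 8 by near: k; exact: small.
have s4 : 1 * fine (sqint mu (b k)) <= e / 8 by near: k; exact: small.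
have C : \int[mu]_x (v x * a k x) = \int[mu]_x (a k x * v x).
  by apply: eq_Rintegral => x _; rewrite mulrC.
rewrite C in h2; rewrite invr1 in h3.
apply: (le_trans (ler_normB _ _)); apply: (le_trans (lerD (ler_normD _ _) (lexx _))).
by move: h1 h2 h3; rewrite -/A -/B; lra.
Unshelve. all: by end_near. Qed.

Lemma truncation_vanishing (F : nat -> set T) u : (forall k, measurable (F k)) ->
  nondecreasing_seq F -> \bigcup_k F k = setT ->
  measurable_fun setT u -> (sqint mu u < +oo)%E ->
  vanishing (fun k => sqint mu (fun x => u x - \1_(F k) x * u x)).
Proof.
move=> mF ndF FT mu_ u2; apply: cvg0_vanishing; rewrite -(integral0 mu setT).
have iu2 : mu.-integrable setT (fun x => (u x ^+ 2)%:E).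
  apply/integrableP; split; first by apply/measurable_EFinP; exact: measurable_funX.
  by under eq_integral do rewrite gee0_abs ?lee_fin ?sqr_ge0//.
apply: dominated_cvg iu2 _ => //.
- move=> k; apply/measurable_EFinP; apply: measurable_funX; apply: measurable_funB => //.
  by apply: measurable_funM => //; exact: measurable_indic.
- move=> x _ /=; have [N _ FNx] : (\bigcup_k F k) x by rewrite FT.
  apply: cvg_near_cst; exists N => // k /= Nk.
  have Fkx : F k x by move: FNx; exact/subsetPset/ndF.
  by rewrite indicE mem_set// mul1r subrr expr0n.
- move=> k x _ /=; rewrite lee_fin ger0_norm ?sqr_ge0// indicE.
  by case: (x \in F k); rewrite ?mul1r ?subrr ?mul0r ?subr0// expr0n sqr_ge0.
Qed.

Lemma integrable_truncation (A : set T) u : measurable A -> (mu A < +oo)%E ->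
  measurable_fun setT u -> (sqint mu u < +oo)%E ->
  mu.-integrable setT (fun x => (\1_A x * u x)%:E).
Proof.
move=> mA Aoo mu_ u2; apply: integrable_mul => //.
rewrite /sqint (eq_integral (fun x => (\1_A x)%:E)) ?integral_indic ?setIT//.
by move=> x _; rewrite indicE; case: (_ \in _); rewrite ?expr1n ?expr0n.
Qed.

(** * Completeness of L_2 *)

Section riesz_fischer.
Variable h : nat -> T -> R.
Hypothesis mh : forall k, measurable_fun setT (h k).
Hypothesis hd : forall k,
  (sqint mu (fun x => h k.+1 x - h k x)%R <= ((8^-1) ^+ k)%:E)%E.

Let dh k x := h k.+1 x - h k x.

Let mdh k : measurable_fun setT (dh k). Proof. exact: measurable_funB. Qed.

(** Induction on l closes because 2 (4/8) + 2 = 3 <= 4: the ratio 1/8 absorbs the factor 2 lost at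
    each use of [sqintD]. *)
Let sqint_tail k l : (sqint mu (fun x => h (k + l) x - h k x)%R <= (4 * (8^-1) ^+ k)%:E)%E.
Proof.
elim: l k => [|l IH] k.
  rewrite addn0 /sqint; under eq_integral do rewrite subrr expr0n.
  by rewrite integral0 lee_fin mulr_ge0// exprn_ge0// invr_ge0.
rewrite (_ : (fun x => h (k + l.+1) x - h k x) =
  (fun x => (h (k.+1 + l) x - h k.+1 x) + dh k x)); last first.
  by apply/funext => x; rewrite addSnnS /dh addrA subrK.
have m1 : measurable_fun setT (fun x => h (k.+1 + l) x - h k.+1 x)%R by exact: measurable_funB.
apply: (le_trans (sqintD mu m1 (mdh k))).
apply: (@le_trans _ _ (2%:E * (4 * (8^-1) ^+ k.+1)%:E + 2%:E * ((8^-1) ^+ k)%:E)%E).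
  by apply: leeD; apply: lee_wpmul2l => //; first [exact: IH|exact: hd].
rewrite -!EFinM -EFinD lee_fin exprS.
have : 0 <= (8^-1 : R) ^+ k by rewrite exprn_ge0// invr_ge0.
by move: (_ ^+ k) => y y0; lra.
Qed.

(** The weights 4^k are beaten by the decay 8^(-k), so S is integrable; where it is finite the
    increments are O(2^(-k)), hence summable. *)
Let S x := (\sum_(0 <= k <oo) ((2 ^+ k * dh k x) ^+ 2)%:E)%E.

Let mterm k : measurable_fun setT (fun x => ((2 ^+ k * dh k x) ^+ 2)%:E).
Proof.
by apply/measurable_EFinP; apply: measurable_funX; exact: measurable_funM.
Qed.

Let S_ae_finite : {ae mu, forall x, S x \is a fin_num}.
Proof.
have S0 x : (0 <= S x)%E by apply: nneseries_ge0 => k _ _; rewrite lee_fin sqr_ge0.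
have mS : measurable_fun setT S.
  apply: ge0_emeasurable_sum => // k x _ _; by rewrite lee_fin sqr_ge0.
have SI : (\int[mu]_x S x < +oo)%E.
  rewrite integral_nneseries//; last by move=> k x _; rewrite lee_fin sqr_ge0.
  (* The k-th integral is at most 4^k 8^(-k) = 2^(-k), in the shape that
     [cvg_geometric_eseries_half] sums. *)
  apply: (@le_lt_trans _ _ (\sum_(0 <= k <oo) (2 / (2 ^ (k + 1))%:R)%:E)%E).
    apply: lee_nneseries => [k _ _|k _].
      by apply: integral_ge0 => x _; rewrite lee_fin sqr_ge0.
    under eq_integral do rewrite exprMn.
    rewrite integralZ_EFin_ge0 ?sqr_ge0//; last 2 first.
    - exact: measurable_funX.
    - by move=> x; exact: sqr_ge0.
    apply: (@le_trans _ _ ((2 ^+ k ^+ 2)%:E * ((8^-1) ^+ k)%:E)%E).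
      by apply: lee_wpmul2l; [rewrite lee_fin sqr_ge0|exact: hd].
    rewrite -EFinM lee_fin le_eqVlt; apply/orP; left; apply/eqP.
    rewrite addn1 expnS natrM natrX -exprM mulnC exprM -exprMn.
    rewrite invfM mulrA divff// mul1r -exprVn; congr (_ ^+ k).
    by rewrite expr2; field.
  have := @cvg_geometric_eseries_half R 2 0 => /(cvg_lim _) -> //.
  exact: ltry.
have iS : mu.-integrable setT S.
  apply/integrableP; split => //.
  by under eq_integral do rewrite gee0_abs//.
by apply: filterS (integrable_ae measurableT iS) => x /(_ I).
Qed.

Let cvg_h x : S x \is a fin_num -> cvgn (h ^~ x).
Proof.
move=> Sf; pose s := fine (S x).
have ts k : (2 ^+ k * dh k x) ^+ 2 <= s.
  rewrite -lee_fin /s fineK//.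
  have := @nneseries_lim_ge R (fun k => ((2 ^+ k * dh k x) ^+ 2)%:E) xpredT 0 k.+1.
  move=> /(_ (fun _ _ => _)) H.
  apply: le_trans (H _); last by move=> i _; rewrite lee_fin sqr_ge0.
  rewrite big_nat_recr//= leeDr// sume_ge0// => i _; by rewrite lee_fin sqr_ge0.
have s0 : 0 <= s by apply: le_trans (ts 0%N); exact: sqr_ge0.
(* From (2^k dh)^2 <= s <= (s + 1)^2, which avoids a square root. *)
have dk k : `|dh k x| <= (s + 1) * (2^-1) ^+ k.
  have p2 : 0 < 2 ^+ k :> R by rewrite exprn_gt0.
  rewrite exprVn ler_pdivlMr// mulrC -(ger0_norm (ltW p2)) -normrM.
  rewrite -ler_sqr ?nnegrE ?addr_ge0//; rewrite real_normK ?num_real//.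
  by apply: (le_trans (ts k)); rewrite sqrrD; nra.
have : cvgn (series (dh ^~ x)).
  apply: normed_cvg.
  apply: (@series_le_cvg _ _ (geometric (s + 1) 2^-1)) => //.
  - by move=> k /=.
  - by move=> k; apply: (@geometric_ge0 _ (s + 1) 2^-1 k); rewrite ?addr_ge0 ?invr_ge0.
  - by apply: is_cvg_geometric_series; rewrite ger0_norm ?invr_ge0//; lra.
move=> cs; apply/cvg_ex; exists (h 0 x + limn (series (dh ^~ x))).
rewrite [X in X @ _](_ : _ = (fun k => h 0 x + series (dh ^~ x) k)).
  by apply: cvgD; [exact: cvg_cst|exact: cs].
by apply/funext => k; rewrite [LHS](@eq_sum_telescope _ (h ^~ x)).
Qed.

Lemma riesz_fischer : exists2 g : T -> R, measurable_fun setT g &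
  forall k, (sqint mu (fun x => g x - h k x)%R <= (4 * (8^-1) ^+ k)%:E)%E.
Proof.
(* An upper limit is defined and measurable everywhere, and it equals the limit almost
   everywhere. *)
pose g x := fine (limn_esup (fun k => (h k x)%:E)).
have mg : measurable_fun setT g.
  apply: measurableT_comp; first exact: fine_measurable.
  by apply: measurable_fun_limn_esup => k; exact/measurable_EFinP.
exists g => // k.
have gE x : S x \is a fin_num -> h k x @[k --> \oo] --> g x.
  move=> /cvg_h /cvg_ex[l hl]; rewrite /g.
  have hlE : (h k x)%:E @[k --> \oo] --> l%:E by apply: cvg_EFin => //; exact: nearW.
  by have [_ ->] := cvg_limn_einf_sup hlE.
pose w l x := ((h (k + l) x - h k x) ^+ 2)%:E.
have mw l : measurable_fun setT (w l).
  by apply/measurable_EFinP; apply: measurable_funX; exact: measurable_funB.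
have w0 l x : (0 <= w l x)%E by rewrite lee_fin sqr_ge0.
have mlw : measurable_fun setT (fun x => limn_einf (w ^~ x)).
  have -> : (fun x => limn_einf (w ^~ x)) = (fun x => - limn_esup (fun l => - w l x)%E)%E.
    apply/funext => x; rewrite -[LHS]oppeK -limn_esupN//.
  apply: measurableT_comp => //; apply: measurable_fun_limn_esup => l.
  exact: measurableT_comp.
have lw0 x : (0 <= limn_einf (w ^~ x))%E.
  rewrite limn_einf_lim; apply: lime_ge; first exact: is_cvg_einfs.
  by apply: nearW => l; apply: le_ereal_inf_tmp => _ [j /= _ <-].
(* Almost everywhere (g - h_k)^2 is the lower limit in l of (h_(k+l) - h_k)^2; Fatou and
   [sqint_tail] then bound its integral. *)
apply: (@le_trans _ _ (\int[mu]_x limn_einf (w ^~ x))%E).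
  apply: ae_ge0_le_integral => //.
  - by move=> x _; rewrite lee_fin sqr_ge0.
  - by apply/measurable_EFinP; apply: measurable_funX; exact: measurable_funB.
  apply: filterS S_ae_finite => x Sx _.
  have : w l x @[l --> \oo] --> ((g x - h k x) ^+ 2)%:E.
    apply: cvg_EFin; first exact: nearW.
    have H : (fun l => h (k + l)%N x) @ \oo --> g x.
      under eq_fun do rewrite addnC.
      have := gE x Sx; rewrite -(cvg_shiftn k) => H; exact H.
    have H' : (h (k + l)%N x - h k x) @[l --> \oo] --> g x - h k x.
      by apply: cvgB => //; exact: cvg_cst.
    have C := @exprn_continuous R 2 (g x - h k x).
    exact: (cvg_comp (fun l => h (k + l)%N x - h k x) (fun y : R => y ^+ 2) H' C).
  by move=> /cvg_limn_einf_sup[->].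
apply: (le_trans (fatou mu measurableT mw (fun l x _ => w0 l x))).
rewrite limn_einf_lim; apply: lime_le; first exact: is_cvg_einfs.
apply: nearW => l; apply: le_trans (sqint_tail k l).
by apply: ereal_inf_lbound; exists l => //=.
Qed.

End riesz_fischer.

End square_integrable.

Section clifford_square_integrable.
Local Open Scope ereal_scope.
Context d (T : measurableType d) (R : realType) (m : nat).
Local Notation G := (clifford R m).
Variable mu : {measure set T -> \bar R}.
Implicit Types f g h : T -> G.

Definition csquare_integrable f := cmeasurable f /\ csqint mu f < +oo.

Lemma cmeasurableB f g : cmeasurable f -> cmeasurable g ->
  cmeasurable (fun x => f x - g x)%R.
Proof.
move=> mf mg I; rewrite (_ : (fun x => _) = (fun x => f x I - g x I)%R).
  exact: measurable_funB.
by apply/funext => x; rewrite Defs.coefD [in RHS]/GRing.opp/= ffunE.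
Qed.

Lemma coefB (a b : G) I : (a - b)%R I = (a I - b I)%R.
Proof. by rewrite Defs.coefD; congr (_ + _)%R; rewrite ffunE. Qed.

Lemma csqintB f g : cmeasurable f -> cmeasurable g ->
  csqint mu (fun x => f x - g x)%R <= 2%:E * csqint mu f + 2%:E * csqint mu g.
Proof.
move=> mf mg; rewrite /csqint !ge0_sume_distrr; try by move=> I _; exact: sqint_ge0.
rewrite -big_split; apply: lee_sum => I _ /=.
under [X in sqint _ X <= _]eq_fun do rewrite coefB.
by apply: (le_trans (sqintD mu (mf I) (measurable_funN (mg I)))); rewrite sqintN.
Qed.

Lemma csqintBC f g : csqint mu (fun x => f x - g x)%R = csqint mu (fun x => g x - f x)%R.
Proof.
apply: eq_bigr => I _; apply: eq_integral => x _.
by rewrite !coefB -sqrrN opprB.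
Qed.

Lemma csqint_triangle g f h : cmeasurable f -> cmeasurable g -> cmeasurable h ->
  csqint mu (fun x => f x - h x)%R <=
  2%:E * csqint mu (fun x => f x - g x)%R + 2%:E * csqint mu (fun x => g x - h x)%R.
Proof.
move=> mf mg mh; rewrite (csqintBC g h).
apply: le_trans (csqintB (cmeasurableB mf mg) (cmeasurableB mh mg)).
rewrite le_eqVlt; apply/orP; left; apply/eqP; congr (csqint mu _).
by apply/funext => x; rewrite opprB addrA subrK.
Qed.

Lemma csquare_integrableB f g : csquare_integrable f -> csquare_integrable g ->
  csquare_integrable (fun x => f x - g x)%R.
Proof.
move=> [mf f2] [mg g2]; split; first exact: cmeasurableB.
by apply: (le_lt_trans (csqintB mf mg)); rewrite lte_add_pinfty// lte_mul_pinfty.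
Qed.

Lemma csqint_ae_eq f g h : cmeasurable f -> cmeasurable g -> cmeasurable h ->
  {ae mu, forall x, f x = g x} ->
  csqint mu (fun x => h x - f x)%R = csqint mu (fun x => h x - g x)%R.
Proof.
move=> mf mg mh fg; apply: eq_bigr => I _.
apply: ge0_ae_eq_integral => //.
- apply/measurable_EFinP; apply: measurable_funX; exact: (cmeasurableB mh mf).
- apply/measurable_EFinP; apply: measurable_funX; exact: (cmeasurableB mh mg).
- by move=> x _; rewrite lee_fin sqr_ge0.
- by move=> x _; rewrite lee_fin sqr_ge0.
- by apply: filterS fg => x -> _.
Qed.

Lemma csqintB_eq0 f g : cmeasurable f -> cmeasurable g ->
  csqint mu (fun x => f x - g x)%R <= 0 -> {ae mu, forall x, f x = g x}.
Proof.
move=> mf mg fg0.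
have aeI I : {ae mu, forall x, f x I = g x I}.
  have : \int[mu]_x `|((f x I - g x I) ^+ 2)%:E| = 0.
    apply/eqP; rewrite eq_le integral_ge0 ?andbT//.
    apply: le_trans fg0; apply: le_trans (sqint_le_csqint _ _ I).
    rewrite le_eqVlt; apply/orP; left; apply/eqP; apply: eq_integral => x _.
    by rewrite gee0_abs ?lee_fin ?sqr_ge0// coefB.
  have mI : measurable_fun setT (fun x => ((f x I - g x I) ^+ 2)%:E).
    by apply/measurable_EFinP; apply: measurable_funX; exact: measurable_funB.
  move=> /(ae_eq_integral_abs mu measurableT mI) H.
  have H' : {ae mu, forall x, setT x -> ((f x I - g x I) ^+ 2)%:E = 0} by exact: H.
  apply: filterS H' => x /(_ Logic.I) [] /eqP.
  by rewrite expf_eq0/= subr_eq0 => /eqP.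
have aeA : {ae mu, forall x, forall I, f x I = g x I} by exact: filter_forall.
by apply: filterS aeA => x fgx; apply/ffunP.
Qed.

Lemma csqint_le_dist f g : cmeasurable f -> cmeasurable g ->
  csqint mu f <= 2%:E * csqint mu (fun x => f x - g x)%R + 2%:E * csqint mu g.
Proof.
move=> mf mg; have m0 : cmeasurable (fun _ : T => 0%R : G).
  by move=> I; under eq_fun do rewrite ffunE; exact: measurable_cst.
have := csqint_triangle mf mg m0.
under [X in csqint _ X <= _ -> _]eq_fun do rewrite subr0.
by under [X in _ <= _ + _ * csqint _ X -> _]eq_fun do rewrite subr0.
Qed.

Lemma vanishing_sum (I : Type) (r : seq I) (u : I -> nat -> \bar R) :
  (forall i, vanishing (u i)) -> vanishing (fun k => \sum_(i <- r) u i k).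
Proof.
move=> u0; elim: r => [|i r IH].
  by move=> e e0; apply: nearW => k; rewrite big_nil lee_fin ltW.
apply: (@vanishing_le _ _ (fun k => u i k + \sum_(j <- r) u j k)).
  by move=> k; rewrite big_cons.
exact: vanishingD.
Qed.

Lemma clifford_riesz_fischer (h : nat -> T -> G) : (forall k, cmeasurable (h k)) ->
  (forall k, csqint mu (fun x => h k.+1 x - h k x)%R <= ((8^-1) ^+ k)%:E) ->
  exists2 g, cmeasurable g & vanishing (fun k => csqint mu (fun x => g x - h k x)%R).
Proof.
move=> mh hd.
have RF I : exists g : T -> R, measurable_fun setT g /\ forall k,
    sqint mu (fun x => g x - h k x I)%R <= (4 * (8^-1) ^+ k)%:E.
  have [k|g mg gh] := @riesz_fischer _ _ _ mu (fun k x => h k x I) (fun k => mh k I).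
    apply: le_trans (hd k); apply: le_trans (sqint_le_csqint _ _ I).
    by under [X in _ <= sqint _ X]eq_fun do rewrite coefB.
  by exists g.
have [g gP] := choice RF.
exists (fun x => [ffun I => g I x]).
  by move=> I; under eq_fun do rewrite ffunE; have [] := gP I.
apply: vanishing_sum => I.
apply: (@vanishing_le _ _ (fun k => (4 * (8^-1) ^+ k)%:E)).
  move=> k; under [X in sqint _ X <= _]eq_fun do rewrite coefB ffunE.
  by have [] := gP I.
apply: cvg0_vanishing; apply: cvg_EFin; first exact: nearW.
by apply: (@cvg_geometric R 4 8^-1); rewrite ger0_norm ?invr_ge0//; lra.
Qed.

(** The intersection of L_1 and L_2, with integrability asked of each coefficient;
    [in_clifford_L12P] and [cdom_in_clifford_L1] relate it to [in_clifford_L]. *)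
Definition cdom f := csquare_integrable f /\
  forall I, mu.-integrable setT (fun x => (f x I)%:E).

(** * Density of the common domain and extension of isometries *)

Section density.
Variable F : nat -> set T.
Hypothesis mF : forall k, measurable (F k).
Hypothesis ndF : nondecreasing_seq F.
Hypothesis FT : \bigcup_k F k = setT.
Hypothesis Foo : forall k, mu (F k) < +oo.

(** Truncation to a set of finite measure stays in L_2 and enters L_1, as a product with an
    indicator that is itself in L_2. *)
Lemma cdom_dense f : csquare_integrable f ->
  forall e : R, (0 < e)%R -> exists2 g, cdom g & csqint mu (fun x => f x - g x)%R <= e%:E.
Proof.
move=> [mf f2] e e0.
have f2I I : sqint mu (fun x => f x I) < +oo by exact: le_lt_trans (sqint_le_csqint _ _ _) f2.
pose g k x : G := (\1_(F k) x *: f x)%R.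
have v : vanishing (fun k => csqint mu (fun x => f x - g k x)%R).
  apply: vanishing_sum => I.
  apply: vanishing_le (truncation_vanishing mF ndF FT (mf I) (f2I I)) => k.
  by under [X in sqint _ X <= _]eq_fun do rewrite coefB Defs.coefZ.
have [N _ /(_ N (leqnn N)) HN] := v e e0.
exists (g N) => //.
have mg : cmeasurable (g N).
  move=> I; under eq_fun do rewrite Defs.coefZ.
  by apply: measurable_funM => //; exact: measurable_indic.
split; last first.
  move=> I; under eq_fun do rewrite Defs.coefZ.
  exact: integrable_truncation.
split => //; apply: (le_lt_trans (csqint_le_dist mg mf)).
by rewrite csqintBC lte_add_pinfty// lte_mul_pinfty// ?csqint_ge0// (le_lt_trans HN)// ltry.
Qed.

(** At this rate consecutive terms differ by at most (1/16 + 1/2) 8^(-k) in square norm, within what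
    [clifford_riesz_fischer] asks. *)
Lemma cdom_seq f : csquare_integrable f -> exists g : nat -> T -> G,
  (forall k, cdom (g k)) /\
  forall k, csqint mu (fun x => f x - g k x)%R <= (4^-1 * (8^-1) ^+ k)%:E.
Proof.
move=> f2.
have H k : exists g, cdom g /\ csqint mu (fun x => f x - g x)%R <= (4^-1 * (8^-1) ^+ k)%:E.
  have e0 : (0 < 4^-1 * (8^-1) ^+ k :> R)%R by rewrite mulr_gt0// exprn_gt0.
  by have [g dg fg] := cdom_dense f2 e0; exists g.
have [g gP] := choice H.
by exists g; split => k; have [] := gP k.
Qed.

Section extension.
Variable T0 : (T -> G) -> (T -> G).
Hypothesis T0_measurable : forall f, cdom f -> cmeasurable (T0 f).
Hypothesis T0_isometry : forall f, cdom f -> csqint mu (T0 f) = csqint mu f.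
Hypothesis T0B : forall f g, cdom f -> cdom g ->
  T0 (fun x => f x - g x)%R = (fun x => T0 f x - T0 g x)%R.

Lemma cdomB f g : cdom f -> cdom g -> cdom (fun x => f x - g x)%R.
Proof.
move=> [f2 fi] [g2 gi]; split; first exact: csquare_integrableB.
move=> I; under eq_fun do rewrite coefB EFinB.
by apply: integrableB.
Qed.

Let T0_dist f g : cdom f -> cdom g ->
  csqint mu (fun x => T0 f x - T0 g x)%R = csqint mu (fun x => f x - g x)%R.
Proof. by move=> df dg; rewrite -T0B// T0_isometry//; exact: cdomB. Qed.

(** h is the limit of the images of a fast sequence g_k. Comparing T0 g with T0 g_k, then g_k with
    f, costs two factors 2. The resulting bound no longer mentions the sequence, and gives both
    agreement with [T0] and continuity. *)
Lemma isometry_extension f : csquare_integrable f -> exists2 h, csquare_integrable h &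
  forall g, cdom g -> csqint mu (fun x => h x - T0 g x)%R <=
    4%:E * csqint mu (fun x => f x - g x)%R.
Proof.
move=> f2; have [mf _] := f2.
have [g [dg fg]] := cdom_seq f2.
have mg k : cmeasurable (g k) by have [[]] := dg k.
have [k|k|h mh hv] := @clifford_riesz_fischer (fun k => T0 (g k)).
- exact: T0_measurable.
- rewrite T0_dist//.
  apply: (le_trans (csqint_triangle (mg k.+1) mf (mg k))); rewrite csqintBC.
  apply: (@le_trans _ _ (2%:E * (4^-1 * (8^-1) ^+ k.+1)%:E + 2%:E * (4^-1 * (8^-1) ^+ k)%:E)).
    by apply: leeD; apply: lee_wpmul2l => //; exact: fg.
  rewrite -!EFinM -EFinD lee_fin exprS.
  have : (0 <= (8^-1 : R) ^+ k)%R by rewrite exprn_ge0// invr_ge0.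
  by move: (_ ^+ k)%R => y y0; lra.
have bound g' : cdom g' -> csqint mu (fun x => h x - T0 g' x)%R <=
    4%:E * csqint mu (fun x => f x - g' x)%R.
  move=> dg'; have mg' : cmeasurable g' by have [[]] := dg'.
  apply/lee_addgt0Pr => e e0.
  have fv : vanishing (fun k => csqint mu (fun x => f x - g k x)%R).
    apply: (vanishing_le fg).
    apply: cvg0_vanishing; apply: cvg_EFin; first exact: nearW.
    by apply: (@cvg_geometric R 4^-1 8^-1); rewrite ger0_norm ?invr_ge0//; lra.
  have e1 : (0 < e / 8)%R by rewrite divr_gt0.
  near \oo => k.
  have hk : csqint mu (fun x => h x - T0 (g k) x)%R <= (e / 8)%:E.
    by near: k; exact: hv.
  have fk : csqint mu (fun x => f x - g k x)%R <= (e / 8)%:E.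
    by near: k; exact: fv.
  apply: (le_trans (csqint_triangle mh (T0_measurable (dg k)) (T0_measurable dg'))).
  rewrite T0_dist//.
  have tr := csqint_triangle (mg k) mf mg'; rewrite (csqintBC (g k) f) in tr.
  apply: (@le_trans _ _ (2%:E * (e / 8)%:E + 2%:E * (2%:E * (e / 8)%:E +
      2%:E * csqint mu (fun x => f x - g' x)%R))).
    apply: leeD; apply: lee_wpmul2l => //.
    apply: (le_trans tr); apply: leeD => //; exact: lee_wpmul2l.
  rewrite ge0_muleDr ?mule_ge0 ?csqint_ge0 ?lee_fin ?(ltW e1)//.
  rewrite addeA addeC !muleA -!EFinM -EFinD leeD//; last by rewrite lee_fin; lra.
  by rewrite (_ : (2 * 2 = 4)%R); [|ring].
exists h => //; split => //.
have T2 : csqint mu (T0 (g 0%N)) < +oo.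
  by rewrite T0_isometry//; have [[]] := dg 0%N.
apply: (le_lt_trans (csqint_le_dist mh (T0_measurable (dg 0%N)))).
rewrite lte_add_pinfty// lte_mul_pinfty// ?csqint_ge0//.
apply: (le_lt_trans (bound _ (dg 0%N))); rewrite lte_mul_pinfty// ?csqint_ge0//.
by apply: (le_lt_trans (fg 0%N)); rewrite ltry.
Unshelve. all: by end_near. Qed.

(** The value of S is chosen at each f separately; the bound of [isometry_extension] ties the
    choices together, and continuity is content with the loose constant 16. *)
Lemma extension_exists : exists2 S : (T -> G) -> (T -> G),
  (forall f, csquare_integrable f -> csquare_integrable (S f)) &
  (forall f, cdom f -> {ae mu, forall x, S f x = T0 f x}) /\
  (forall f g, csquare_integrable f -> csquare_integrable g ->
    csqint mu (fun x => S f x - S g x)%R <=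
    16%:E * csqint mu (fun x => f x - g x)%R).
Proof.
have H f : exists h, csquare_integrable f -> csquare_integrable h /\
    forall g, cdom g -> csqint mu (fun x => h x - T0 g x)%R <=
    4%:E * csqint mu (fun x => f x - g x)%R.
  have [f2|nf2] := pselect (csquare_integrable f); last by exists f.
  by have [h h2 hb] := isometry_extension f2; exists h.
have [S SP] := choice H.
exists S; first by move=> f f2; have [] := SP f f2.
split => [f df|f g f2 g2].
  have f2 : csquare_integrable f by case: df.
  have [[mS _] Sb] := SP f f2.
  apply: csqintB_eq0 => //; first exact: T0_measurable.
  apply: (le_trans (Sb _ df)).
  rewrite /csqint big1 ?mule0// => I _; rewrite /sqint.
  by under eq_integral do rewrite coefB subrr expr0n; rewrite integral0.
have [[mSf _] Sfb] := SP f f2; have [[mSg _] Sgb] := SP g g2.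
have [mf _] := f2; have [mg _] := g2.
have B e : (0 < e)%R -> csqint mu (fun x => S f x - S g x)%R <=
    16%:E * csqint mu (fun x => f x - g x)%R + e%:E.
  (* Going through T0 f' costs 8 d + 8 (2 D + 2 d) = 16 D + 24 d, where D and d are the square
     distances of f to g and of f to f'. *)
  move=> e0; have e1 : (0 < e / 24)%R by rewrite divr_gt0.
  have [f' df' ff'] := cdom_dense f2 e1.
  have mf' : cmeasurable f' by have [[]] := df'.
  apply: (le_trans (csqint_triangle mSf (T0_measurable df') mSg)).
  rewrite (csqintBC (T0 f') (S g)).
  have tr := csqint_triangle mg mf mf'; rewrite (csqintBC g f) in tr.
  apply: (@le_trans _ _ (2%:E * (4%:E * (e / 24)%:E) + 2%:E * (4%:E *
      (2%:E * csqint mu (fun x => f x - g x)%R + 2%:E * (e / 24)%:E)))).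
    apply: leeD; apply: lee_wpmul2l => //.
      by apply: (le_trans (Sfb _ df')); exact: lee_wpmul2l.
    apply: (le_trans (Sgb _ df')); apply: lee_wpmul2l => //.
    by apply: (le_trans tr); apply: leeD => //; exact: lee_wpmul2l.
  rewrite !ge0_muleDr ?mule_ge0 ?csqint_ge0 ?lee_fin ?(ltW e1)//.
  rewrite addeCA !muleA -!EFinM -EFinD leeD//; last by rewrite lee_fin; lra.
  by rewrite (_ : (2 * 4 * 2 = 16)%R); [|ring].
by apply/lee_addgt0Pr => e; exact: B.
Qed.

End extension.
End density.
End clifford_square_integrable.

(** * From Lebesgue measure to the normalized measure *)

Section normalized_measure.
Local Open Scope ereal_scope.
Variables (R : realType) (n : nat).
Local Notation E := ('Eucl[R]_n).
Local Notation lam := (lebesgue_tuple R n).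
Local Notation dm := (normalized_lebesgue R n).

Definition normalization : R := powR (2 * pi)%R (- (n%:R / 2))%R.
Local Notation c := normalization.

Lemma normalization_gt0 : (0 < c)%R.
Proof. by rewrite powR_gt0// mulr_gt0// pi_gt0. Qed.

Lemma normalization_sqr : (c ^+ 2 * (2 * pi) ^+ n = 1)%R.
Proof.
have p0 : (0 < 2 * pi :> R)%R by rewrite mulr_gt0// pi_gt0.
rewrite expr2 -powRD; last by rewrite (gt_eqF p0) implybT.
rewrite -powR_mulrn ?(ltW p0)// -powRD; last by rewrite (gt_eqF p0) implybT.
by rewrite -opprD -splitr addNr powRr0.
Qed.

Lemma ge0_integral_normalized (f : E -> \bar R) : measurable_fun setT f ->
  (forall x, 0 <= f x) -> \int[dm]_x f x = c%:E * \int[lam]_x f x.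
Proof. by move=> mf f0; rewrite ge0_integral_mscale. Qed.

Lemma integrable_normalized (f : E -> \bar R) :
  dm.-integrable setT f <-> lam.-integrable setT f.
Proof.
have c0 := normalization_gt0.
split=> /integrableP[mf fi]; apply/integrableP; split => //.
- rewrite ge0_integral_normalized// in fi; last exact: measurableT_comp.
  move: fi; case: (\int[lam]_x _) => [r||]; rewrite ?ltry ?ltNyr//.
  by rewrite gt0_muley ?lte_fin// ltxx.
- rewrite ge0_integral_normalized//; last exact: measurableT_comp.
  by rewrite lte_mul_pinfty// lee_fin ltW.
Qed.

Lemma integral_normalized (f : E -> R) : lam.-integrable setT (EFin \o f) ->
  (\int[dm]_x f x = c * \int[lam]_x f x)%R.
Proof.
move=> fi; have mf := measurable_int _ fi.
have c0 := normalization_gt0.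
have pf := integrable_fin_num measurableT (integrable_funepos measurableT fi).
have nf := integrable_fin_num measurableT (integrable_funeneg measurableT fi).
rewrite /Rintegral integralE [in RHS]integralE.
rewrite !ge0_integral_normalized//; try exact: measurable_funepos; try exact: measurable_funeneg.
by rewrite -muleBr ?fin_num_adde_defr// fineM// fin_numB pf nf.
Qed.

Lemma sqint_normalized (u : E -> R) : measurable_fun setT u ->
  sqint dm u = c%:E * sqint lam u.
Proof.
move=> mu_; rewrite /sqint ge0_integral_normalized//.
- by apply/measurable_EFinP; exact: measurable_funX.
- by move=> x; rewrite lee_fin sqr_ge0.
Qed.

Lemma csqint_normalized m (f : E -> clifford R m) : cmeasurable f ->
  csqint dm f = c%:E * csqint lam f.
Proof.
move=> mf; rewrite /csqint ge0_sume_distrr; last by move=> I _; exact: sqint_ge0.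
by apply: eq_bigr => I _; exact: sqint_normalized.
Qed.

Lemma sigma_finite_normalized : exists F : nat -> set E,
  [/\ forall k, measurable (F k), nondecreasing_seq F, \bigcup_k F k = setT &
      forall k, dm (F k) < +oo].
Proof.
have /sigma_finiteP[F [FT ndF Foo]] := sigma_finiteT lam.
exists F; split => // k; first by have [] := Foo k.
have c0 := normalization_gt0.
have [mF Fk] := Foo k.
rewrite -[X in dm X]setIT -integral_indic// ge0_integral_normalized//.
- by rewrite integral_indic// setIT lte_mul_pinfty// lee_fin ltW.
- exact/measurable_EFinP/measurable_indic.
Qed.

End normalized_measure.

(** * Norms of the statement in terms of sums of squares *)

Section clifford_Lnorm_csqint.
Local Open Scope ereal_scope.
Variables (R : realType) (n : nat).
Local Notation G := (clifford R (n + n)).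
Local Notation E := ('Eucl[R]_n).
Local Notation dm := (normalized_lebesgue R n).
Implicit Types f g : E -> G.

Lemma clifford_norm_sqr m (a : clifford R m) : (clifford_norm a ^+ 2 = cinner a a)%R.
Proof.
rewrite /clifford_norm sqr_sqrtr; first exact: eq_bigr.
by apply: sumr_ge0 => I _; exact: sqr_ge0.
Qed.

Lemma le_coef_clifford_norm m (a : clifford R m) I : (`|a I| <= clifford_norm a)%R.
Proof.
rewrite -ler_sqr ?nnegrE ?sqrtr_ge0// clifford_norm_sqr real_normK ?num_real//.
by rewrite /cinner (bigD1 I)//= lerDl sumr_ge0// => J _; rewrite -expr2 sqr_ge0.
Qed.

Lemma measurable_clifford_norm f : cmeasurable f ->
  measurable_fun setT (fun x => clifford_norm (f x)).
Proof.
move=> mf; apply: (measurableT_comp (continuous_measurable_fun (@sqrt_continuous R))).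
by apply: measurable_sumr => I; apply: measurable_funX; exact: mf.
Qed.

Lemma clifford_Lnorm2_sqr f : cmeasurable f ->
  clifford_Lnorm 2 f `^ 2 = csqint dm f.
Proof.
move=> mf; rewrite /clifford_Lnorm poweR_Lnorm// csqintE//.
apply: eq_integral => x _.
rewrite -clifford_norm_sqr /= ger0_norm ?sqrtr_ge0//.
by rewrite powR_mulrn ?sqrtr_ge0.
Qed.

Lemma poweR2_lt (x : \bar R) (e : R) : 0 <= x -> (0 < e)%R ->
  (x < e%:E) = (x `^ 2 < (e ^+ 2)%:E).
Proof.
case: x => [r||//] r0 e0; last by rewrite poweRyr// !ltNge !leey.
rewrite poweR_EFin !lte_fin powR_mulrn// ltr_sqr// nnegrE; exact: ltW.
Qed.

Lemma clifford_Lnorm2_lt f (e : R) : cmeasurable f -> (0 < e)%R ->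
  (clifford_Lnorm 2 f < e%:E) = (csqint dm f < (e ^+ 2)%:E).
Proof. by move=> mf e0; rewrite poweR2_lt ?Lnorm_ge0// clifford_Lnorm2_sqr. Qed.

Lemma in_clifford_L2P f : in_clifford_L 2 f <-> csquare_integrable dm f.
Proof.
have P (x : \bar R) : 0 <= x -> (x < +oo) = (x `^ 2 < +oo).
  by case: x => [r||//] r0; [rewrite poweR_EFin !ltry|rewrite poweRyr].
by split => -[mf f2]; split => //; move: f2;
  rewrite -clifford_Lnorm2_sqr// -P// Lnorm_ge0.
Qed.

Lemma in_clifford_L12P f : in_clifford_L 1 f -> in_clifford_L 2 f -> cdom dm f.
Proof.
move=> [mf f1] /in_clifford_L2P f2; split => // I.
apply: (@le_integrable _ _ _ _ _ measurableT _ (fun x => (clifford_norm (f x))%:E)).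
- exact/measurable_EFinP.
- by move=> x _; rewrite /= lee_fin [leRHS]ger0_norm ?sqrtr_ge0// le_coef_clifford_norm.
- apply/integrableP; split; first by apply/measurable_EFinP; exact: measurable_clifford_norm.
  by move: f1; rewrite /clifford_Lnorm Lnorm1.
Qed.

Lemma cdom_in_clifford_L1 f : cdom dm f -> in_clifford_L 1 f.
Proof.
move=> [[mf f2] fi]; split => //.
rewrite /clifford_Lnorm Lnorm1.
apply: (@le_lt_trans _ _ (\int[dm]_x (\sum_I `|f x I|)%:E)).
  under eq_integral do rewrite gee0_abs ?lee_fin ?sqrtr_ge0//.
  apply: le_integral_EFin => [|||x].
  - exact: measurable_clifford_norm.
  - by apply: measurable_sumr => I; exact: measurableT_comp.
  - by move=> x; exact: sqrtr_ge0.
  - rewrite -ler_sqr ?nnegrE ?sqrtr_ge0 ?sumr_ge0// clifford_norm_sqr /cinner.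
    rewrite expr2 mulr_suml; apply: ler_sum => I _.
    rewrite (bigD1 I)//= mulrDr -[X in (X <= _)%R]addr0 lerD//.
      by rewrite -normrM ler_norm.
    by rewrite mulr_ge0// sumr_ge0.
have iS : dm.-integrable setT (fun x => (\sum_I `|f x I|)%:E).
  by apply: integrable_sumr => I; exact: integrable_norm (fi I).
exact: integrable_lty iS.
Qed.

End clifford_Lnorm_csqint.

(** * The Clifford-Fourier transforms *)

Section scalar_part.
Variables (R : realType) (m : nat).
Local Notation G := (clifford R m).
Implicit Types a b c : G.

Lemma cinnerC a b : cinner a b = cinner b a.
Proof. by apply: eq_bigr => I _; rewrite mulrC. Qed.

(** The scalar coefficient pairs e_I only with itself, and there the sign in the reversion is that
    of e_I e_I: the two cancel. *)
Lemma cinner_revl a b : cinner a b = (reversion a * b) finset.set0.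
Proof.
rewrite ffunE; apply: eq_bigr => I _.
by rewrite symdiffs0 ffunE mulrA -exprD addnn -signr_odd odd_double mul1r.
Qed.

Lemma cinner_revr a b : cinner a b = (a * reversion b) finset.set0.
Proof.
rewrite ffunE; apply: eq_bigr => I _.
by rewrite symdiffs0 ffunE mulrACA -exprD addnn -signr_odd odd_double mul1r.
Qed.

Lemma cinner_blade a K : cinner (blade R K) a = a K.
Proof.
rewrite /cinner (bigD1 K)//= big1 ?addr0 => [|I IK].
  by rewrite ffunE eqxx mul1r.
by rewrite ffunE (negPf IK) mul0r.
Qed.

Lemma coef_revM a b K : (reversion a * b) K = cinner a (b * reversion (blade R K)).
Proof.
by rewrite -cinner_blade cinnerC cinner_revr -mulrA cinner_revl.
Qed.

Lemma coef_Mrev a b K : (a * reversion b) K = cinner (reversion (blade R K) * a) b.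
Proof. by rewrite -cinner_blade cinner_revl mulrA -cinner_revr. Qed.

Definition lmul c (a : G) : G := c * a.

Lemma lmul_is_linear c : linear (lmul c).
Proof. by move=> r a b; rewrite /lmul mulrDr scalerAr. Qed.

HB.instance Definition _ c := GRing.isLinear.Build R G G *:%R (lmul c) (lmul_is_linear c).

Definition rmul c (a : G) : G := a * c.

Lemma rmul_is_linear c : linear (rmul c).
Proof. by move=> r a b; rewrite /rmul mulrDl scalerAl. Qed.

HB.instance Definition _ c := GRing.isLinear.Build R G G *:%R (rmul c) (rmul_is_linear c).

End scalar_part.

Section rotor_kernels.
Variables (R : realType) (n : nat).
Local Notation G := (clifford R (n + n)).
Local Notation B := (@bivector R n).
Local Notation sign := {ffun 'I_n -> bool}.
Implicit Types (th : 'I_n -> R) (s : sign) (a b : G).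

Lemma reversion_bivector i : reversion (B i) = - B i.
Proof.
rewrite /bivector reversionM !reversion_vector basis_vector_anticomm//.
by rewrite eq_rlshift.
Qed.

Definition left_op s : {linear G -> G} := lmul (Bprod B s).
(** Reversion appears since the adjoint of left multiplication by c is left multiplication by its
    reversion, and the reversion of rotor th times rotor th' is the reversion of the rotor of th -
    th' ([reversion_rotorM]). *)
Definition left_gram s : {linear G -> G} := lmul (reversion (Bprod B s)).
Definition right_op s : {linear G -> G} := rmul (Bprod B s).
Definition right_gram s : {linear G -> G} := rmul (reversion (Bprod B s)).

Lemma kernel_op_left th a : kernel_op left_op th a = rotor B th * a.
Proof.
rewrite rotorE big_distrl; apply: eq_bigr => s _ /=.
by rewrite -scalerAl.
Qed.

Lemma kernel_op_right th a : kernel_op right_op th a = a * rotor B th.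
Proof.
rewrite rotorE big_distrr; apply: eq_bigr => s _ /=.
by rewrite -scalerAr.
Qed.

Lemma Bprod0 : Bprod B [ffun=> false] = 1.
Proof. by rewrite /Bprod big1// => i _; rewrite ffunE. Qed.

Lemma left_gram0 b : left_gram [ffun=> false] b = b.
Proof. by rewrite /= /lmul Bprod0 reversion1 mul1r. Qed.

Lemma right_gram0 b : right_gram [ffun=> false] b = b.
Proof. by rewrite /= /rmul Bprod0 reversion1 mulr1. Qed.

Lemma cinner_sumr (I : finType) a (F : I -> G) :
  cinner a (\sum_i F i) = \sum_i cinner a (F i).
Proof.
rewrite /cinner exchange_big /=; apply: eq_bigr => J _.
by rewrite sum_ffunE mulr_sumr.
Qed.

Lemma cinnerZr a (r : R) b : cinner a (r *: b) = r * cinner a b.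
Proof.
by rewrite /cinner mulr_sumr; apply: eq_bigr => J _; rewrite Defs.coefZ mulrCA.
Qed.

Lemma reversion_rotorE th : reversion (rotor B th) =
  \sum_s trigprod s th *: reversion (Bprod B s).
Proof.
by rewrite rotorE linear_sum; apply: eq_bigr => s _; rewrite linearZ.
Qed.

Lemma reversion_rotorM th th' : reversion (rotor B th) * rotor B th' =
  reversion (rotor B (fun i => th i - th' i)).
Proof.
have BB := @bivector_sqr R n; have BC := @bivectorC R n.
rewrite !(reversion_rotor BC _ reversion_bivector).
rewrite (rotorM BB BC); congr rotor; apply/funext => i.
by rewrite opprB addrC.
Qed.

Lemma rotorM_reversion th th' : rotor B th * reversion (rotor B th') =
  rotor B (fun i => th i - th' i).
Proof.
have BB := @bivector_sqr R n; have BC := @bivectorC R n.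
rewrite (reversion_rotor BC _ reversion_bivector).
exact: (rotorM BB BC).
Qed.

Lemma left_kernel_opM th th' a b :
  cinner (kernel_op left_op th a) (kernel_op left_op th' b) =
  \sum_s trigprod s (fun i => th i - th' i) * cinner a (left_gram s b).
Proof.
rewrite !kernel_op_left cinner_revl reversionM -mulrA (mulrA (reversion (rotor _ _))).
rewrite reversion_rotorM reversion_rotorE -cinner_revl big_distrl cinner_sumr /=.
by apply: eq_bigr => s _; rewrite -scalerAl cinnerZr.
Qed.

Lemma right_kernel_opM th th' a b :
  cinner (kernel_op right_op th a) (kernel_op right_op th' b) =
  \sum_s trigprod s (fun i => th i - th' i) * cinner a (right_gram s b).
Proof.
rewrite !kernel_op_right cinner_revr reversionM -mulrA (mulrA (rotor _ _)).
rewrite rotorM_reversion -[rotor _ _]reversionK -reversionM -cinner_revr.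
rewrite reversion_rotorE big_distrr cinner_sumr /=.
by apply: eq_bigr => s _; rewrite -scalerAr cinnerZr.
Qed.

Lemma clifford_exp_fourier_form (x y : 'Eucl[R]_n) :
  clifford_exp (- fourier_form x y) = rotor B (hadamard x y).
Proof.
have BB := @bivector_sqr R n; have BC := @bivectorC R n.
apply: has_expE; rewrite /fourier_form -sumrN.
under eq_bigr do rewrite -scaleNr.
exact: (has_exp_rotor BB BC).
Qed.

End rotor_kernels.

Section kernel_int_linear.
Variables (R : realType) (n m : nat).
Local Notation G := (clifford R m).
Local Notation E := ('Eucl[R]_n).
Local Notation sign := {ffun 'I_n -> bool}.
Local Notation lam := (lebesgue_tuple R n).
Variable L : sign -> {linear G -> G}.
Implicit Types f g : E -> G.

Lemma kernel_opB th a b : kernel_op L th (a - b) = kernel_op L th a - kernel_op L th b.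
Proof.
rewrite /kernel_op -sumrB; apply: eq_bigr => s _.
by rewrite linearB scalerBr.
Qed.

Lemma kernel_intB f g y : cintegrable f -> cintegrable g ->
  kernel_int L (fun x => f x - g x) y = kernel_int L f y - kernel_int L g y.
Proof.
move=> fi gi; apply/ffunP => J; rewrite coefB !ffunE.
rewrite -RintegralB//; try exact: integrable_kernel_op.
by apply: eq_Rintegral => x _; rewrite kernel_opB coefB.
Qed.

(** Applied later to multiplication by a constant on the side opposite to the kernel, which commutes
    with [L s] by associativity. *)
Lemma kernel_int_linear (A : {linear G -> G}) f y :
  (forall s a, L s (A a) = A (L s a)) -> cintegrable f ->
  kernel_int L (fun x => A (f x)) y = A (kernel_int L f y).
Proof.
move=> LA fi; apply/ffunP => J; rewrite ffunE linear_coef.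
have ik I : lam.-integrable setT
    (EFin \o (fun x => kernel_op L (hadamard x y) (f x) I)).
  exact: integrable_kernel_op.
transitivity (\sum_I \int[lam]_x
    (kernel_op L (hadamard x y) (f x) I * A (blade R I) J)); last first.
  by apply: eq_bigr => I _; rewrite ffunE RintegralZr//; exact: ik.
rewrite -Rintegral_sum => [|I]; last first.
  rewrite (_ : _ \o _ = (EFin \o (fun x => kernel_op L (hadamard x y) (f x) I)) \*
    cst (A (blade R I) J)%:E)%E; first exact: integrableZr.
  by apply/funext => x; rewrite /= EFinM.
apply: eq_Rintegral => x _; rewrite -linear_coef; congr (fun_of_fin _ J).
rewrite /kernel_op [RHS]linear_sum.
apply: eq_bigr => s _.
by rewrite LA linearZ.
Qed.

End kernel_int_linear.

(** * The normalized transform on the common domain *)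

Section transform.
Variables (R : realType) (n : nat).
Local Notation G := (clifford R (n + n)).
Local Notation E := ('Eucl[R]_n).
Local Notation sign := {ffun 'I_n -> bool}.
Local Notation lam := (lebesgue_tuple R n).
Local Notation dm := (normalized_lebesgue R n).
Local Notation c := (normalization R n).
Variables L M : sign -> {linear G -> G}.
Hypothesis kernel_opM : forall th th' a b,
  cinner (kernel_op L th a) (kernel_op L th' b) =
  \sum_s trigprod s (fun i => th i - th' i) * cinner a (M s b).
Hypothesis M0 : forall b, M [ffun=> false] b = b.
Variable T0 : (E -> G) -> (E -> G).
Hypothesis T0E : forall f y, T0 f y =
  clifford_integral (fun x => kernel_op L (hadamard x y) (f x)).
Implicit Types f g : E -> G.

Lemma cdom_cintegrable f : cdom dm f -> cintegrable f.
Proof. by move=> [_ fi] I; apply/integrable_normalized. Qed.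

Lemma transformE f y : cdom dm f -> T0 f y = c *: kernel_int L f y.
Proof.
move=> /cdom_cintegrable fi; rewrite T0E; apply/ffunP => J.
rewrite Defs.coefZ !ffunE integral_normalized//.
exact: integrable_kernel_op.
Qed.

Lemma transform_measurable f : cdom dm f -> cmeasurable (T0 f).
Proof.
move=> fd J; under eq_fun do rewrite transformE// Defs.coefZ.
apply: measurable_funM => //; apply: measurable_kernel_int => I.
by case: fd => -[mf _] _; exact: mf.
Qed.

(** Both sides carry one factor c from the measure. The transform brings c^2, which cancels the (2
    pi)^n of [kernel_parseval]. *)
Lemma transform_isometry f : cdom dm f -> csqint dm (T0 f) = csqint dm f.
Proof.
move=> fd; have fi := cdom_cintegrable fd; have [[mf f2] _] := fd.
have c0 := normalization_gt0 R n.
have lf2 : (csqint lam f < +oo)%E.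
  move: f2; rewrite csqint_normalized//; have := csqint_ge0 lam f.
  by case: (csqint lam f) => [r||]//; rewrite ?ltry// gt0_muley ?lte_fin.
have mk : cmeasurable (kernel_int L f).
  by move=> J; apply: measurable_kernel_int.
rewrite csqint_normalized; last exact: transform_measurable.
rewrite csqint_normalized//; congr (_ * _)%E.
have -> : csqint lam (T0 f) = ((c ^+ 2)%:E * csqint lam (kernel_int L f))%E.
  rewrite /csqint ge0_sume_distrr; last by move=> J _; exact: sqint_ge0.
  apply: eq_bigr => J _; rewrite /sqint -integralZ_EFin_ge0 ?sqr_ge0//.
  - by apply: eq_integral => y _; rewrite transformE// Defs.coefZ exprMn.
  - exact: measurable_funX.
  - by move=> y; exact: sqr_ge0.
by rewrite (kernel_parseval kernel_opM M0 fi lf2) muleA -EFinM normalization_sqr mul1e.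
Qed.

Lemma transformB f g : cdom dm f -> cdom dm g ->
  T0 (fun x => f x - g x) = (fun x => T0 f x - T0 g x).
Proof.
move=> fd gd; apply/funext => y; rewrite !transformE//; last exact: cdomB.
by rewrite kernel_intB ?scalerBr//; exact: cdom_cintegrable.
Qed.

Lemma cdom_linear (A : {linear G -> G}) f : cdom dm f -> cdom dm (fun x => A (f x)).
Proof.
move=> [[mf f2] fi].
have mA : cmeasurable (fun x => A (f x)) by move=> J; exact: measurable_linear.
split; last first.
  move=> J; apply/integrable_normalized; apply: integrable_linear => I.
  exact/integrable_normalized.
split => //; apply: lte_sum_pinfty => J _.
have good (r : seq {set 'I_(n + n)}) :
    (sqint dm (fun x => \sum_(I <- r) f x I * A (blade R I) J)%R < +oo)%E.
  elim: r => [|I r IH].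
    rewrite /sqint; under eq_integral do rewrite big_nil expr0n.
    by rewrite integral0.
  under [X in sqint _ X]eq_fun do rewrite big_cons.
  apply: (le_lt_trans (sqintD _ _ _)).
  - by apply: measurable_funM.
  - by apply: measurable_sumr => K; exact: measurable_funM.
  rewrite lte_add_pinfty// lte_mul_pinfty//.
  rewrite /sqint; under eq_integral do rewrite exprMn mulrC.
  rewrite integralZ_EFin_ge0 ?sqr_ge0//; last 2 first.
  - exact: measurable_funX.
  - by move=> x; exact: sqr_ge0.
  rewrite lte_mul_pinfty// ?lee_fin ?sqr_ge0//.
  exact: (le_lt_trans (sqint_le_csqint _ _ _) f2).
by under [X in sqint _ X]eq_fun do rewrite linear_coef; exact: good.
Qed.

Lemma transform_linear (A : {linear G -> G}) f :
  (forall s a, L s (A a) = A (L s a)) -> cdom dm f ->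
  T0 (fun x => A (f x)) = (fun y => A (T0 f y)).
Proof.
move=> LA fd; apply/funext => y.
rewrite transformE; last exact: cdom_linear.
by rewrite transformE// kernel_int_linear// ?linearZ//; exact: cdom_cintegrable.
Qed.

End transform.

Section clifford_inner_integral.
Context d (T : measurableType d) (R : realType) (m : nat).
Local Notation G := (clifford R m).
Variable mu : {measure set T -> \bar R}.
Implicit Types f g : T -> G.

Lemma sqint_coef f I : csquare_integrable mu f ->
  measurable_fun setT (fun x => f x I) /\ (sqint mu (fun x => f x I) < +oo)%E.
Proof.
move=> [mf f2]; split; first exact: mf.
exact: (le_lt_trans (sqint_le_csqint _ _ _) f2).
Qed.

Lemma integrable_coefM f g I J : csquare_integrable mu f -> csquare_integrable mu g ->
  mu.-integrable setT (fun x => (f x I * g x J)%:E).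
Proof.
move=> /sqint_coef f2 /sqint_coef g2.
by apply: integrable_mul; [case: (f2 I)|case: (g2 J)|case: (f2 I)|case: (g2 J)].
Qed.

Lemma fine_csqint f : csquare_integrable mu f ->
  fine (csqint mu f) = \int[mu]_x cinner (f x) (f x).
Proof. by move=> [mf _]; rewrite csqintE. Qed.

Lemma integrable_cinner f g : csquare_integrable mu f -> csquare_integrable mu g ->
  mu.-integrable setT (EFin \o (fun x => cinner (f x) (g x))).
Proof. by move=> f2 g2; apply: integrable_sumr => I; exact: integrable_coefM. Qed.

(** Written with the difference f - g alone, because [transformB] makes the transform compatible
    with differences. *)
Lemma polarization f g : csquare_integrable mu f -> csquare_integrable mu g ->
  2 * \int[mu]_x cinner (f x) (g x) =
  fine (csqint mu f) + fine (csqint mu g) - fine (csqint mu (fun x => f x - g x)).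
Proof.
move=> f2 g2; have fg2 := csquare_integrableB f2 g2.
rewrite !fine_csqint//.
rewrite -RintegralD//; try exact: integrable_cinner.
rewrite -RintegralB//; first last.
- exact: integrable_cinner.
- rewrite (_ : _ \o _ = (EFin \o (fun x => cinner (f x) (f x))) \+
    (EFin \o (fun x => cinner (g x) (g x))))%E//.
  by apply: integrableD => //; exact: integrable_cinner.
rewrite -RintegralZl//; last exact: integrable_cinner.
apply: eq_Rintegral => x _; rewrite /cinner mulr_sumr -big_split -sumrB.
by apply: eq_bigr => I _; rewrite coefB /=; ring.
Qed.

Lemma Rintegral_cinner_linear (A : {linear G -> G}) f g :
  csquare_integrable mu f -> csquare_integrable mu g ->
  \int[mu]_x cinner (f x) (A (g x)) =
  \sum_I \sum_J A (blade R J) I * \int[mu]_x (f x I * g x J).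
Proof.
move=> f2 g2.
have iZ I J : mu.-integrable setT
    (EFin \o (fun x => A (blade R J) I * (f x I * g x J))).
  rewrite (_ : _ \o _ = (fun x => (A (blade R J) I)%:E * (f x I * g x J)%:E)%E)//.
  by apply: integrableZl => //; exact: integrable_coefM.
transitivity (\int[mu]_x \sum_I \sum_J A (blade R J) I * (f x I * g x J)).
  apply: eq_Rintegral => x _; apply: eq_bigr => I _.
  rewrite linear_coef mulr_sumr; apply: eq_bigr => J _; ring.
rewrite Rintegral_sum => [|I]; last by apply: integrable_sumr => J; exact: iZ.
apply: eq_bigr => I _; rewrite Rintegral_sum//; apply: eq_bigr => J _.
by rewrite RintegralZl//; exact: integrable_coefM.
Qed.

Lemma cvg_Rintegral_cinner (A : {linear G -> G}) f g (f_ g_ : nat -> T -> G) :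
  csquare_integrable mu f -> csquare_integrable mu g ->
  (forall k, csquare_integrable mu (f_ k)) -> (forall k, csquare_integrable mu (g_ k)) ->
  vanishing (fun k => csqint mu (fun x => f x - f_ k x)) ->
  vanishing (fun k => csqint mu (fun x => g x - g_ k x)) ->
  \int[mu]_x cinner (f_ k x) (A (g_ k x)) @[k --> \oo] -->
  \int[mu]_x cinner (f x) (A (g x)).
Proof.
move=> f2 g2 f_2 g_2 ff gg.
have coefv (h : T -> G) (h_ : nat -> T -> G) I :
    vanishing (fun k => csqint mu (fun x => h x - h_ k x)) ->
    vanishing (fun k => sqint mu (fun x => h x I - h_ k x I)).
  apply: vanishing_le => k; apply: le_trans (sqint_le_csqint _ _ I).
  by under [leRHS]eq_integral do rewrite coefB.
rewrite Rintegral_cinner_linear//.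
under eq_fun do rewrite Rintegral_cinner_linear//.
apply: cvg_sumr => I _; apply: cvg_sumr => J _; apply: cvgM; first exact: cvg_cst.
apply: cvg_Rintegral_mul.
- by case: (sqint_coef I f2).
- by case: (sqint_coef J g2).
- by move=> k; case: (sqint_coef I (f_2 k)).
- by move=> k; case: (sqint_coef J (g_2 k)).
- by case: (sqint_coef I f2).
- by case: (sqint_coef J g2).
- by move=> k; case: (sqint_coef I (f_2 k)).
- by move=> k; case: (sqint_coef J (g_2 k)).
- exact: coefv.
- exact: coefv.
Qed.

End clifford_inner_integral.

(** * Plancherel identity for any continuous extension *)

Section plancherel.
Variables (R : realType) (n : nat).
Local Notation G := (clifford R (n + n)).
Local Notation E := ('Eucl[R]_n).
Local Notation sign := {ffun 'I_n -> bool}.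
Local Notation dm := (normalized_lebesgue R n).
Variables L M : sign -> {linear G -> G}.
Hypothesis kernel_opM : forall th th' a b,
  cinner (kernel_op L th a) (kernel_op L th' b) =
  \sum_s trigprod s (fun i => th i - th' i) * cinner a (M s b).
Hypothesis M0 : forall b, M [ffun=> false] b = b.
Variable T0 : (E -> G) -> (E -> G).
Hypothesis T0E : forall f y, T0 f y =
  clifford_integral (fun x => kernel_op L (hadamard x y) (f x)).
Implicit Types f g : E -> G.

Lemma continuous_extension_exists : exists S, continuous_L2_extension T0 S.
Proof.
have [F [mF ndF FT Foo]] := sigma_finite_normalized R n.
have [S S2 [ST0 SB]] := extension_exists mF ndF FT Foo
  (transform_measurable T0E) (transform_isometry kernel_opM M0 T0E)
  (transformB T0E).
exists S; split => [f|f f1 f2|f].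
- by move=> /in_clifford_L2P f2; apply/in_clifford_L2P; exact: S2.
- by apply: ST0; exact: in_clifford_L12P.
(* A factor 16 between squares is a factor 4 between norms. *)
- move=> /in_clifford_L2P f2 e e0; exists (e / 4); first by rewrite divr_gt0.
  move=> g /in_clifford_L2P g2.
  have [mfg _] := csquare_integrableB f2 g2.
  have [mSfg _] := csquare_integrableB (S2 _ f2) (S2 _ g2).
  rewrite !clifford_Lnorm2_lt ?divr_gt0// => fg.
  apply: (le_lt_trans (SB _ _ f2 g2)).
  rewrite (_ : e ^+ 2 = 16 * (e / 4) ^+ 2); last by field.
  by rewrite EFinM lte_pmul2l// lte_fin.
Qed.

Variable S : (E -> G) -> (E -> G).
Hypothesis ST0 : continuous_L2_extension T0 S.

Lemma transform_square_integrable f : cdom dm f -> csquare_integrable dm (T0 f).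
Proof.
move=> fd; split; first exact: (transform_measurable T0E).
by rewrite (transform_isometry kernel_opM M0 T0E)//; case: fd => -[].
Qed.

Lemma extension_square_integrable f :
  csquare_integrable dm f -> csquare_integrable dm (S f).
Proof. by case: ST0 => S2 _ _ /in_clifford_L2P/S2/in_clifford_L2P. Qed.

(** S and T0 agree almost everywhere at each f_k, so the continuity of S at f passes to T0 (f_k). *)
Lemma extension_vanishing f (f_ : nat -> E -> G) : csquare_integrable dm f ->
  (forall k, cdom dm (f_ k)) ->
  vanishing (fun k => csqint dm (fun x => f x - f_ k x)) ->
  vanishing (fun k => csqint dm (fun x => S f x - T0 (f_ k) x)).
Proof.
move=> f2 f_d fv e e0; have [_ ST Sc] := ST0.
(* Continuity is about norms and [vanishing] about squares, whence the root of e and the square of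
   d; half of d^2 turns a weak bound into the strict one required. *)
have s0 : 0 < Num.sqrt e by rewrite sqrtr_gt0.
have f2' : in_clifford_L 2 f by exact/in_clifford_L2P.
have [d d0 dP] := Sc f f2' _ s0.
have d20 : 0 < d ^+ 2 / 2 by rewrite divr_gt0// exprn_gt0.
apply: filterS (fv _ d20) => k fk.
have f_k2 : csquare_integrable dm (f_ k) by case: (f_d k).
have f_k2' : in_clifford_L 2 (f_ k) by exact/in_clifford_L2P.
have Sf2 := extension_square_integrable f2.
have Sfk2 := extension_square_integrable f_k2.
have Tfk2 := transform_square_integrable (f_d k).
have [mSf _] := Sf2; have [mSfk _] := Sfk2; have [mTfk _] := Tfk2.
have ae := ST _ (cdom_in_clifford_L1 (f_d k)) f_k2'.
rewrite -(csqint_ae_eq mSfk mTfk mSf ae).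
have [mfk _] := csquare_integrableB f2 f_k2.
have [mSfk' _] := csquare_integrableB Sf2 Sfk2.
have := dP _ f_k2'; rewrite !clifford_Lnorm2_lt// sqr_sqrtr ?(ltW e0)// => h.
apply/ltW/h; apply: (le_lt_trans fk).
by rewrite lte_fin ltr_pdivrMr// ltr_pMr ?ltr1n// exprn_gt0.
Qed.

Variable A : {linear G -> G}.
Hypothesis LA : forall s a, L s (A a) = A (L s a).

(** Since T0 commutes with A, the left side pairs T0 f with T0 (A g); the isometry preserves each
    term of [polarization]. *)
Lemma transform_inner f g : cdom dm f -> cdom dm g ->
  \int[dm]_x cinner (T0 f x) (A (T0 g x)) = \int[dm]_x cinner (f x) (A (g x)).
Proof.
move=> fd gd; have Agd := cdom_linear A gd.
have TA := transform_linear T0E LA gd.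
have := polarization (transform_square_integrable fd) (transform_square_integrable Agd).
rewrite -(transformB T0E)// !(transform_isometry kernel_opM M0 T0E)//; last exact: cdomB.
have [f2 _] := fd; have [Ag2 _] := Agd.
rewrite -polarization// TA => h.
by apply: (@mulfI _ (2 : R)); rewrite ?pnatr_eq0.
Qed.

(** Along approximations from the common domain, both sides are limits of one and the same sequence,
    by [transform_inner]. *)
Lemma plancherel f g : csquare_integrable dm f -> csquare_integrable dm g ->
  \int[dm]_x cinner (f x) (A (g x)) = \int[dm]_x cinner (S f x) (A (S g x)).
Proof.
move=> f2 g2.
have [F [mF ndF FT Foo]] := sigma_finite_normalized R n.
have geo0 : vanishing (fun k => (4^-1 * (8^-1) ^+ k : R)%:E).
  apply: cvg0_vanishing; apply: cvg_EFin; first exact: nearW.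
  by apply: (@cvg_geometric R 4^-1 8^-1); rewrite ger0_norm ?invr_ge0//; lra.
have [f_ [f_d ff]] := cdom_seq mF ndF FT Foo f2.
have [g_ [g_d gg]] := cdom_seq mF ndF FT Foo g2.
have fv : vanishing (fun k => csqint dm (fun x => f x - f_ k x)).
  exact: vanishing_le ff geo0.
have gv : vanishing (fun k => csqint dm (fun x => g x - g_ k x)).
  exact: vanishing_le gg geo0.
have f_2 k : csquare_integrable dm (f_ k) by case: (f_d k).
have g_2 k : csquare_integrable dm (g_ k) by case: (g_d k).
have cv : \int[dm]_x cinner (f_ k x) (A (g_ k x)) @[k --> \oo] -->
    \int[dm]_x cinner (f x) (A (g x)).
  exact: cvg_Rintegral_cinner.
have Scv : \int[dm]_x cinner (T0 (f_ k) x) (A (T0 (g_ k) x)) @[k --> \oo] -->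
    \int[dm]_x cinner (S f x) (A (S g x)).
  apply: cvg_Rintegral_cinner.
  - exact: extension_square_integrable.
  - exact: extension_square_integrable.
  - by move=> k; exact: transform_square_integrable.
  - by move=> k; exact: transform_square_integrable.
  - exact: extension_vanishing.
  - exact: extension_vanishing.
have TE k : \int[dm]_x cinner (T0 (f_ k) x) (A (T0 (g_ k) x)) =
    \int[dm]_x cinner (f_ k x) (A (g_ k x)).
  exact: transform_inner.
by move: Scv; rewrite (funext TE) => /(cvg_unique _ cv); exact.
Qed.

End plancherel.

Section fourier.
Variables (R : realType) (n : nat).
Local Notation G := (clifford R (n + n)).
Local Notation E := ('Eucl[R]_n).
Implicit Types f g : E -> G.

Lemma fourier_left_L1E f y : fourier_left_L1 f y =
  clifford_integral (fun x => kernel_op (@left_op R n) (hadamard x y) (f x)).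
Proof.
congr clifford_integral; apply/funext => x.
by rewrite clifford_exp_fourier_form kernel_op_left.
Qed.

Lemma fourier_right_L1E f y : fourier_right_L1 f y =
  clifford_integral (fun x => kernel_op (@right_op R n) (hadamard x y) (f x)).
Proof.
congr clifford_integral; apply/funext => x.
by rewrite clifford_exp_fourier_form kernel_op_right.
Qed.

(** [xget] falls back on the zero operator when no extension exists; existence therefore precedes
    every property of [fourier_left]. *)
Lemma fourier_left_extension :
  continuous_L2_extension (@fourier_left_L1 R n) (@fourier_left R n).
Proof.
have [S SP] := continuous_extension_exists (@left_kernel_opM R n) (@left_gram0 R n)
  fourier_left_L1E.
by apply: (@xgetPex _ (fun=> fun=> 0) (continuous_L2_extension _)); exists S.
Qed.

Lemma fourier_right_extension :
  continuous_L2_extension (@fourier_right_L1 R n) (@fourier_right R n).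
Proof.
have [S SP] := continuous_extension_exists (@right_kernel_opM R n) (@right_gram0 R n)
  fourier_right_L1E.
by apply: (@xgetPex _ (fun=> fun=> 0) (continuous_L2_extension _)); exists S.
Qed.

(** A constant on the right commutes with a kernel on the left; c will be the reversion of a basis
    element, one for each coefficient. *)
Lemma fourier_left_plancherel f g (c : G) : in_clifford_L 2 f -> in_clifford_L 2 g ->
  \int[normalized_lebesgue R n]_x cinner (f x) (g x * c) =
  \int[normalized_lebesgue R n]_x cinner (fourier_left f x) (fourier_left g x * c).
Proof.
move=> /in_clifford_L2P f2 /in_clifford_L2P g2.
apply: (plancherel (@left_kernel_opM R n) (@left_gram0 R n) fourier_left_L1E
  fourier_left_extension (A := rmul c)) => // s a.
by rewrite /= /lmul /rmul mulrA.
Qed.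

Lemma fourier_right_plancherel f g (c : G) : in_clifford_L 2 f -> in_clifford_L 2 g ->
  \int[normalized_lebesgue R n]_x cinner (f x) (c * g x) =
  \int[normalized_lebesgue R n]_x cinner (fourier_right f x) (c * fourier_right g x).
Proof.
move=> /in_clifford_L2P f2 /in_clifford_L2P g2.
apply: (plancherel (@right_kernel_opM R n) (@right_gram0 R n) fourier_right_L1E
  fourier_right_extension (A := lmul c)) => // s a.
by rewrite /= /lmul /rmul mulrA.
Qed.

End fourier.

Theorem mainTheorem10 (R : realType) (n : nat)
    (f g : 'Eucl[R]_n -> clifford R (n + n))
    (hf : in_clifford_L 2 f) (hg : in_clifford_L 2 g) :
  clifford_integral (fun x => reversion (f x) * g x) =
    clifford_integral
      (fun x => reversion (fourier_left f x) * fourier_left g x) /\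
  clifford_integral (fun x => f x * reversion (g x)) =
    clifford_integral
      (fun x => fourier_right f x * reversion (fourier_right g x)).
Proof.
split; apply/ffunP => K; rewrite !ffunE.
  under eq_Rintegral do rewrite coef_revM.
  under [RHS]eq_Rintegral do rewrite coef_revM.
  exact: fourier_left_plancherel.
(* The constant now multiplies f, so [fourier_right_plancherel] is used with f and g exchanged. *)
under eq_Rintegral do rewrite coef_Mrev cinnerC.
under [RHS]eq_Rintegral do rewrite coef_Mrev cinnerC.
exact: fourier_right_plancherel.
Qed.
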